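(* Let $\alpha=\frac ab\in\,]0,1[$ with $a,b$ coprime positive integers, and let $\Lambda=z_0+\vec\Lambda$ be a $\mathbb{Z}$-grid in $\mathbb{C}$. Let $\phi,\psi:\mathbb{N}\to\,]0,+\infty[$ with $\phi(N)\to+\infty$, $\frac{\phi(N)}{N^{1-\alpha}}\to\lambda\in[0,+\infty]$, and $\psi(N)=\big(\frac{N^{2-\alpha}}{\phi(N)}\big)^2$. Define, for $N\geq1$, $$\mathcal{R}^{\alpha,\Lambda}_{N,0,b}=\frac{1}{b\,\psi(N)}\sum_{\substack{m,n\in\Lambda,\ n\neq m\\ 0<|m|,|n|\leq N}}\ \sum_{\substack{r\in\exp^{-1}(m),\ s\in\exp^{-1}(n)\\ |\mathrm{Im}(r)-\mathrm{Im}(s)|<2\pi\\ 0\leq \mathrm{Im}(r),\mathrm{Im}(s)<2\pi b}}\Delta_{\phi(N)(\exp(\alpha s)-\exp(\alpha r))}.$$ Then $\mathcal{R}^{\alpha,\Lambda}_{N,0,b}$ converges vaguely to $\rho_{\alpha,\vec\Lambda,\lambda}\,\mathrm{Leb}_{\mathbb{C}}$ as $N\to\infty$.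
   Context: $\Delta_w$ is the Dirac mass at $w$; $\exp^{-1}(m)$ is the set of complex logarithms of $m$. $\mathrm{covol}_{\vec\Lambda}$ is the area of a fundamental parallelogram of $\vec\Lambda$. The function $\rho_{\alpha,\vec\Lambda,\lambda}$ is: $0$ if $\lambda=+\infty$; the constant $\frac{\pi}{\alpha^2(2-\alpha)\mathrm{covol}_{\vec\Lambda}^2}$ if $\lambda=0$; and for $\lambda\in\,]0,\infty[$, $\rho(z)=\frac{\alpha^{\frac{2}{1-\alpha}}}{(1-\alpha)\mathrm{covol}_{\vec\Lambda}}(|z|/\lambda)^{-\frac{4-2\alpha}{1-\alpha}}\sum_{p\in\vec\Lambda,\ |p|\leq |z|/(\alpha\lambda)}|p|^{\frac{2}{1-\alpha}}$ (and $0$ at $z=0$). Vague convergence means convergence of integrals against every continuous compactly supported function. *)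

(* Defs.v *)
From HB Require Import structures.
From mathcomp Require Import all_boot all_order all_algebra.
From mathcomp Require Import all_classical all_reals all_analysis.
From mathcomp Require Import complex.

Set Implicit Arguments.
Unset Strict Implicit.
Unset Printing Implicit Defensive.

Import Order.TTheory GRing.Theory Num.Theory numFieldNormedType.Exports.

Local Open Scope classical_set_scope.
Local Open Scope ring_scope.
Local Open Scope complex_scope.

(* Algebra takes place in R[i]; the topology, the Borel sigma-algebra and the
   Lebesgue measure of the complex plane are those of R * R, through the
   identification x + iy <-> (x, y). *)
Notation plane R := (measurableTypeR R * measurableTypeR R)%type.

Section ComplexPlane.
Variable R : realType.

Definition plane_of (z : R[i]) : plane R := (complex.Re z, complex.Im z).

Definition complex_of (x : plane R) : R[i] := x.1 +i* x.2.

Definition modulus (z : R[i]) : R := ComplexField.Normc.normc z.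

Definition Leb : {measure set (plane R) -> \bar R} :=
  (@lebesgue_measure R \x @lebesgue_measure R)%E.

Definition expC (z : R[i]) : R[i] :=
  (expR (complex.Re z))%:C * (cos (complex.Im z) +i* sin (complex.Im z)).

Definition logs (m : R[i]) : set R[i] := [set r | expC r = m].

(* mu and nu are bare set functions, which \int accepts; pair_measure and
   with_density (rho _ _ _ _) Leb below are measures when psi > 0,
   0 < alpha < 1 and w1, w2 are R-independent. *)
Definition vague_cvg (mu : nat -> set (plane R) -> \bar R)
    (nu : set (plane R) -> \bar R) :=
  forall f : R * R -> R, continuous f ->
    compact (closure [set x | f x != 0]) ->
    (fun N => \int[mu N]_x (f x)%:E : \bar R)%E @ \oo --> (\int[nu]_x (f x)%:E)%E.

Definition with_density (g : plane R -> R) (mu : set (plane R) -> \bar R)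
    (A : set (plane R)) : \bar R :=
  (\int[mu]_(x in A) (g x)%:E)%E.

End ComplexPlane.

Section Grids.
Variable R : realType.

Definition real_independent (w1 w2 : R[i]) :=
  forall x y : R, x%:C * w1 + y%:C * w2 = 0 -> x = 0 /\ y = 0.

Definition lattice (w1 w2 : R[i]) : set R[i] :=
  [set p | exists k l : int, p = k%:~R * w1 + l%:~R * w2].

Definition grid (z0 w1 w2 : R[i]) : set R[i] :=
  [set z0 + p | p in lattice w1 w2].

Definition parallelogram (w1 w2 : R[i]) : set (plane R) :=
  [set x | exists s t : R, [/\ 0 <= s < 1, 0 <= t < 1 &
    x = plane_of (s%:C * w1 + t%:C * w2)]].

Definition covol (w1 w2 : R[i]) : R := fine (Leb R (parallelogram w1 w2)).

End Grids.

Section PairCorrelation.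
Variable R : realType.

Definition pair_index (L : set R[i]) (b N : nat) :
    set (R[i] * R[i] * R[i] * R[i]) :=
  [set q | let: (m, n, r, s) := q in
    [/\ L m /\ L n, n <> m, 0 < modulus m <= N%:R /\ 0 < modulus n <= N%:R,
        logs m r /\ logs n s &
        [/\ `|complex.Im r - complex.Im s| < 2 * pi, 0 <= complex.Im r < 2 * pi * b%:R &
            0 <= complex.Im s < 2 * pi * b%:R]]].

Definition pair_point (alpha c : R) (q : R[i] * R[i] * R[i] * R[i]) : plane R :=
  let: (_, _, r, s) := q in
  plane_of (c%:C * (expC (alpha%:C * s) - expC (alpha%:C * r))).

Definition pair_measure (alpha : R) (L : set R[i]) (phi psi : nat -> R)
    (b N : nat) (A : set (plane R)) : \bar R :=
  (((b%:R * psi N)^-1)%:E *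
   \esum_(q in pair_index L b N) \d_(pair_point alpha (phi N) q) A)%E.

(* Only lam in [0, +oo] is meaningful; the value at -oo is junk. *)
Definition rho (alpha : R) (w1 w2 : R[i]) (lam : \bar R) (x : plane R) : R :=
  match lam with
  | EFin l =>
    if l == 0 then pi / (alpha ^+ 2 * (2 - alpha) * covol w1 w2 ^+ 2)
    else
      let t := modulus (complex_of x) in
      if t == 0 then 0
      else alpha `^ (2 / (1 - alpha)) / ((1 - alpha) * covol w1 w2)
        * (t / l) `^ (- ((4 - 2 * alpha) / (1 - alpha)))
        * \sum_(p \in [set p | lattice w1 w2 p /\
                               modulus p <= t / (alpha * l)])
            modulus p `^ (2 / (1 - alpha))
  | _ => 0
  end.

End PairCorrelation.

(* Main.v *)
Require Import Defs.
From HB Require Import structures.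
From mathcomp Require Import all_boot all_order all_algebra.
From mathcomp Require Import all_classical all_reals all_analysis.
From mathcomp Require Import measurable_realfun complex ring lra zify.

(** Write f >= 0 for a continuous compactly supported test function and index
  the logarithms of m, n by their sheets k, l < b.  With p = n - m the value
  phi(N) (exp (alpha s) - exp (alpha r)) is close to
  alpha (phi(N) / N^(1-alpha)) p exp ((alpha - 1) Log_k (m / N)) when k = l, and
  leaves every compact set when k <> l (off the real axis).  Hence the double
  sum over the grid is a Riemann sum: N^-2 times the sum over m tends to an
  integral over the unit disc in z = m / N, while the inner sum over p is
  negligible if lam = +oo, a second Riemann sum if lam = 0, and stays a sum over
  finitely many p in the lattice if 0 < lam < +oo.  Dominated convergence over
  the cells of the grid makes this rigorous.

  In the last case summing over the b sheets turns the angular integral over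
  [0, 2 pi b[ of a 2 pi-periodic function of (1 - alpha) theta into b full turns,
  because (1 - alpha) b = b - a is an integer; in log-polar coordinates the
  radial substitution t = ln |alpha lam p| - (1 - alpha) u then produces the
  density rho term by term. *)

Set Implicit Arguments.
Unset Strict Implicit.
Unset Printing Implicit Defensive.

Import Order.TTheory GRing.Theory Num.Theory numFieldNormedType.Exports.

Local Open Scope classical_set_scope.
Local Open Scope ring_scope.
Local Open Scope complex_scope.

(** Each sum is rewritten as the integral of a function constant on small squares, so that the
    passage to the limit is dominated convergence, once for the inner sum at fixed z and once for
    the outer sum. The obstacle is the domination: f controls exp (alpha s) - exp (alpha r), not n -
    m. As |Im r - Im s| < 2 pi and alpha < 1, the number alpha (s - r) stays away from the nonzero
    multiples of 2 i pi, so exp (alpha (s - r)) is near 1 only if s - r is near 0. This yields |n -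
    m| <= K N^(1-alpha) |exp (alpha s) - exp (alpha r)|, and multiplying by phi(N) confines p to a
    disc of radius D / [mesh N], uniformly in m and in the sheets. Pointwise convergence is proved
    where the logarithm is continuous and the condition |m| <= N is stable: off the real axis and
    the unit circle, both null sets. Up to the last proof test functions are nonnegative, so Tonelli
    and monotone convergence apply freely; finiteness of the limits is recorded because it allows
    the subtraction f = f^+ - f^- in the extended reals. *)

(** * Integration against a measure with a density *)

Section Density.
Local Open Scope ereal_scope.
Context d (T : measurableType d) (R : realType).
Variables (mu : {measure set T -> \bar R}) (g : T -> R).
Hypothesis mg : measurable_fun setT g.
Hypothesis g0 : forall x, (0 <= g x)%R.

Definition density_measure (A : set T) : \bar R := \int[mu]_(x in A) (g x)%:E.

Let density0 : density_measure set0 = 0.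
Proof. by rewrite /density_measure integral_set0. Qed.

Let density_ge0 A : 0 <= density_measure A.
Proof. by apply: integral_ge0 => x _; rewrite lee_fin. Qed.

Let density_sigma_additive : semi_sigma_additive density_measure.
Proof.
move=> /= F mF tF mUF; rewrite /density_measure; apply: cvg_toP.
  apply: ereal_nondecreasing_is_cvgn => m n mn.
  by apply: lee_sum_nneg_natr => // k _ _; exact: density_ge0.
rewrite ge0_integral_bigcup//=.
- by apply/measurable_EFinP/measurable_funTS.
- by move=> x _; rewrite lee_fin.
Qed.

Let density_mixin := isMeasure.Build _ _ _ density_measure
  density0 density_ge0 density_sigma_additive.
Definition density_pack : {measure set T -> \bar R} :=
  HB.pack density_measure density_mixin.

Import HBNNSimple.

(** True for indicators by hypothesis, hence for simple functions by additivity, hence for f by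
    monotone convergence on both sides. *)
Lemma ge0_integral_density (nu : {measure set T -> \bar R}) (f : T -> \bar R) :
  (forall A, measurable A -> nu A = density_measure A) ->
  measurable_fun setT f -> (forall x, 0 <= f x) ->
  \int[nu]_x f x = \int[mu]_x (f x * (g x)%:E).
Proof.
move=> nuE mf f0.
pose f_ := nnsfun_approx measurableT mf.
have cf x : (f_ n x)%:E @[n --> \oo] --> f x.
  by apply: cvg_nnsfun_approx => // y _; exact: f0.
have ndf x : nondecreasing_seq (fun n => (f_ n x)%:E).
  by move=> m n mn; rewrite lee_fin; exact/lefP/nd_nnsfun_approx.
transitivity (limn (fun n => \int[nu]_x (f_ n x)%:E)).
  rewrite -monotone_convergence//=.
  - by apply: eq_integral => y _; apply/esym/cvg_lim => //; exact: cf.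
  - by move=> n; exact/measurable_EFinP/measurable_funP.
  - by move=> n y _; rewrite lee_fin.
transitivity (limn (fun n => \int[mu]_x ((f_ n x)%:E * (g x)%:E))); last first.
  rewrite -monotone_convergence//=.
  - apply: eq_integral => y _; apply/cvg_lim => //.
    by apply: cvgeZr => //; exact: cf.
  - move=> n; apply: emeasurable_funM; last exact/measurable_EFinP.
    exact/measurable_EFinP/measurable_funP.
  - by move=> n y _; rewrite mule_ge0// lee_fin.
  - by move=> y _ m n mn; apply: lee_wpmul2r; rewrite ?lee_fin//; exact: ndf.
congr (limn _); apply/funext => n.
have mA r : measurable (f_ n @^-1` [set r]) by [].
under eq_integral do rewrite fimfunE -fsumEFin//.
rewrite ge0_integral_fsum//; last 2 first.
- by move=> y; exact/measurable_EFinP/measurable_funM.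
- by move=> y x _; rewrite nnfun_muleindic_ge0.
transitivity (\int[mu]_x (\sum_(i \in range (f_ n))
    ((i * \1_(f_ n @^-1` [set i]) x)%:E * (g x)%:E))); last first.
  apply: eq_integral => x _; rewrite -ge0_mule_fsuml; last first.
    by move=> y; rewrite nnfun_muleindic_ge0.
  by rewrite fsumEFin// -fimfunE.
rewrite ge0_integral_fsum//; last 2 first.
- move=> y; apply: emeasurable_funM; last exact/measurable_EFinP.
  exact/measurable_EFinP/measurable_funM.
- by move=> y x _; rewrite mule_ge0 ?lee_fin//; rewrite -lee_fin nnfun_muleindic_ge0.
apply: eq_fsbigr => r; rewrite inE => -[x0 _ fx0].
have r0 : (0 <= r)%R by rewrite -fx0.
rewrite integralZl_indic_nnsfun// integral_indic//= setIT nuE// /density_measure.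
rewrite integral_mkcond/=.
under [RHS]eq_integral do rewrite EFinM -muleA.
rewrite ge0_integralZl//; first last.
- by move=> x _; rewrite mule_ge0 ?lee_fin.
- by apply: emeasurable_funM; exact/measurable_EFinP.
congr (_ * _); apply: eq_integral => x _.
by rewrite patchE indicE; case: ifPn; rewrite ?mul1e ?mul0e.
Qed.

End Density.

(** * Change of variables on the line *)

Section MeasureOcitv.
Context {R : realType}.
Local Open Scope ereal_scope.

(** Intervals ]a, b] form a pi-system generating the Borel sets, and the intervals ]-(n+1), n+1], of
    finite measure, exhaust the line. *)
Lemma measure_ocitv_unique (m1 m2 : {measure set (measurableTypeR R) -> \bar R}) :
  (forall a b : R, (a < b)%R -> m1 `]a, b]%classic = m2 `]a, b]%classic) ->
  (forall a b : R, (a < b)%R -> m1 `]a, b]%classic < +oo) ->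
  forall A, measurable A -> m1 A = m2 A.
Proof.
move=> m12 m1oo A mA.
have m12' (X : set R) : ocitv X -> m1 X = m2 X.
  move=> /ocitvP[->|[[a b] /= ab ->]]; first by rewrite !measure0.
  exact: m12.
refine (@measure_unique _ R (measurableTypeR R) (@ocitv R)
  (fun n : nat => `](- n.+1%:R)%R, n.+1%:R%R]%classic) _ _ _ _ m1 m2 _ _ A mA) => //.
- exact: ocitvI.
- by move=> n; exact: is_ocitv.
- rewrite -subTset => x _; exists (Num.truncn `|x|%R) => //=.
  have := truncnS_gt `|x|%R; rewrite ltr_norml in_itv/= => /andP[-> /ltW ->].
  by [].
- by move=> n; apply: m1oo; rewrite (@lt_trans _ _ 0%R) ?oppr_lt0 ?ltr0n.
Qed.

End MeasureOcitv.

Section Substitution.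
Context {R : realType}.
Local Open Scope ereal_scope.
Notation mu := (@lebesgue_measure R).
Variables (F F' G : R -> R) (I : set R).
Hypothesis mI : measurable I.
Hypothesis ndF : {mono F : x y / (x < y)%R}.
Hypothesis dF : forall x, is_derive x (1%R : R) F (F' x).
Hypothesis cF' : continuous F'.
Hypothesis F'0 : forall x, (0 <= F' x)%R.
Hypothesis IF : forall x, I (F x).
Hypothesis FG : forall y, I y -> F (G y) = y.
Hypothesis I_convex : forall x y z, (x <= y <= z)%R -> I x -> I z -> I y.

Let leF : {mono F : x y / (x <= y)%R}.
Proof. by move=> x y; rewrite !leNgt ndF. Qed.

Let mG : measurable_fun (I : set (measurableTypeR R)) (G : measurableTypeR R -> measurableTypeR R).
Proof.
move=> _; apply: (measurability _ (RGenOInfty.measurableE R)) => //.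
move=> /= _ [_ [x ->] <-].
rewrite [X in measurable X](_ : _ = I `&` `]F x, +oo[%classic); first exact: measurableI.
apply/seteqP; split => y/= [Iy]; rewrite !in_itv/= !andbT => h; split => //.
  by rewrite -(FG Iy) ndF.
by rewrite -ndF FG.
Qed.

(** The inverse of F made total: its value 0 outside I is harmless, since [m0] does not charge the
    complement of I. *)
Let GI := (G \_ I) : measurableTypeR R -> measurableTypeR R.

Let mGI : measurable_fun setT GI.
Proof. by apply/(measurable_restrictT (T1 := measurableTypeR R) (T2 := measurableTypeR R) _ mI); exact: mG. Qed.

Let indic0 (x : R) : (0 <= \1_I x :> R)%R. Proof. by []. Qed.

Let m0 : {measure set (measurableTypeR R) -> \bar R} :=
  @density_pack _ (measurableTypeR R) R mu (\1_I) (measurable_indic mI) indic0.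

Let mF : measurable_fun setT F.
Proof.
apply: continuous_measurable_fun => x.
by apply/differentiable_continuous/derivable1_diffP; case: (dF x).
Qed.

Let m1 : {measure set (measurableTypeR R) -> \bar R}.
Proof. refine [the {measure set _ -> \bar R} of pushforward m0 GI]. exact: mGI. Defined.

Let m2 : {measure set (measurableTypeR R) -> \bar R} :=
  @density_pack _ (measurableTypeR R) R mu F' (continuous_measurable_fun cF') F'0.

Let FTC a b : (a < b)%R -> \int[mu]_(x in `]a, b]) (F' x)%:E = (F b - F a)%:E.
Proof.
move=> ab; have cF x : {for x, continuous F}.
  by apply/differentiable_continuous/derivable1_diffP; case: (dF x).
rewrite integral_itv_obnd_cbnd; last first.
  apply/measurable_EFinP; apply: measurable_funTS; exact: continuous_measurable_fun.
rewrite (@continuous_FTC2 _ F' F)//.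
- exact: continuous_subspaceT.
- split; first by move=> x _; case: (dF x).
  + by apply: cvg_at_right_filter; exact: cF.
  + by apply: cvg_at_left_filter; exact: cF.
- by move=> x _; rewrite derive1E; apply: derive_val.
Qed.

Let m1E a b : (a < b)%R -> m1 `]a, b]%classic = (F b - F a)%:E.
Proof.
move=> ab; rewrite /m1 /= /pushforward/= /density_measure.
rewrite integral_indic//; last first.
  by rewrite -[X in measurable X]setTI; exact: mGI.
rewrite (_ : I `&` _ = `]F a, F b]%classic).
  rewrite -[LHS]/(lebesgue_measure [set` `]F a, F b]%R]).
  by rewrite lebesgue_measure_itv/= lte_fin ndF ab EFinB.
apply/seteqP; split => y/=; rewrite !in_itv/=.
  by move=> [Iy]; rewrite /GI patchE mem_set// -ndF -leF FG.
move=> /andP[h1 h2]; have Iy : I y by apply: (@I_convex (F a) y (F b)); rewrite // (ltW h1).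
by split => //; rewrite /GI patchE mem_set// -ndF -leF FG// h1.
Qed.

(** The image [m1] of Lebesgue measure on I under the inverse of F and the measure [m2] = F' dx both
    give mass F b - F a to ]a, b], hence coincide; the formula is the integral of k \o F against
    each of them. *)
Lemma ge0_integral_substitution (k : R -> \bar R) :
  measurable_fun setT k -> (forall x, 0 <= k x) ->
  \int[mu]_(y in I) k y = \int[mu]_x (k (F x) * (F' x)%:E).
Proof.
move=> mk k0.
have m12 : forall A, measurable A -> m1 A = m2 A.
  apply: measure_ocitv_unique => a b ab; rewrite m1E//= ?ltry//.
  by rewrite /density_measure FTC.
have mkF : measurable_fun setT (k \o F) by exact: measurableT_comp.
have kF0 x : 0 <= (k \o F) x by exact: k0.
rewrite -[RHS](@ge0_integral_density _ _ _ mu _ (continuous_measurable_fun cF') F'0 m2 (k \o F))//.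
transitivity (\int[m1]_x (k \o F) x); last first.
  by apply: eq_measure_integral => A mA _; exact: m12.
rewrite ge0_integral_pushforward// preimage_setT.
rewrite (@ge0_integral_density _ _ _ mu _ (measurable_indic mI) _ m0)//; last first.
- by move=> x; exact: kF0.
- by apply: measurableT_comp => //.
rewrite [LHS]integral_mkcond; apply: eq_integral => x _.
rewrite patchE indicE /GI/= patchE; case: ifPn => xI; rewrite ?mule0// mule1 FG//.
exact/set_mem.
Qed.

End Substitution.

Section OneDim.
Context {R : realType}.
Local Open Scope ereal_scope.
Notation mu := (@lebesgue_measure R).

Lemma ge0_integral_opp (k : R -> \bar R) :
  measurable_fun setT k -> (forall x, 0 <= k x) ->
  \int[mu]_x k (- x)%R = \int[mu]_x k x.
Proof.
move=> mk k0.
rewrite -[LHS]/(\int[mu]_(x in (-%R : _ -> measurableTypeR R) @^-1` setT) k (- x)%R).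
rewrite -[LHS](@ge0_integral_pushforward _ _ (measurableTypeR R) (measurableTypeR R) R (-%R : measurableTypeR R -> measurableTypeR R) _ mu setT k)//.
by apply: eq_measure_integral => //= A mA AS; exact/lebesgue_measureN.
Qed.

(** A positive slope is an increasing substitution; a negative one is reduced to it by the
    reflection x -> - x. *)
Lemma ge0_integral_affine (c d : R) (k : R -> \bar R) : (c != 0)%R ->
  measurable_fun setT k -> (forall x, 0 <= k x) ->
  \int[mu]_x k x = `|c|%:E * \int[mu]_x k (c * x + d)%R.
Proof.
move=> + mk k0.
have pos (c0 d0 : R) (h : R -> \bar R) : (0 < c0)%R ->
  measurable_fun setT h -> (forall x, 0 <= h x) ->
  \int[mu]_x h x = c0%:E * \int[mu]_x h (c0 * x + d0)%R.
  move=> c0p mh h0.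
  have mF : measurable_fun setT (fun x : R => c0 * x + d0)%R.
    by apply: measurable_funD => //; exact: mulrl_measurable.
  have dF (x : R) : is_derive x (1%R : R) (fun x => c0 * x + d0)%R c0.
    by apply: is_derive_eq; rewrite addr0 /GRing.scale/= mulr1.
  rewrite (@ge0_integral_substitution R (fun x => c0 * x + d0)%R (fun=> c0)
     (fun y => (y - d0) / c0)%R setT)//.
  - rewrite ge0_integralZr 1?muleC ?lee_fin ?(ltW c0p)//.
    exact: measurableT_comp mF.
  - by move=> x y; rewrite ltrD2r ltr_pM2l.
  - by move=> x; exact: cvg_cst.
  - by move=> x; rewrite ltW.
  - by move=> y _; rewrite mulrCA divff ?mulr1 ?subrK// gt_eqF.
rewrite neq_lt => /orP[cn|cp]; last by rewrite gtr0_norm// -pos.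
rewrite ltr0_norm// -ge0_integral_opp// (pos (- c)%R (- d)%R)//.
- congr (_ * _); apply: eq_integral => x _; congr (k _).
  by rewrite opprD mulNr !opprK.
- by rewrite oppr_gt0.
- by apply: measurableT_comp => //; exact: oppr_measurable.
Qed.

Lemma ge0_integral_expR (k : R -> \bar R) :
  measurable_fun setT k -> (forall x, 0 <= k x) ->
  \int[mu]_(y in `]0%R, +oo[) k y = \int[mu]_x (k (expR x) * (expR x)%:E).
Proof.
move=> mk k0.
apply: (@ge0_integral_substitution R expR expR (@ln R)) => //.
- exact: ltr_expR.
- exact: continuous_expR.
- by move=> x; rewrite /= in_itv/= andbT expR_gt0.
- by move=> y; rewrite /= in_itv/= andbT => y0; rewrite lnK// posrE.
- move=> x y z /andP[xy yz]; rewrite /= !in_itv/= !andbT => x0 _.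
  exact: lt_le_trans xy.
Qed.

(** Turns the slope x / y of a point of the upper half-plane into an angle. *)
Lemma ge0_integral_atan (k : R -> \bar R) :
  measurable_fun setT k -> (forall x, 0 <= k x) ->
  \int[mu]_(y in [set` `]- (pi / 2), pi / 2[%R]) k y =
  \int[mu]_x (k (atan x) * ((1 + x ^+ 2)^-1)%:E).
Proof.
move=> mk k0.
apply: (@ge0_integral_substitution R (@atan R) _ (@tan R)) => //.
- by apply: leW_mono; apply: le_mono; exact: lt_atan.
- move=> x; apply: cvgV; first by rewrite gt_eqF// ltr_pwDl// sqr_ge0.
  by apply: cvgD; [exact: cvg_cst|exact: exprn_continuous].
- by move=> x; rewrite invr_ge0 addr_ge0// sqr_ge0.
- by move=> x; rewrite /= in_itv/= atan_gtNpi2 atan_ltpi2.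
- by move=> y hy; rewrite tanK//; exact: hy.
- move=> x y z /andP[xy yz]; rewrite /= !in_itv/= => /andP[x0 _] /andP[_ z0].
  by rewrite (lt_le_trans x0 xy) (le_lt_trans yz z0).
Qed.

End OneDim.

(** * Linear changes of variables in the plane *)

Section TwoDim.
Context {R : realType}.
Local Open Scope ereal_scope.
Notation mu := (@lebesgue_measure R).
Implicit Types g : plane R -> \bar R.

Lemma ge0_integral_swap g : measurable_fun setT g -> (forall x, 0 <= g x) ->
  \int[Leb R]_x g (x.2, x.1) = \int[Leb R]_x g x.
Proof.
move=> mg g0; rewrite /Leb fubini_tonelli2//.
  by rewrite fubini_tonelli1.
apply: measurableT_comp => //; apply: measurable_fun_pair; [exact: measurable_snd|exact: measurable_fst].
Qed.

(** With a nonzero pivot the map factors through [h] into two affine substitutions, of ratio a in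
    the first variable and D / a in the second, and Tonelli exchanges the order of integration in
    between. *)
Let lin_aux (a b c d : R) g : (a != 0)%R -> (a * d - b * c != 0)%R ->
  measurable_fun setT g -> (forall x, 0 <= g x) ->
  \int[Leb R]_x g x =
  `|a * d - b * c|%:E * \int[Leb R]_x g (x.1 * a + x.2 * c, x.1 * b + x.2 * d)%R.
Proof.
move=> a0 det0 mg g0; set D := (a * d - b * c)%R.
have mlin (p q : R) : measurable_fun [set: plane R] (fun x : plane R => x.1 * p + x.2 * q)%R.
  by apply: measurable_funD; apply: measurable_funM.
have mg1 s : measurable_fun [set: measurableTypeR R] (fun t => g (s, t)) by exact: measurable_fun_pair2.
rewrite [in RHS]/Leb [in RHS]fubini_tonelli2//=; last first.
  by apply: measurableT_comp => //; apply: measurable_fun_pair; exact: mlin.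
pose h (x : plane R) := g (x.1, x.1 * (b / a) + x.2 * (D / a))%R.
have mh : measurable_fun setT h.
  by apply: measurableT_comp => //; apply: measurable_fun_pair; [exact: measurable_fst|exact: mlin].
have h0 x : 0 <= h x by exact: g0.
have -> : \int[mu]_y fubini_G mu (fun x : plane R => g (x.1 * a + x.2 * c, x.1 * b + x.2 * d)%R) y =
  \int[mu]_t (`|a|^-1%:E * \int[mu]_s h (s, t)).
  apply: eq_integral => t _; rewrite /fubini_G/=.
  rewrite [in RHS](@ge0_integral_affine _ a (t * c)%R (fun s => h (s, t)))//; last exact: (measurable_fun_pair1 t mh).
  rewrite muleA -EFinM mulVf ?normr_eq0// mul1e; apply: eq_integral => s _.
  rewrite /h/= /D; congr (g (_, _)); [ring|by field].
rewrite ge0_integralZl//; first last.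
- by move=> x _; apply: integral_ge0 => s _; exact: h0.
- exact: (measurable_fun_fubini_tonelli_G h).
rewrite muleA -EFinM -normrV ?unitfE// -normrM.
rewrite -[X in _ * X](fubini_tonelli h)//= fubini_tonelli1//.
rewrite -ge0_integralZl//; first last.
- by move=> x _; apply: integral_ge0 => s _; exact: h0.
- exact: (measurable_fun_fubini_tonelli_F h).
apply: eq_integral => s _; rewrite /fubini_F/= /h/=.
rewrite (@ge0_integral_affine _ (D / a)%R (s * (b / a))%R (fun t => g (s, t)))//.
  congr (_ * _); apply: eq_integral => t _; congr (g (_, _)).
  by rewrite addrC [(t * _)%R]mulrC.
- by rewrite mulf_neq0 ?invr_eq0.
- exact: (measurable_fun_pair2 s mg).
Qed.

(** If a = 0 then c is a nonzero pivot, and exchanging the two integration variables reduces to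
    [lin_aux] with the opposite determinant. *)
Lemma ge0_integral_linear (a b c d : R) g : (a * d - b * c != 0)%R ->
  measurable_fun setT g -> (forall x, 0 <= g x) ->
  \int[Leb R]_x g x =
  `|a * d - b * c|%:E * \int[Leb R]_x g (x.1 * a + x.2 * c, x.1 * b + x.2 * d)%R.
Proof.
move=> det0 mg g0; have [a0|a0] := eqVneq a 0%R; last exact: lin_aux.
have c0 : (c != 0)%R by apply: contra_neq det0 => ->; rewrite a0; ring.
rewrite (lin_aux (a := c) (b := d) (c := a) (d := b))//; last first.
  by rewrite -oppr_eq0 opprB mulrC [(c * b)%R]mulrC.
rewrite -normrN opprB [(d * a)%R]mulrC [(c * b)%R]mulrC; congr (_ * _).
rewrite -[RHS]ge0_integral_swap//=.
  by apply: eq_integral => x _ /=; congr (g (_, _)); rewrite addrC.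
apply: measurableT_comp => //.
by apply: measurable_fun_pair; apply: measurable_funD; apply: measurable_funM.
Qed.

End TwoDim.

Lemma measurable_patch d (T : measurableType d) (R : realType) (D : set T)
    (g : T -> \bar R) :
  measurable D -> measurable_fun setT g -> measurable_fun setT (g \_ D).
Proof. by move=> mD mg; apply: (measurable_restrictT _ mD).1; exact: measurable_funTS. Qed.

(** * Log-polar coordinates *)

Section LogPolar.
Context {R : realType}.
Local Open Scope ereal_scope.
Notation mu := (@lebesgue_measure R).
Notation T := (measurableTypeR R).
Implicit Types g : plane R -> \bar R.

Lemma Leb_setX (A B : set T) : measurable A -> measurable B ->
  Leb R (A `*` B) = mu A * mu B.
Proof. by move=> mA mB; exact: product_measure1E. Qed.

Definition exp_polar (x : plane R) : plane R :=
  (expR x.1 * cos x.2, expR x.1 * sin x.2)%R.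

Lemma measurable_exp_polar : measurable_fun setT exp_polar.
Proof.
have me : measurable_fun setT (fun x : plane R => expR x.1 : T).
  exact: (measurableT_comp (@measurable_expR R)).
apply: measurable_fun_pair; apply: measurable_funM => //.
- apply: (measurableT_comp (f := @cos R)) => //.
  by apply: continuous_measurable_fun; exact: continuous_cos.
- apply: (measurableT_comp (f := @sin R)) => //.
  by apply: continuous_measurable_fun; exact: continuous_sin.
Qed.

Let sin_atan (t : R) : sin (atan t) = (t / Num.sqrt (1 + t ^+ 2))%R.
Proof.
have c0 : cos (atan t) != 0%R.
  by rewrite gt_eqF// cos_gt0_pihalf// atan_gtNpi2 atan_ltpi2.
by rewrite -cos_atan -[X in _ = (X * _)%R]atanK /tan divfK.
Qed.

(** One-dimensional substitutions, with Tonelli in between: x = t y at fixed y, y = exp v, v = u -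
    ln (sqrt (1 + t^2)) at fixed t, then t = tan y' and y' = pi / 2 - s. The Jacobians multiply to
    exp (2 u). *)
Let upper g : measurable_fun setT g -> (forall x, 0 <= g x) ->
  \int[Leb R]_(x in [set x | (0 < x.2)%R]) g x =
  \int[mu]_u \int[mu]_(s in `]0%R, pi[) (g (exp_polar (u, s)) * (expR (2 * u))%:E).
Proof.
move=> mg g0.
have mH : measurable [set x : plane R | (0 < x.2)%R].
  rewrite [X in measurable X](_ : _ = setT `*` `]0%R, +oo[%classic); first exact: measurableX.
  by apply/seteqP; split => x /=; rewrite in_itv/= andbT => // -[].
rewrite integral_mkcond /Leb fubini_tonelli2//; first last.
- by move=> x; rewrite erestrict_ge0.
- exact: measurable_patch.
pose h (x : plane R) := g (x.1 * x.2, x.2)%R.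
have mh : measurable_fun setT h.
  by apply: measurableT_comp => //; apply: measurable_fun_pair => //; exact: measurable_funM.
have h0 x : 0 <= h x by exact: g0.
pose k y := \int[mu]_t h (t, y) * `|y|%:E.
have mhG : measurable_fun setT (fun y : T => \int[mu]_t h (t, y)).
  exact: (measurable_fun_fubini_tonelli_G h).
have mk : measurable_fun setT k.
  apply: emeasurable_funM => //; apply/measurable_EFinP.
  exact: (normr_measurable (D := setT)).
have hG0 y : 0 <= \int[mu]_t h (t, y) by apply: integral_ge0 => t _; exact: h0.
have k0 y : 0 <= k y by rewrite mule_ge0 ?lee_fin.
transitivity (\int[mu]_(y in `]0%R, +oo[) k y).
  rewrite [RHS]integral_mkcond; apply: eq_integral => y _.
  rewrite /fubini_G !patchE; case: ifPn => [|] yp.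
  - have {}yp : (0 < y)%R by move: yp; rewrite inE/= in_itv/= andbT.
    under eq_integral => x _ do rewrite patchE mem_set//=.
    rewrite (@ge0_integral_affine _ y 0%R (fun x => g (x, y)))//; last 2 first.
    + by rewrite gt_eqF.
    + exact: (measurable_fun_pair1 y mg).
    rewrite /k muleC; congr (_ * _); apply: eq_integral => t _.
    by rewrite /h/= addr0 mulrC.
  - rewrite integral0_eq// => x _; rewrite patchE ifF//; apply/negbTE.
    by apply: contra yp; rewrite !inE/= in_itv/= andbT.
rewrite ge0_integral_expR//.
pose l (x : plane R) := h (x.1, expR x.2) * (expR (2 * x.2))%:E.
have mexp2 : measurable_fun setT (fun u : R => expR (2 * u) : T).
  by apply: (measurableT_comp (f := @expR R)) => //; exact: mulrl_measurable.
have ml : measurable_fun setT l.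
  apply: emeasurable_funM.
    apply: (measurableT_comp mh); apply: measurable_fun_pair => //.
    exact: (measurableT_comp (@measurable_expR R)).
  apply/measurable_EFinP; exact: (measurableT_comp mexp2).
have l0 x : 0 <= l x by rewrite mule_ge0// lee_fin expR_ge0.
transitivity (\int[mu]_v \int[mu]_t l (t, v)).
  apply: eq_integral => v _; rewrite /k -muleA -EFinM.
  rewrite ger0_norm ?expR_ge0// -expRD -mulr2n -mulr_natl.
  rewrite -ge0_integralZr//.
  exact: (measurable_fun_pair1 (expR v) mh).
transitivity (\int[mu]_t \int[mu]_v l (t, v)).
  exact: (esym (fubini_tonelli (m1 := mu) (m2 := mu) l ml l0)).
pose q (x : plane R) := g (expR x.2 * sin (atan x.1), expR x.2 * cos (atan x.1))%R * (expR (2 * x.2))%:E * ((1 + x.1 ^+ 2)^-1)%:E.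
pose k2 (u s : R) := g (expR u * sin s, expR u * cos s)%R * (expR (2 * u))%:E.
have mexp2' : measurable_fun setT (fun x : plane R => (expR (2 * x.1))%:E).
  by apply/measurable_EFinP; exact: (measurableT_comp mexp2).
have mk2 : measurable_fun setT (fun x : plane R => k2 x.1 x.2).
  apply: emeasurable_funM => //; apply: (measurableT_comp mg).
  exact: (measurableT_comp (@measurable_swap _ _ T T) measurable_exp_polar).
have mat : measurable_fun setT (fun x : plane R => atan x.1 : T).
  apply: (measurableT_comp (f := @atan R)) => //.
  by apply: continuous_measurable_fun; exact: continuous_atan.
have mq : measurable_fun setT q.
  apply: emeasurable_funM; last first.
    apply/measurable_EFinP; apply: (measurableT_comp (f := fun t : R => ((1 + t ^+ 2)^-1)%R)) => //.
    apply: continuous_measurable_fun => x.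
    apply: cvgV; first by rewrite gt_eqF// ltr_pwDl// sqr_ge0.
    by apply: cvgD; [exact: cvg_cst|exact: exprn_continuous].
  apply: (measurableT_comp (f := fun x : plane R => k2 x.1 x.2)
    (g := fun x : plane R => (x.2, atan x.1) : plane R) mk2).
  exact: measurable_fun_pair.
have q0 x : 0 <= q x.
  by rewrite !mule_ge0// lee_fin ?expR_ge0// invr_ge0 addr_ge0// sqr_ge0.
transitivity (\int[mu]_t \int[mu]_u q (t, u)).
  apply: eq_integral => t _.
  have t1 : (0 < 1 + t ^+ 2)%R by rewrite ltr_pwDl// sqr_ge0.
  (* This shift turns the logarithm of the ordinate into the logarithm of the modulus. *)
  rewrite (@ge0_integral_affine _ 1%R (- ln (Num.sqrt (1 + t ^+ 2)))%R (fun v => l (t, v)))//; last first.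
    exact: (measurable_fun_pair2 t ml).
  rewrite normr1 mul1e; apply: eq_integral => u _.
  rewrite /l /q /h/= mul1r expRD expRN lnK ?posrE ?sqrtr_gt0// sin_atan cos_atan.
  rewrite -muleA; congr (g (_, _) * _); first by rewrite mulrCA.
  rewrite -EFinM; congr (_%:E); rewrite mulrDr expRD mulrN expRN !mulr_natl !mulr2n !expRD.
  rewrite lnK ?posrE ?sqrtr_gt0//; congr (_ / _)%R.
  by rewrite -expr2 sqr_sqrtr// ltW.
transitivity (\int[mu]_u \int[mu]_t q (t, u)).
  exact: (fubini_tonelli (m1 := mu) (m2 := mu) q mq q0).
apply: eq_integral => u _.
transitivity (\int[mu]_(s in [set` `]- (pi / 2), pi / 2[%R]) k2 u s).
  rewrite ge0_integral_atan//.
  - exact: (measurable_fun_pair2 u mk2).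
  - by move=> x; rewrite mule_ge0// lee_fin expR_ge0.
(* The arctangent of x / y is the angle from the vertical axis; its complement s is the angle from
   the horizontal one. *)
rewrite integral_mkcond (@ge0_integral_affine _ (-1)%R (pi / 2)%R)//; first last.
- by move=> x; apply: erestrict_ge0 => s _; rewrite mule_ge0// lee_fin expR_ge0.
- by apply: measurable_patch => //; exact: (measurable_fun_pair2 u mk2).
rewrite normrN1 mul1e [RHS]integral_mkcond; apply: eq_integral => s _.
rewrite mulN1r addrC !patchE.
have -> : ((pi / 2 - s)%R \in [set` `]- (pi / 2), pi / 2[%R]) = (s \in `]0%R, pi[%classic).
  by apply/idP/idP; rewrite !inE/= !in_itv/= => ?; lra.
case: ifPn => // _; rewrite /k2 /exp_polar/=; congr (g (_, _) * _).
  by rewrite -opprB sinN sinBpihalf opprK.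
by rewrite -opprB cosN cosBpihalf.
Qed.

Lemma measurable_integral_strip (q : plane R -> \bar R) (I : set T) :
  measurable I -> measurable_fun setT q -> (forall x, 0 <= q x) ->
  measurable_fun setT (fun u : T => \int[mu]_(s in I) q (u, s)).
Proof.
move=> mI mq q0.
have mqI : measurable_fun setT (q \_ (setT `*` I)).
  by apply: measurable_patch => //; exact: measurableX.
rewrite [X in measurable_fun _ X](_ : _ = fubini_F mu (q \_ (setT `*` I))).
  by apply: measurable_fun_fubini_tonelli_F => // x; exact: erestrict_ge0.
apply/funext => u; rewrite /fubini_F [LHS]integral_mkcond; apply: eq_integral => s _.
by rewrite !patchE; congr (if _ then _ else _); apply/idP/idP; rewrite !inE/= => // -[].
Qed.

(** The real axis is null, and x -> - x carries the lower half-plane to the upper one while shifting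
    the angle by pi. *)
Lemma ge0_integral_log_polar g : measurable_fun setT g -> (forall x, 0 <= g x) ->
  \int[Leb R]_x g x =
  \int[mu]_u \int[mu]_(s in `[0%R, (2 * pi)%R[)
    (g (exp_polar (u, s)) * (expR (2 * u))%:E).
Proof.
move=> mg g0.
pose Hp := [set x : plane R | (0 < x.2)%R].
pose Hn := [set x : plane R | (x.2 < 0)%R].
pose Hz := [set x : plane R | x.2 = 0%R].
have mHp : measurable Hp.
  rewrite [X in measurable X](_ : _ = setT `*` `]0%R, +oo[%classic); first exact: measurableX.
  by apply/seteqP; split => x /=; rewrite in_itv/= andbT => // -[].
have mHn : measurable Hn.
  rewrite [X in measurable X](_ : _ = setT `*` `]-oo, 0%R[%classic); first exact: measurableX.
  by apply/seteqP; split => x /=; rewrite in_itv/= => // -[].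
have HzE : Hz = setT `*` [set 0%R].
  by apply/seteqP; split => x /= => // -[].
have mHz : measurable Hz by rewrite HzE; exact: measurableX.
have Hz0 : Leb R Hz = 0.
  by rewrite HzE Leb_setX// lebesgue_measure_set1 mule0.
have -> : \int[Leb R]_x g x = \int[Leb R]_(x in Hp) g x + \int[Leb R]_(x in Hn) g x.
  rewrite (_ : setT = (Hp `|` Hn) `|` Hz); last first.
    apply/seteqP; split => // x _; rewrite /Hp /Hn /Hz/=.
    by case: (ltgtP x.2 0%R); [left; right|left; left|right].
  rewrite ge0_integral_setU//; first last.
  - rewrite disj_set2E; apply/eqP/seteqP; split => // x [[|] /[swap]];
      by rewrite /Hz/Hp/Hn/= => ->; rewrite ltxx.
  - exact: measurable_funTS.
  - exact: measurableU.
  rewrite [X in _ + X]null_set_integral//; last exact: measurable_funTS.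
  rewrite adde0 ge0_integral_setU//; first exact: measurable_funTS.
  rewrite disj_set2E; apply/eqP/seteqP; split => // x []; rewrite /Hp/Hn/= => h1 h2.
  by move: (lt_trans h1 h2); rewrite ltxx.
pose g' (x : plane R) := g (- x.1, - x.2)%R.
have mg' : measurable_fun setT g'.
  apply: (measurableT_comp mg); apply: measurable_fun_pair.
    by apply: (measurableT_comp (f := fun t : R => (- t)%R)) => //; exact: oppr_measurable.
  by apply: (measurableT_comp (f := fun t : R => (- t)%R)) => //; exact: oppr_measurable.
have -> : \int[Leb R]_(x in Hn) g x = \int[Leb R]_(x in Hp) g' x.
  rewrite integral_mkcond (@ge0_integral_linear _ (-1)%R 0%R 0%R (-1)%R); first last.
  - by move=> x; exact: erestrict_ge0.
  - exact: measurable_patch.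
  - by rewrite mulrNN mulr1 mul0r subr0 oner_neq0.
  rewrite mulrNN mulr1 mul0r subr0 normr1 mul1e [RHS]integral_mkcond.
  apply: eq_integral => x _; rewrite !mulr0 addr0 add0r !mulrN1 !patchE.
  by congr (if _ then _ else _); apply/idP/idP; rewrite !inE /Hp/Hn/= oppr_lt0.
rewrite !upper//; last by move=> x; exact: g0.
pose q (x : plane R) := g (exp_polar x) * (expR (2 * x.1))%:E.
have mexp2' : measurable_fun setT (fun x : plane R => (expR (2 * x.1))%:E).
  apply/measurable_EFinP; apply: (measurableT_comp (f := fun u : R => expR (2 * u)%R)) => //.
  by apply: (measurableT_comp (f := @expR R)) => //; exact: mulrl_measurable.
have mq : measurable_fun setT q.
  by apply: emeasurable_funM => //; exact: (measurableT_comp mg measurable_exp_polar).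
have q0 x : 0 <= q x by rewrite mule_ge0// lee_fin expR_ge0.
have pi0 := pi_gt0 R.
have -> : \int[mu]_u \int[mu]_(s in `]0%R, pi[) (g' (exp_polar (u, s)) * (expR (2 * u))%:E) =
  \int[mu]_u \int[mu]_(s in `]pi, (2 * pi)%R[) q (u, s).
  apply: eq_integral => u _.
  rewrite [RHS]integral_mkcond (@ge0_integral_affine _ 1%R pi); first last.
  - by move=> x; exact: erestrict_ge0.
  - by apply: measurable_patch => //; exact: (measurable_fun_pair2 u mq).
  - exact: oner_neq0.
  rewrite normr1 mul1e integral_mkcond; apply: eq_integral => s _.
  rewrite !patchE mul1r /q /g' /exp_polar/= cosDpi sinDpi !mulrN.
  by congr (if _ then _ else _); apply/idP/idP; rewrite !inE/= !in_itv/= => ?; lra.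
rewrite -ge0_integralD//; first last.
- by apply: measurable_integral_strip.
- by move=> u _; apply: integral_ge0 => s _; exact: q0.
- by apply: (@measurable_integral_strip q).
- by move=> u _; apply: integral_ge0 => s _; exact: (q0 (u, s)).
apply: eq_integral => u _.
have mqu D : measurable_fun D (fun s => q (u, s)).
  by apply: measurable_funTS; exact: (measurable_fun_pair2 u mq).
rewrite -[in RHS]integral_itv_obnd_cbnd; last exact: mqu.
have -> : `]0%R, (2 * pi)%R[%classic = `]0%R, pi[%classic `|` `[pi, (2 * pi)%R[%classic :> set R.
  apply/seteqP; split => s /=; rewrite !in_itv/=.
    by move=> ?; case: (ltP s pi) => ?; [left|right]; lra.
  by case; lra.
rewrite ge0_integral_setU//; first last.
- rewrite disj_set2E; apply/eqP/seteqP; split => // s []/=; rewrite !in_itv/=.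
  by move=> /andP[_ h1] /andP[h2 _]; move: (lt_le_trans h1 h2); rewrite ltxx.
- by move=> s _; exact: (q0 (u, s)).
by rewrite -[in RHS]integral_itv_obnd_cbnd//; exact: mqu.
Qed.

End LogPolar.

(** * Quantitative estimates for the complex exponential *)

Section ComplexExp.
Context {R : realType}.
Implicit Types (z w u v : R[i]) (a b t : R).

Lemma modulus_def z : modulus z = Num.sqrt (complex.Re z ^+ 2 + complex.Im z ^+ 2).
Proof. by case: z. Qed.

Lemma modulus_ge0 z : 0 <= modulus z.
Proof. by rewrite modulus_def sqrtr_ge0. Qed.

Lemma modulus_sqr z : modulus z ^+ 2 = complex.Re z ^+ 2 + complex.Im z ^+ 2.
Proof. by rewrite modulus_def sqr_sqrtr// addr_ge0 ?sqr_ge0. Qed.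

Lemma modulusM z w : modulus (z * w) = modulus z * modulus w.
Proof. exact: ComplexField.Normc.normcM. Qed.

Lemma modulusV z : modulus z^-1 = (modulus z)^-1.
Proof. exact: ComplexField.Normc.normcV. Qed.

Lemma modulusN z : modulus (- z) = modulus z.
Proof. exact: normcN. Qed.

Lemma modulusD z w : modulus (z + w) <= modulus z + modulus w.
Proof. exact: le_normcD. Qed.

Lemma modulus0 : modulus (0 : R[i]) = 0.
Proof. exact: ComplexField.Normc.normc0. Qed.

Lemma modulus_eq0 z : (modulus z == 0) = (z == 0).
Proof.
by apply/eqP/eqP => [/ComplexField.Normc.eq0_normc//|->]; exact: modulus0.
Qed.

Lemma modulus_gt0 z : (0 < modulus z) = (z != 0).
Proof. by rewrite lt0r modulus_eq0 modulus_ge0 andbT. Qed.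

Lemma modulusR t : modulus t%:C = `|t|.
Proof. by rewrite modulus_def /= expr0n/= addr0 sqrtr_sqr. Qed.

Lemma Re_le_modulus z : `|complex.Re z| <= modulus z.
Proof. by rewrite modulus_def -sqrtr_sqr ler_wsqrtr// lerDl sqr_ge0. Qed.

Lemma Im_le_modulus z : `|complex.Im z| <= modulus z.
Proof. by rewrite modulus_def -sqrtr_sqr ler_wsqrtr// lerDr sqr_ge0. Qed.

Lemma modulus_le z : modulus z <= `|complex.Re z| + `|complex.Im z|.
Proof.
rewrite -(@ler_pXn2r _ 2)// ?nnegrE ?modulus_ge0 ?addr_ge0//.
rewrite modulus_sqr -[complex.Re z ^+ 2]real_normK ?num_real//.
rewrite -[complex.Im z ^+ 2]real_normK ?num_real//.
by have := normr_ge0 (complex.Re z); have := normr_ge0 (complex.Im z); nra.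
Qed.

Lemma expCD z w : expC (z + w) = expC z * expC w.
Proof.
case: z => a b; case: w => c d; rewrite /expC/= expRD cosD sinD.
by apply/eqP; rewrite eq_complex/=; apply/andP; split; apply/eqP; ring.
Qed.

Lemma expC0 : expC (0 : R[i]) = 1.
Proof.
rewrite /expC/= expR0 cos0 sin0; apply/eqP; rewrite eq_complex/=.
by apply/andP; split; apply/eqP; ring.
Qed.

Lemma modulus_expC z : modulus (expC z) = expR (complex.Re z).
Proof.
rewrite /expC modulusM modulusR ger0_norm ?expR_ge0// [X in _ * X]modulus_def/=.
by rewrite cos2Dsin2 sqrtr1 mulr1.
Qed.

Lemma expC_neq0 z : expC z != 0.
Proof. by rewrite -modulus_gt0 modulus_expC expR_gt0. Qed.

Lemma expCN z : expC (- z) = (expC z)^-1.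
Proof. by apply: (mulfI (expC_neq0 z)); rewrite -expCD subrr expC0 divff// expC_neq0. Qed.

Lemma expCB z w : expC (z - w) = expC z / expC w.
Proof. by rewrite expCD expCN. Qed.

(** Mean value theorem; the polynomial bounds on sin and cos below all rest on it. *)
Let sin_aux b : 0 <= b -> exists2 c, 0 <= c <= b & sin b = b * cos c.
Proof.
rewrite le_eqVlt => /predU1P[<-|b0].
  by exists 0; rewrite ?lexx// sin0 mul0r.
have [|c] := @MVT_segment R sin cos 0 b (ltW b0) (fun x _ => is_derive_sin x).
  by apply: continuous_subspaceT; exact: continuous_sin.
by rewrite in_itv/= sin0 !subr0 => cb ->; exists c => //; rewrite mulrC.
Qed.

Lemma sin_le_abs b : `|sin b| <= `|b|.
Proof.
wlog b0 : b / 0 <= b.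
  by move=> H; have [|/ltW] := leP 0 b; [exact: H|rewrite -oppr_ge0 => /H]; rewrite sinN !normrN.
have [c _ ->] := sin_aux b0; rewrite normrM ler_piMr// ler_norml.
by rewrite cos_geN1 cos_le1.
Qed.

Lemma cos_ge_quad b : 1 - cos b <= b ^+ 2 / 2.
Proof.
have -> : b = b / 2 + b / 2 by field.
set c := b / 2; rewrite cosD -!expr2 cos2sin2.
have : sin c ^+ 2 <= c ^+ 2.
  by rewrite -[leLHS]real_normK ?num_real// -[leRHS]real_normK ?num_real// lerXn2r ?nnegrE// sin_le_abs.
by move=> ?; nra.
Qed.

Lemma sin_sub_abs b : `|sin b - b| <= `|b| ^+ 3 / 2.
Proof.
wlog b0 : b / 0 <= b.
  move=> H; have [|/ltW] := leP 0 b; [exact: H|rewrite -oppr_ge0 => /H].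
  by rewrite sinN -opprD !normrN.
have [c /andP[c0 cb] ->] := sin_aux b0.
rewrite -{2}(mulr1 b) -mulrBr normrM ger0_norm// exprS -mulrA ler_wpM2l//.
rewrite distrC ger0_norm ?subr_ge0 ?cos_le1//.
by rewrite (le_trans (cos_ge_quad c))// ler_pM2r// lerXn2r// nnegrE.
Qed.

(** Both sides follow from 1 + x <= exp x, taken at a and at - a; the latter gives exp a (1 - a) <=
    1. *)
Lemma expR_quad a : `|a| <= 1 / 2 -> `|expR a - 1 - a| <= 2 * a ^+ 2.
Proof.
rewrite ler_norml => /andP[a1 a2].
have h1 := expR_ge1Dx a; have h2 := expR_ge1Dx (- a).
have e0 := expR_gt0 a.
have E : expR a * expR (- a) = 1 by rewrite -expRD subrr expR0.
have : expR a * (1 - a) <= 1 by rewrite -E ler_pM2l//; lra.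
by move=> h3; rewrite ger0_norm; nra.
Qed.

Lemma expC_quad u : modulus u <= 1 / 2 ->
  modulus (expC u - 1 - u) <= 4 * modulus u ^+ 2.
Proof.
move=> hu; rewrite modulus_sqr; apply: le_trans (modulus_le _) _.
have := le_trans (Re_le_modulus u) hu; have := le_trans (Im_le_modulus u) hu.
case: u {hu} => a b /= hb ha.
have h1 := expR_quad ha; have h2 := cos_ge_quad b; have h3 := sin_sub_abs b.
have h4 := sin_le_abs b; have h5 : cos b <= 1 := cos_le1 b.
have e2 : 0 < expR a <= 2.
  by rewrite expR_gt0; move: h1 ha; rewrite !ler_norml => /andP[_ h] /andP[? ?]; nra.
rewrite !mul0r subr0 addr0 !subr0.
have -> : expR a * cos b - 1 - a = (expR a - 1 - a) - expR a * (1 - cos b) by ring.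
have -> : expR a * sin b - b = (expR a - 1 - a) * sin b + a * sin b + (sin b - b) by ring.
have A1 : `|expR a - 1 - a - expR a * (1 - cos b)| <= 2 * a ^+ 2 + b ^+ 2.
  apply: le_trans (ler_normB _ _) _; apply: lerD => //.
  rewrite normrM !ger0_norm; [nra|lra|lra].
have a2 : a ^+ 2 = `|a| ^+ 2 by rewrite real_normK// num_real.
have b2 : b ^+ 2 = `|b| ^+ 2 by rewrite real_normK// num_real.
have A2 : `|(expR a - 1 - a) * sin b + a * sin b + (sin b - b)| <=
   2 * a ^+ 2 * `|b| + `|a| * `|b| + `|b| ^+ 3 / 2.
  apply: le_trans (ler_normD _ _) _; apply: lerD => //.
  apply: le_trans (ler_normD _ _) _; rewrite !normrM; apply: lerD; apply: ler_pM => //.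
have := normr_ge0 a; have := normr_ge0 b => nb na.
have A3 : `|b| ^+ 3 = `|b| * `|b| ^+ 2 by rewrite exprS.
rewrite A3 in A2.
move: A1 A2; rewrite a2 b2; set X := `|_ - _|; set Y := `|_ + _ + _|.
move: hb ha nb na; set p := `|b|; set q := `|a| => hb ha nb na A1 A2.
have : p * p ^+ 2 <= 1 / 2 * p ^+ 2 by rewrite ler_wpM2r// sqr_ge0.
have : q ^+ 2 * p <= q ^+ 2 * (1 / 2) by rewrite ler_wpM2l// sqr_ge0.
have : 0 <= (q - p) ^+ 2 by rewrite sqr_ge0.
by nra.
Qed.

(** The thresholds 1/4 here and 1/8 in the next bound are those below which the error 4 |u|^2 is at
    most |u|, respectively |u| / 2. *)
Lemma expC_sub1_le u : modulus u <= 1 / 4 -> modulus (expC u - 1) <= 2 * modulus u.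
Proof.
move=> hu; have h0 := modulus_ge0 u.
have /expC_quad h : modulus u <= 1 / 2 by lra.
rewrite -(subrK u (expC u - 1)) (le_trans (modulusD _ _))//.
by nra.
Qed.

Lemma expC_sub1_ge u : modulus u <= 1 / 8 -> modulus u / 2 <= modulus (expC u - 1).
Proof.
move=> hu; have h0 := modulus_ge0 u.
have /expC_quad h : modulus u <= 1 / 2 by lra.
have : modulus u <= modulus (expC u - 1) + modulus (expC u - 1 - u).
  have {1}-> : u = (expC u - 1) + - (expC u - 1 - u) by ring.
  by rewrite (le_trans (modulusD _ _))// modulusN.
by nra.
Qed.

(** Either |b| or 2 pi - |b| lies in [eta, pi], where cos decreases: the bound |b| < 2 pi alpha
    leaves a gap of 2 pi (1 - alpha) before the next period. *)
Lemma cos_le_far (alpha eta b : R) : 0 < alpha < 1 -> 0 < eta ->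
  eta <= 2 * pi * (1 - alpha) -> eta <= pi -> eta <= `|b| < 2 * pi * alpha ->
  cos b <= cos eta.
Proof.
move=> /andP[al0 al1] eta0 eta1 eta2 /andP[b1 b2]; have pi0 := pi_gt0 R.
have -> : cos b = cos `|b| by case: (ger0P b) => // _; rewrite cosN.
have [bpi|bpi] := leP `|b| pi.
  rewrite leNgt; apply/negP => h.
  have : `|b| < eta by rewrite -ltr_cos// in_itv/= ?eta2 ?(ltW eta0) ?bpi ?normr_ge0.
  by rewrite ltNge b1.
have -> : cos `|b| = cos (2 * pi - `|b|).
  by rewrite addrC mulr_natl cosD2pi cosN.
have h3 : 2 * pi * (1 - alpha) < 2 * pi - `|b| by lra.
rewrite leNgt; apply/negP => h.
have : 2 * pi - `|b| < eta by rewrite -ltr_cos// in_itv/= ?eta2 ?(ltW eta0)//; lra.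
by lra.
Qed.

(** The key rigidity: with alpha u = a + i b, |exp (alpha u) - 1|^2 = (exp a - 1)^2 + 2 exp a (1 -
    cos b), and both terms must be small. The second forces b itself, not only b modulo 2 pi, to be
    small because |b| < 2 pi alpha. *)
Lemma expC_small (alpha eta : R) : 0 < alpha < 1 -> 0 < eta ->
  exists2 delta, 0 < delta & forall u, `|complex.Im u| < 2 * pi ->
    modulus (expC (alpha%:C * u) - 1) < delta -> modulus u < eta.
Proof.
move=> al01 eta0; have /andP[al0 al1] := al01; have pi0 := pi_gt0 R.
(* Bounding |a| and |b| by e1 gives alpha |u| <= |a| + |b| < alpha eta. *)
pose e1 := alpha * eta / 2; have e10 : 0 < e1 by rewrite /e1; nra.
pose e2 := Num.min e1 (Num.min (2 * pi * (1 - alpha)) pi).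
have e2le : [/\ e2 <= e1, e2 <= 2 * pi * (1 - alpha) & e2 <= pi].
  by rewrite /e2 !ge_min !lexx !orbT.
have e20 : 0 < e2 by rewrite !lt_min e10 pi0 andbT; nra.
pose kap := 1 - cos e2.
have kap0 : 0 < kap.
  rewrite subr_gt0.
  have : cos e2 < cos 0; last by rewrite cos0.
  rewrite ltr_cos// in_itv/=; first by rewrite lexx ltW.
  by rewrite (ltW e20); case: e2le.
(* 1/2 keeps exp a away from 0, e1 / 2 gives |a| <= 2 delta <= e1, and kap forces |b| < e1 through
   [cos_le_far]. *)
pose delta := Num.min (1 / 2) (Num.min (e1 / 2) kap).
have dle : [/\ delta <= 1 / 2, delta <= e1 / 2 & delta <= kap].
  by rewrite /delta !ge_min !lexx !orbT.
have d0 : 0 < delta by rewrite !lt_min kap0 !andbT; lra.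
exists delta => // u hu hd.
pose a := alpha * complex.Re u; pose b := alpha * complex.Im u.
have vE : alpha%:C * u = a +i* b.
  rewrite /a /b; case: (u) => p q; apply/eqP; rewrite eq_complex/=.
  by apply/andP; split; apply/eqP; ring.
have sqE : modulus (expC (a +i* b) - 1) ^+ 2 = (expR a - 1) ^+ 2 + 2 * expR a * (1 - cos b).
  rewrite modulus_sqr/= !mul0r subr0 addr0 subr0.
  have := cos2Dsin2 b; set c := cos b; set s := sin b => h.
  transitivity (expR a ^+ 2 * (c ^+ 2 + s ^+ 2) - 2 * expR a * c + 1); first by ring.
  by rewrite h; ring.
rewrite vE in hd; move: sqE hd; have := modulus_ge0 (expC (a +i* b) - 1).
move: (modulus _) => M M0 sqE hd.
have c1 := cos_le1 b; have E0 := expR_gt0 a.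
have h1 := expR_ge1Dx a; have h2 := expR_ge1Dx (- a).
have h3 : expR a * (1 - a) <= 1.
  have EE : expR a * expR (- a) = 1 by rewrite -expRD subrr expR0.
  by apply: (@le_trans _ _ (expR a * expR (- a))); [rewrite ler_pM2l|rewrite EE].
case: dle => dle1 dle2 dle3.
have Md : M ^+ 2 < delta ^+ 2 by rewrite ltrXn2r// nnegrE ltW.
have hE : `|expR a - 1| < delta.
  rewrite -(@ltr_pXn2r _ 2)// ?nnegrE ?(ltW d0)//.
  rewrite -normrX ger0_norm ?sqr_ge0// (le_lt_trans _ Md)// sqE lerDl.
  by rewrite mulr_ge0 ?mulr_ge0 ?subr_ge0// ltW.
move: hE; rewrite ltr_norml => /andP[hE1 hE2].
have ha : `|a| <= 2 * delta by rewrite ler_norml; apply/andP; split; nra.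
have hc : 1 - cos b < kap.
  have : 2 * expR a * (1 - cos b) < delta ^+ 2.
    by rewrite (le_lt_trans _ Md)// sqE lerDr sqr_ge0.
  by nra.
have hb : `|b| < e1.
  rewrite ltNge; apply/negP => be1.
  have : cos b <= cos e2; last by rewrite /kap in hc; lra.
  case: e2le => *; apply: (@cos_le_far alpha) => //; apply/andP; split; first lra.
  by rewrite /b normrM (gtr0_norm al0) mulrC ltr_pM2r.
rewrite (le_lt_trans (modulus_le _))// -(@ltr_pM2l _ alpha)// mulrDr.
have -> : alpha * `|complex.Re u| = `|a| by rewrite normrM gtr0_norm.
have -> : alpha * `|complex.Im u| = `|b| by rewrite normrM gtr0_norm.
by rewrite /e1 in hb dle2; lra.
Qed.

Lemma modulusZ t z : modulus (t%:C * z) = `|t| * modulus z.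
Proof. by rewrite modulusM modulusR. Qed.

(** Near u = 0 the two moduli are at most 2 |u| and at least alpha |u| / 2, ratio 4 / alpha;
    elsewhere the left side is at most 2 because Re u <= 0, while the right modulus is at least
    delta. *)
Lemma expC_ratio_bound (alpha : R) : 0 < alpha < 1 ->
  exists2 K, 0 < K & forall u, complex.Re u <= 0 -> `|complex.Im u| < 2 * pi ->
    modulus (expC u - 1) <= K * modulus (expC (alpha%:C * u) - 1).
Proof.
move=> al01; have /andP[al0 al1] := al01.
have [|delta d0 hd] := @expC_small alpha (1 / 8) al01; first by lra.
exists (4 / alpha + 2 / delta).
  by rewrite addr_gt0// divr_gt0.
move=> u hre him; have m0 := modulus_ge0 (expC (alpha%:C * u) - 1).
have [small|big] := ltP (modulus (expC (alpha%:C * u) - 1)) delta.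
  have hu := hd _ him small; have mu0 := modulus_ge0 u.
  have h1 : modulus (expC u - 1) <= 2 * modulus u by apply: expC_sub1_le; lra.
  have h2 : alpha * modulus u / 2 <= modulus (expC (alpha%:C * u) - 1).
    rewrite -{1}(gtr0_norm al0) -modulusZ; apply: expC_sub1_ge.
    by rewrite modulusZ gtr0_norm//; nra.
  apply: (le_trans h1); rewrite [leRHS]mulrDl.
  apply: (@le_trans _ _ (4 / alpha * modulus (expC (alpha%:C * u) - 1))); last first.
    by rewrite lerDl mulr_ge0// divr_ge0// ltW.
  have -> : 2 * modulus u = 4 / alpha * (alpha * modulus u / 2).
    by field; rewrite gt_eqF.
  by rewrite ler_wpM2l// divr_ge0// ltW.
have h1 : modulus (expC u - 1) <= 2.
  rewrite (le_trans (modulusD _ _))// modulusN modulus_expC.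
  have -> : modulus (1 : R[i]) = 1 by rewrite -[1]/(1%:C) modulusR normr1.
  by rewrite -ler_expR expR0 in hre; lra.
apply: (le_trans h1); rewrite [leRHS]mulrDl.
apply: (@le_trans _ _ (2 / delta * modulus (expC (alpha%:C * u) - 1))); last first.
  by rewrite lerDr mulr_ge0// divr_ge0// ltW.
apply: (@le_trans _ _ (2 / delta * delta)); first by rewrite divfK// gt_eqF.
by rewrite ler_wpM2l// divr_ge0// ltW.
Qed.

(** Factor out exp r, with Re s <= Re r by symmetry, and split exp (Re r) as exp ((1 - alpha) Re r)
    exp (alpha Re r): the first factor is at most N^(1-alpha). This is where the scale N^(1-alpha)
    comes from. *)
Lemma expC_diff_bound (alpha : R) : 0 < alpha < 1 ->
  exists2 K, 0 < K & forall (r s : R[i]) (N : R), `|complex.Im r - complex.Im s| < 2 * pi ->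
    modulus (expC r) <= N -> modulus (expC s) <= N ->
    modulus (expC s - expC r) <=
      K * N `^ (1 - alpha) * modulus (expC (alpha%:C * s) - expC (alpha%:C * r)).
Proof.
move=> al01; have [K K0 hK] := expC_ratio_bound al01; exists K => // r s N.
have /andP[al0 al1] := al01.
wlog rs : r s / complex.Re s <= complex.Re r.
  move=> H him hr hs; have [|/ltW] := leP (complex.Re s) (complex.Re r) => rs; first exact: H.
  rewrite -modulusN opprB -[X in _ * X]modulusN [X in _ * modulus X]opprB.
  by apply: H => //; rewrite distrC.
move=> him hr hs; pose u := s - r.
have -> : expC s - expC r = expC r * (expC u - 1).
  by rewrite mulrBr mulr1 -expCD /u [r + _]addrC subrK.
have -> : expC (alpha%:C * s) - expC (alpha%:C * r) = expC (alpha%:C * r) * (expC (alpha%:C * u) - 1).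
  by rewrite mulrBr mulr1 -expCD -mulrDr /u [r + _]addrC subrK.
rewrite [modulus (expC r * _)]modulusM [modulus (expC (_ * r) * _)]modulusM !modulus_expC.
have -> : complex.Re (alpha%:C * r) = alpha * complex.Re r.
  by case: (r) => p q /=; rewrite mul0r subr0.
set a := complex.Re r.
have aE : expR a = expR ((1 - alpha) * a) * expR (alpha * a).
  by rewrite -expRD; congr expR; ring.
have hN : expR ((1 - alpha) * a) <= N `^ (1 - alpha).
  rewrite modulus_expC -/a in hr.
  have -> : expR ((1 - alpha) * a) = expR a `^ (1 - alpha).
    by rewrite /powR gt_eqF ?expR_gt0// expRK.
  by rewrite ge0_ler_powR ?nnegrE ?subr_ge0 ?expR_ge0 ?(ltW al1)// (le_trans _ hr) ?expR_ge0.
rewrite aE -mulrA; set V := modulus (expC (_ * u) - 1).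
have -> : K * N `^ (1 - alpha) * (expR (alpha * a) * V) =
  N `^ (1 - alpha) * (expR (alpha * a) * (K * V)) by ring.
rewrite ler_pM ?expR_ge0 ?mulr_ge0 ?expR_ge0 ?modulus_ge0//.
rewrite ler_wpM2l ?expR_ge0// hK//.
  by rewrite raddfB/= subr_le0.
by rewrite raddfB/= distrC.
Qed.

(** The first-order terms alpha u cancel, leaving two errors of at most 4 |u|^2 each. *)
Lemma expC_ratio_quad (alpha : R) u : 0 < alpha < 1 -> modulus u <= 1 / 8 ->
  modulus (expC (alpha%:C * u) - 1 - alpha%:C * (expC u - 1)) <= 8 * modulus u ^+ 2.
Proof.
move=> /andP[al0 al1] hu; have m0 := modulus_ge0 u.
have -> : expC (alpha%:C * u) - 1 - alpha%:C * (expC u - 1) =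
  (expC (alpha%:C * u) - 1 - alpha%:C * u) - alpha%:C * (expC u - 1 - u) by ring.
rewrite (le_trans (modulusD _ _))// modulusN modulusZ gtr0_norm//.
have h1 : modulus (expC u - 1 - u) <= 4 * modulus u ^+ 2 by apply: expC_quad; lra.
have h2 : modulus (expC (alpha%:C * u) - 1 - alpha%:C * u) <= 4 * modulus (alpha%:C * u) ^+ 2.
  by apply: expC_quad; rewrite modulusZ gtr0_norm//; nra.
rewrite modulusZ gtr0_norm// exprMn in h2.
have q0 : 0 <= modulus u ^+ 2 by rewrite sqr_ge0.
have : alpha * modulus (expC u - 1 - u) <= 1 * (4 * modulus u ^+ 2).
  by rewrite ler_pM ?modulus_ge0 ?(ltW al0) ?(ltW al1).
have : alpha ^+ 2 * modulus u ^+ 2 <= 1 * modulus u ^+ 2.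
  by rewrite ler_wpM2r// expr_le1// ltW.
by lra.
Qed.

End ComplexExp.

(** * The argument and the logarithms of a complex number *)

Section ComplexLog.
Context {R : realType}.
Implicit Types (z w : R[i]) (u : nat -> R[i]).

(** Expressed through the quotient Re z / Im z, so that on each open half-plane it is given by one
    continuous formula. *)
Definition arg z : R :=
  if 0 < complex.Im z then pi / 2 - atan (complex.Re z / complex.Im z)
  else if complex.Im z < 0 then 3 * pi / 2 - atan (complex.Re z / complex.Im z)
  else if 0 <= complex.Re z then 0 else pi.

Definition Log z : R[i] := ln (modulus z) +i* arg z.

Lemma arg_itv z : 0 <= arg z < 2 * pi.
Proof.
rewrite /arg; have pi0 := pi_gt0 R; set t := complex.Re z / complex.Im z.
have h1 := atan_gtNpi2 t; have h2 := atan_ltpi2 t.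
by do 3?case: ifP => _; lra.
Qed.

Lemma sin_atan (t : R) : sin (atan t) = t * cos (atan t).
Proof.
have c0 : cos (atan t) != 0.
  by rewrite gt_eqF// cos_gt0_pihalf// atan_gtNpi2 atan_ltpi2.
by rewrite -[X in _ = X * _]atanK /tan divfK.
Qed.

Lemma cos_atan_div (x y : R) : y != 0 ->
  cos (atan (x / y)) = `|y| / Num.sqrt (x ^+ 2 + y ^+ 2).
Proof.
move=> y0; rewrite cos_atan.
have y20 : 0 < y ^+ 2 by rewrite exprn_even_gt0.
have -> : x ^+ 2 + y ^+ 2 = y ^+ 2 * (1 + (x / y) ^+ 2) by field.
by rewrite sqrtrM ?ltW// sqrtr_sqr invfM mulrA divff ?mul1r// normr_eq0.
Qed.

Lemma cos_arg z : z != 0 -> cos (arg z) = complex.Re z / modulus z.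
Proof.
rewrite modulus_def; case: z => x y; rewrite eq_complex/= negb_and /arg/= => z0.
have [y0|y0|y0] := ltgtP y 0.
- have -> : 3 * pi / 2 - atan (x / y) = pi + (pi / 2 - atan (x / y)) by field.
  have s0 : Num.sqrt (x ^+ 2 + y ^+ 2) != 0 by rewrite gt_eqF// sqrtr_gt0; nra.
  rewrite addrC cosDpi -opprB cosN cosBpihalf sin_atan cos_atan_div ?lt_eqF//.
  by rewrite ltr0_norm//; field; rewrite s0 lt_eqF.
- have s0 : Num.sqrt (x ^+ 2 + y ^+ 2) != 0 by rewrite gt_eqF// sqrtr_gt0; nra.
  rewrite -opprB cosN cosBpihalf sin_atan cos_atan_div ?gt_eqF//.
  by rewrite gtr0_norm//; field; rewrite s0 gt_eqF.
- move: z0; rewrite y0 eqxx/= orbF => x0.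
  rewrite expr0n/= addr0 sqrtr_sqr; case: ifPn => x1.
    by rewrite cos0 ger0_norm// divff.
  by rewrite cospi ltr0_norm ?ltNge// invrN mulrN divff.
Qed.

Lemma sin_arg z : z != 0 -> sin (arg z) = complex.Im z / modulus z.
Proof.
rewrite modulus_def; case: z => x y; rewrite eq_complex/= negb_and /arg/= => z0.
have [y0|y0|y0] := ltgtP y 0.
- have -> : 3 * pi / 2 - atan (x / y) = pi + (pi / 2 - atan (x / y)) by field.
  rewrite addrC sinDpi -opprB sinN opprK sinBpihalf cos_atan_div ?lt_eqF//.
  by rewrite ltr0_norm// mulNr opprK.
- rewrite -opprB sinN sinBpihalf opprK cos_atan_div ?gt_eqF//.
  by rewrite gtr0_norm.
- by rewrite y0 mul0r; case: ifPn => _; rewrite ?sin0 ?sinpi.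
Qed.

Lemma LogK z : z != 0 -> expC (Log z) = z.
Proof.
move=> z0; have m0 : modulus z != 0 by rewrite modulus_eq0.
rewrite /expC /Log/= lnK ?posrE ?modulus_gt0// cos_arg// sin_arg//.
move: m0; set m := modulus z; case: z {z0} @m => x y m m0.
apply/eqP; rewrite eq_complex/=; apply/andP; split; apply/eqP; field; exact: m0.
Qed.

Lemma periodic_intr (f : R -> R) (a : R) (k : int) : periodic f (pi *+ 2) ->
  f (a + 2 * pi * k%:~R) = f a.
Proof.
move=> pf; have fDn (n : nat) (c : R) : f (c + 2 * pi * n%:R) = f c.
  by rewrite mulrC mulr_natl mulr_natl -(periodicn pf n c).
case: k => n; first exact: fDn.
by rewrite NegzE mulrNz mulrN -(fDn n.+1) subrK.
Qed.

(** Reduce to y in [0, 2 pi[ by the floor, then to [0, pi] by y -> 2 pi - y, where cos is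
    injective. *)
Lemma cos_eq1 (x : R) : cos x = 1 -> exists k : int, x = 2 * pi * k%:~R.
Proof.
move=> cx; have pi0 := pi_gt0 R; have pi20 : 0 < 2 * pi :> R by rewrite mulr_gt0.
pose k := Num.floor (x / (2 * pi)); exists k.
pose y := x - 2 * pi * k%:~R.
have cy : cos y = 1 by rewrite -cx -(periodic_intr y k (@cosD2pi R)) subrK.
have y0 : 0 <= y by rewrite subr_ge0 mulrC -ler_pdivlMr// floor_le_tmp.
have y1 : y < 2 * pi.
  rewrite ltrBlDr -{1}(mulr1 (2 * pi)) -mulrDr mulrC -ltr_pdivrMr//.
  by have h := floorD1_gt (x / (2 * pi)); rewrite -/k intrD/= addrC in h.
suff : y = 0 by rewrite /y => /eqP; rewrite subr_eq0 => /eqP.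
have [ypi|ypi] := leP y pi.
  by apply: cos_inj; rewrite ?in_itv/= ?lexx ?y0 ?ypi ?(ltW pi0)// cos0.
have : 2 * pi - y = 0.
  apply: cos_inj; rewrite ?in_itv/= ?lexx ?(ltW pi0)//; first by lra.
  by rewrite addrC mulr_natl cosD2pi cosN cy cos0.
by lra.
Qed.

Lemma expC_inj r s : expC r = expC s :> R[i] ->
  exists k : int, s = r + 0 +i* (2 * pi * k%:~R).
Proof.
move=> rs.
have hre : complex.Re r = complex.Re s by apply: expR_inj; rewrite -!modulus_expC rs.
have h1 : expC (s - r) = 1 by rewrite expCB rs divff// expC_neq0.
have : cos (complex.Im (s - r)) = 1.
  move: h1; rewrite /expC; have -> : complex.Re (s - r) = 0 by rewrite raddfB/= hre subrr.
  by rewrite expR0 mul1r => -[].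
move=> /cos_eq1[k hk]; exists k; move: hre hk.
case: r {rs h1} => r1 r2; case: s => s1 s2/= -> h.
by apply/eqP; rewrite eq_complex/= addr0 eqxx/= -h addrC subrK.
Qed.

Lemma expC_period z (k : int) : expC (z + 0 +i* (2 * pi * k%:~R)) = expC z.
Proof.
case: z => x y; rewrite /expC/= addr0 periodic_intr ?periodic_intr//.
  exact: sinD2pi.
exact: cosD2pi.
Qed.

(** Logarithms differ by integer multiples of 2 i pi and the argument lies in [0, 2 pi[, so the
    strip of height 2 pi b contains exactly those with index 0 <= k < b. This turns sums over
    logarithms into sums over sheets. *)
Lemma logs_strip (b : nat) m r : m != 0 ->
  (logs m r /\ 0 <= complex.Im r < 2 * pi * b%:R) <->
  (exists k : 'I_b, r = Log m + 0 +i* (2 * pi * k%:R)).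
Proof.
move=> m0; have pi0 := pi_gt0 R.
have /andP[a0 a1] := arg_itv m.
split.
  move=> [rm /andP[r0 r1]].
  have [k hk] : exists k : int, r = Log m + 0 +i* (2 * pi * k%:~R).
    by apply: expC_inj; rewrite LogK.
  have : complex.Im r = arg m + 2 * pi * k%:~R by rewrite hk.
  move=> E; rewrite E in r0 r1.
  have k0 : 0 <= k.
    rewrite leNgt; apply/negP => k0.
    have : k%:~R <= (-1)%:~R :> R by rewrite ler_int; lia.
    by rewrite intrN/= => ?; nra.
  move: k0 E r0 r1 hk; case: k => // k _ E r0 r1 hk.
  have kb : (k < b)%N by rewrite -(@ltr_nat R); rewrite -pmulrn in r1; nra.
  by exists (Ordinal kb).
move=> [k ->]; split; first by rewrite /logs/= -[k%:R]/(k%:Z%:~R) expC_period LogK.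
rewrite /=; have : (k%:R : R) + 1 <= b%:R by rewrite natr1 ler_nat.
have : 0 <= k%:R :> R by [].
by move=> ? ?; apply/andP; split; nra.
Qed.

(** The case b = 1 of [logs_strip], where the only sheet is 0. *)
Lemma Log_polar (t th : R) : 0 <= th < 2 * pi -> Log (expC (t +i* th)) = t +i* th.
Proof.
move=> hth; have z0 := expC_neq0 (t +i* th).
have : logs (expC (t +i* th)) (t +i* th) /\ 0 <= complex.Im (t +i* th) < 2 * pi * 1%:R.
  by rewrite mulr1.
move=> /(logs_strip _ _ z0)[[[|//] k1]] h.
by rewrite [RHS]h/= mulr0 -[X in _ = _ + X]/(0 : R[i]) addr0.
Qed.

Lemma LogZ (t : R) z : 0 < t -> z != 0 -> Log (t%:C * z) = (ln t)%:C + Log z.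
Proof.
move=> t0 z0; rewrite /Log modulusZ gtr0_norm// lnM ?posrE ?modulus_gt0//.
have -> : arg (t%:C * z) = arg z.
  case: z z0 => x y _; rewrite /arg/= !mul0r subr0 addr0 pmulr_rgt0// pmulr_rlt0// pmulr_rge0//.
  by rewrite -mulf_div divff ?mul1r// gt_eqF.
by apply/eqP; rewrite eq_complex/= add0r !eqxx.
Qed.

End ComplexLog.

Local Arguments modulus : simpl never.
Local Arguments expC : simpl never.
Local Arguments Log : simpl never.

(** * Limits of complex sequences *)

Section ComplexLimits.
Context {R : realType}.
Implicit Types (u v : nat -> R[i]) (l m : R[i]) (a b : nat -> R).

(** Coordinatewise, in accordance with the topology of R * R. *)
Definition cvgC u l :=
  complex.Re (u N) @[N --> \oo] --> complex.Re l /\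
  complex.Im (u N) @[N --> \oo] --> complex.Im l.

Lemma cvgC_modulusP u l :
  cvgC u l <-> modulus (u N - l) @[N --> \oo] --> (0 : R).
Proof.
split => [[hr hi]|h].
  apply: (@squeeze_cvgr _ _ _ _ (fun=> 0)
    (fun N => `|complex.Re (u N) - complex.Re l| + `|complex.Im (u N) - complex.Im l|)).
  - by apply: nearW => N; rewrite modulus_ge0/= (le_trans (modulus_le _))// !raddfB.
  - exact: cvg_cst.
  - rewrite -[X in _ --> X]addr0; apply: cvgD; apply/norm_cvg0P/subr_cvg0; [exact: hr|exact: hi].
by split; apply/subr_cvg0/norm_cvg0P;
  apply: (@squeeze_cvgr _ _ _ _ (fun=> 0) _ _ _ _ (cvg_cst _) h);
  apply: nearW => N; rewrite normr_ge0/= -raddfB ?Re_le_modulus ?Im_le_modulus.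
Qed.

Lemma cvgC_cst l : cvgC (fun=> l) l.
Proof. by split; exact: cvg_cst. Qed.

Lemma cvgCD u v l m : cvgC u l -> cvgC v m -> cvgC (fun N => u N + v N) (l + m).
Proof.
by move=> [ur ui] [vr vi]; split; rewrite raddfD/=; under eq_fun do rewrite raddfD/=; exact: cvgD.
Qed.

Lemma cvgCN u l : cvgC u l -> cvgC (fun N => - u N) (- l).
Proof.
by move=> [ur ui]; split; rewrite raddfN/=; under eq_fun do rewrite raddfN/=; exact: cvgN.
Qed.

Lemma Re_mul (z w : R[i]) : complex.Re (z * w) =
  complex.Re z * complex.Re w - complex.Im z * complex.Im w.
Proof. by case: z; case: w. Qed.

Lemma Im_mul (z w : R[i]) : complex.Im (z * w) =
  complex.Re z * complex.Im w + complex.Im z * complex.Re w.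
Proof. by case: z => ? ?; case: w. Qed.

Lemma cvgCM u v l m : cvgC u l -> cvgC v m -> cvgC (fun N => u N * v N) (l * m).
Proof.
move=> [ur ui] [vr vi]; split.
  by rewrite Re_mul; under eq_fun do rewrite Re_mul; apply: cvgB; exact: cvgM.
by rewrite Im_mul; under eq_fun do rewrite Im_mul; apply: cvgD; exact: cvgM.
Qed.

Lemma cvgCV u l : l != 0 -> cvgC u l -> cvgC (fun N => (u N)^-1) l^-1.
Proof.
move=> l0 [ur ui]; have n0 : complex.Re l ^+ 2 + complex.Im l ^+ 2 != 0.
  by rewrite -modulus_sqr sqrf_eq0 modulus_eq0.
have ReV (z : R[i]) : complex.Re z^-1 = complex.Re z / (complex.Re z ^+ 2 + complex.Im z ^+ 2).
  by case: z.
have ImV (z : R[i]) : complex.Im z^-1 = - (complex.Im z / (complex.Re z ^+ 2 + complex.Im z ^+ 2)).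
  by case: z.
have nV : (complex.Re (u N) ^+ 2 + complex.Im (u N) ^+ 2)^-1 @[N --> \oo] -->
    (complex.Re l ^+ 2 + complex.Im l ^+ 2)^-1.
  by apply: cvgV => //; apply: cvgD; rewrite expr2; under eq_fun do rewrite expr2; exact: cvgM.
split.
  by rewrite ReV; under eq_fun do rewrite ReV; exact: cvgM.
by rewrite ImV; under eq_fun do rewrite ImV; apply: cvgN; exact: cvgM.
Qed.

Lemma cvgC_eq u v l : (\forall N \near \oo, u N = v N) -> cvgC u l -> cvgC v l.
Proof.
move=> uv [ur ui]; split.
  apply: cvg_trans ur; apply: near_eq_cvg; apply: filterS uv => N -> //.
by apply: cvg_trans ui; apply: near_eq_cvg; apply: filterS uv => N -> //.
Qed.

Lemma cvgC_real a (x : R) : a @ \oo --> x -> cvgC (fun N => (a N)%:C) x%:C.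
Proof. by move=> ax; split => //; exact: cvg_cst. Qed.

Lemma cvgC_modulus u l : cvgC u l -> modulus (u N) @[N --> \oo] --> modulus l.
Proof.
move=> ul; have [h1 h2] := ul.
rewrite modulus_def; under eq_fun do rewrite modulus_def.
apply: (@continuous_cvg _ _ _ _ _ _ (@Num.sqrt R)); first exact: sqrt_continuous.
by apply: cvgD; rewrite expr2; under eq_fun do rewrite expr2; exact: cvgM.
Qed.

Lemma cvgC_expC u l : cvgC u l -> cvgC (fun N => expC (u N)) (expC l).
Proof.
move=> ul; have [h1 h2] := ul.
rewrite /expC; apply: cvgCM.
  by apply: cvgC_real; apply: continuous_cvg => //; exact: continuous_expR.
split; apply: continuous_cvg => //; [exact: continuous_cos|exact: continuous_sin].
Qed.

(** The imaginary part of u N eventually has the sign of that of l, so a single arctangent formula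
    gives both arguments. *)
Lemma cvgC_Log u l : complex.Im l != 0 -> cvgC u l -> cvgC (fun N => Log (u N)) (Log l).
Proof.
move=> l0 ul; have [h1 h2] := ul; have h3 := cvgC_modulus ul.
split.
  apply: continuous_cvg => //; apply: continuous_ln; rewrite modulus_gt0.
  by apply: contra_neq l0 => ->.
rewrite -[complex.Im (Log l)]/(arg l); under eq_fun do rewrite -[complex.Im _]/(arg (u _)).
have hq : atan (complex.Re (u N) / complex.Im (u N)) @[N --> \oo] -->
    atan (complex.Re l / complex.Im l).
  apply: continuous_cvg; first exact: continuous_atan.
  by apply: cvgM => //; exact: cvgV.
move: l0; rewrite neq_lt => /orP[l0|l0].
- have -> : arg l = 3 * pi / 2 - atan (complex.Re l / complex.Im l).
    by rewrite /arg ltNge (ltW l0)/= l0.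
  have near : \forall N \near \oo, 3 * pi / 2 - atan (complex.Re (u N) / complex.Im (u N)) = arg (u N).
    have : \forall N \near \oo, complex.Im (u N) < 0 by exact: (cvgr_lt _ h2).
    apply: filterS => N h.
    by rewrite /arg ltNge (ltW h)/= h.
  apply: cvg_trans; first exact: near_eq_cvg near.
  by apply: cvgB => //; exact: cvg_cst.
- have -> : arg l = pi / 2 - atan (complex.Re l / complex.Im l).
    by rewrite /arg l0.
  have near : \forall N \near \oo, pi / 2 - atan (complex.Re (u N) / complex.Im (u N)) = arg (u N).
    have : \forall N \near \oo, 0 < complex.Im (u N) by exact: (cvgr_gt _ h2).
    by apply: filterS => N h; rewrite /arg h.
  apply: cvg_trans; first exact: near_eq_cvg near.
  by apply: cvgB => //; exact: cvg_cst.
Qed.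

Lemma cvg_expC_ratio (alpha : R) u : 0 < alpha < 1 -> cvgC u 0 ->
  (\forall N \near \oo, expC (u N) != 1) ->
  cvgC (fun N => (expC (alpha%:C * u N) - 1) / (expC (u N) - 1)) alpha%:C.
Proof.
move=> al01 u0 un1; apply/cvgC_modulusP.
have m0 : modulus (u N) @[N --> \oo] --> (0 : R) by rewrite -(modulus0); exact: cvgC_modulus.
have small : \forall N \near \oo, modulus (u N) < 1 / 8.
  by apply: (cvgr_lt _ m0); rewrite divr_gt0.
(* 16 is the error 8 |u|^2 of [expC_ratio_quad] over the lower bound |u| / 2 of the denominator. *)
apply: (@squeeze_cvgr _ _ _ _ (fun=> 0) (fun N => 16 * modulus (u N))).
- near=> N; rewrite modulus_ge0/=.
  have n1 : expC (u N) - 1 != 0 by rewrite subr_eq0; near: N.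
  have sm : modulus (u N) <= 1 / 8 by apply: ltW; near: N.
  have -> : (expC (alpha%:C * u N) - 1) / (expC (u N) - 1) - alpha%:C =
    (expC (alpha%:C * u N) - 1 - alpha%:C * (expC (u N) - 1)) / (expC (u N) - 1).
    by rewrite [RHS]mulrBl mulfK.
  rewrite modulusM modulusV ler_pdivrMr ?modulus_gt0//.
  apply: (le_trans (expC_ratio_quad al01 sm)).
  have := expC_sub1_ge sm; have := modulus_ge0 (u N).
  move: (modulus (u N)) (modulus _) => x y x0 xy; nra.
- exact: cvg_cst.
- by rewrite -(mulr0 16); apply: cvgM => //; exact: cvg_cst.
Unshelve. all: by end_near. Qed.

Lemma cvg_plane_of (f : R * R -> R) u l : continuous f -> cvgC u l ->
  f (plane_of (u N)) @[N --> \oo] --> f (plane_of l).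
Proof.
move=> cf [h1 h2].
have h : (complex.Re (u N), complex.Im (u N)) @[N --> \oo] -->
    ((complex.Re l, complex.Im l) : R * R).
  exact: (@cvg_pair _ _ _ _ (nbhs (complex.Re l)) (nbhs (complex.Im l)) _ _ _ _ _ h1 h2).
exact: (cvg_comp _ f h (cf _)).
Qed.

End ComplexLimits.

(** * Asymptotics of a single pair (m, n) *)

Section PairTerm.
Context {R : realType}.
Variables (alpha : R) (phi : nat -> R) (f : R * R -> R).

(* The logarithm of z on the k-th sheet, Im in [2 pi k, 2 pi (k + 1)[. *)
Definition LogB (k : nat) (z : R[i]) : R[i] := Log z + 0 +i* (2 * pi * k%:R).

Definition pair_value (N k l : nat) (m n : R[i]) : R[i] :=
  (phi N)%:C * (expC (alpha%:C * LogB l n) - expC (alpha%:C * LogB k m)).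

Definition pair_cond (N k l : nat) (m n : R[i]) : bool :=
  [&& n != m, 0 < modulus m <= N%:R, 0 < modulus n <= N%:R &
      `|complex.Im (LogB k m) - complex.Im (LogB l n)| < 2 * pi].

Definition pair_term (N k l : nat) (m n : R[i]) : R :=
  if pair_cond N k l m n then f (plane_of (pair_value N k l m n)) else 0.

(* Side of the cells of the inner Riemann sum; psi N = (N / mesh N)^2. *)
Definition mesh (N : nat) : R := phi N / N%:R `^ (1 - alpha).

Lemma expC_LogB k z : z != 0 -> expC (LogB k z) = z.
Proof. by move=> z0; rewrite /LogB -[k%:R]/(k%:Z%:~R) expC_period LogK. Qed.

Lemma Im_LogB k z : complex.Im (LogB k z) = arg z + 2 * pi * k%:R.
Proof. by []. Qed.

Lemma modulus_expC_LogB k z : z != 0 ->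
  modulus (expC (alpha%:C * LogB k z)) = modulus z `^ alpha.
Proof.
move=> z0; rewrite modulus_expC Re_mul/= mul0r subr0 addr0 /powR modulus_eq0 (negbTE z0).
by [].
Qed.

Hypothesis alpha01 : 0 < alpha < 1.
Hypothesis phi0 : forall N, 0 < phi N.
Hypothesis f0 : forall x, 0 <= f x.
Variable C : R.
Hypothesis fC : forall z, f (plane_of z) != 0 -> modulus z <= C.

Lemma pair_term_ge0 N k l m n : 0 <= pair_term N k l m n.
Proof. by rewrite /pair_term; case: ifP. Qed.

Lemma mesh_gt0 N : (0 < N)%N -> 0 < mesh N.
Proof. by move=> N0; rewrite divr_gt0// powR_gt0// ltr0n. Qed.

(** A nonzero term has a value of modulus at most C, and [expC_diff_bound] multiplied by phi(N)
    transfers this to n - m. The bound depends neither on m nor on the sheets, and every domination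
    below relies on it. *)
Lemma pair_term_support : exists2 D, 0 < D & forall N k l m n, (0 < N)%N ->
  pair_term N k l m n != 0 -> mesh N * modulus (n - m) <= D.
Proof.
have [K K0 hK] := expC_diff_bound alpha01.
(* C has no prescribed sign; the absolute value and the 1 make D positive. *)
exists (K * `|C| + 1); first by rewrite ltr_wpDl// mulr_ge0// ltW.
move=> N k l m n N0; rewrite /pair_term; case: ifP => [|_]; last by rewrite eqxx.
move=> /and4P[nm /andP[m0 mN] /andP[n0 nN] him] /fC.
rewrite /pair_value modulusZ gtr0_norm// => hC.
rewrite modulus_gt0 in m0; rewrite modulus_gt0 in n0.
have := hK (LogB k m) (LogB l n) N%:R him.
rewrite !expC_LogB// => /(_ mN nN) h.
rewrite /mesh mulrAC ler_pdivrMr ?powR_gt0 ?ltr0n//.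
have P0 : 0 < N%:R `^ (1 - alpha) :> R by rewrite powR_gt0// ltr0n.
move: h hC; set P := N%:R `^ _; set X := modulus (_ - _); set Y := modulus (_ - _) => h hC.
have : phi N * X <= phi N * (K * P * Y) by rewrite ler_pM2l.
have -> : phi N * (K * P * Y) = K * P * (phi N * Y) by ring.
move=> /le_trans; apply.
have : K * P * (phi N * Y) <= K * P * `|C|.
  by rewrite ler_wpM2l ?mulr_ge0 ?(ltW K0) ?(ltW P0)// (le_trans hC)// ler_norm.
move=> /le_trans; apply; rewrite mulrAC -[leLHS]mulr1 -mulrA.
by rewrite mulr1 ler_wpM2r ?(ltW P0)// lerDl.
Qed.

Hypothesis phioo : phi N @[N --> \oo] --> +oo.
Hypothesis cf : continuous f.

(** This quantity is also [mesh N] times N. Its divergence makes differences p of order 1 / [mesh N]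
    negligible against N, and expels the terms on distinct sheets. *)
Lemma phi_pow_oo : phi N * N%:R `^ alpha @[N --> \oo] --> +oo.
Proof.
have /andP[al0 _] := alpha01.
apply/cvgryPge => A; have /cvgryPge/(_ `|A|) hA := phioo.
near=> N; have N1 : 1 <= N%:R :> R by rewrite ler1n; near: N; exact: nbhs_infty_gt.
have h1 : `|A| <= phi N by near: N; exact: hA.
have h2 : N%:R `^ 0 <= N%:R `^ alpha :> R by apply: ler_powR => //; exact: ltW.
rewrite powRr0 in h2.
rewrite (le_trans (ler_norm A))// (le_trans h1)// ler_peMr//.
exact: ltW.
Unshelve. all: by end_near. Qed.

Lemma mesh_natE N : (0 < N)%N -> mesh N * N%:R = phi N * N%:R `^ alpha.
Proof.
move=> N0; have N0' : 0 < N%:R :> R by rewrite ltr0n.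
have h : N%:R `^ (1 - alpha) * N%:R `^ alpha = N%:R :> R.
  by rewrite -powRD ?subrK ?powRr1 ?ltW// gt_eqF// implybT.
rewrite /mesh -{2}h; field.
by rewrite gt_eqF// powR_gt0.
Qed.

Variables (M p : nat -> R[i]) (x y : R[i]).
Hypothesis cM : cvgC (fun N => (N%:R^-1)%:C * M N) x.
Hypothesis cp : cvgC (fun N => (mesh N)%:C * p N) y.
Hypothesis x01 : 0 < modulus x < 1.
Hypothesis Imx : complex.Im x != 0.
Hypothesis y0 : y != 0.

Let n N := M N + p N.

Let x0 : x != 0.
Proof. by move: x01; rewrite modulus_gt0 => /andP[]. Qed.

Let nearN : \forall N \near \oo, (0 < N)%N.
Proof. exact: nbhs_infty_gt. Qed.

Let meshV : (mesh N * N%:R)^-1 @[N --> \oo] --> 0.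
Proof.
have : (phi N * N%:R `^ alpha)^-1 @[N --> \oo] --> 0.
  by apply/gtr0_cvgV0; [near=> N; rewrite mulr_gt0// powR_gt0// ltr0n; near: N|exact: phi_pow_oo].
apply: cvg_trans; apply: near_eq_cvg; near=> N; rewrite mesh_natE//; near: N; exact: nearN.
Unshelve. all: by end_near. Qed.

Let cpN : cvgC (fun N => (N%:R^-1)%:C * p N) 0.
Proof.
have h := cvgCM (cvgC_real meshV) cp; rewrite -[X in cvgC _ X](mul0r y).
apply: cvgC_eq h; near=> N.
have N0 : (0 < N)%N by near: N; exact: nearN.
have r0 := mesh_gt0 N0; have N0' : 0 < N%:R :> R by rewrite ltr0n.
rewrite mulrA -rmorphM/= invfM; congr (_%:C * _); field.
by rewrite !gt_eqF.
Unshelve. all: by end_near. Qed.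

Let cn : cvgC (fun N => (N%:R^-1)%:C * n N) x.
Proof.
have := cvgCD cM cpN; rewrite addr0; apply: cvgC_eq; apply: nearW => N.
by rewrite mulrDr.
Qed.

Let near_ball (v : nat -> R[i]) : cvgC (fun N => (N%:R^-1)%:C * v N) x ->
  \forall N \near \oo, 0 < modulus (v N) <= N%:R.
Proof.
move=> /cvgC_modulus h; have /andP[x1 x2] := x01; near=> N.
have N0 : (0 < N)%N by near: N; exact: nearN.
have N0' : 0 < N%:R :> R by rewrite ltr0n.
have h1 : 0 < modulus ((N%:R^-1)%:C * v N) by near: N; exact: (cvgr_gt _ h).
have h2 : modulus ((N%:R^-1)%:C * v N) < 1 by near: N; exact: (cvgr_lt _ h).
rewrite modulusZ gtr0_norm ?invr_gt0// in h1 h2.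
by rewrite mulrC pmulr_lgt0 ?invr_gt0// in h1; rewrite h1/= ltW// -(mulr1 N%:R) -ltr_pdivrMl.
Unshelve. all: by end_near. Qed.

Let Log_scale N (z : R[i]) : (0 < N)%N -> z != 0 -> Log z = (ln N%:R)%:C + Log ((N%:R^-1)%:C * z).
Proof.
move=> N0 z0; have N0' : 0 < N%:R :> R by rewrite ltr0n.
have iz : (N%:R^-1)%:C * z != 0.
  by rewrite mulf_neq0// (inj_eq (@complexI R)) invr_eq0 gt_eqF.
by rewrite -LogZ// mulrA -rmorphM divff ?gt_eqF// mul1r.
Qed.

Let u N := Log (n N) - Log (M N).

(** Dividing by N shifts both logarithms by ln N, and M / N and n / N have the same limit x, at
    which the logarithm is continuous. *)
Let cu : cvgC u 0.
Proof.
have h : cvgC (fun N => Log ((N%:R^-1)%:C * n N) - Log ((N%:R^-1)%:C * M N)) 0.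
  by rewrite -(subrr (Log x)); apply: cvgCD; [exact: cvgC_Log|apply: cvgCN; exact: cvgC_Log].
apply: cvgC_eq h; near=> N.
have N0 : (0 < N)%N by near: N; exact: nearN.
have M0 : M N != 0.
  by rewrite -modulus_gt0; have /andP[//] : 0 < modulus (M N) <= N%:R by near: N; exact: near_ball cM.
have n0 : n N != 0.
  by rewrite -modulus_gt0; have /andP[//] : 0 < modulus (n N) <= N%:R by near: N; exact: near_ball cn.
by rewrite /u (Log_scale N0 M0) (Log_scale N0 n0); ring.
Unshelve. all: by end_near. Qed.

Let near_p : \forall N \near \oo, p N != 0.
Proof.
have h := cvgC_modulus cp; near=> N.
have : 0 < modulus ((mesh N)%:C * p N) by near: N; apply: (cvgr_gt _ h); rewrite modulus_gt0.
by rewrite modulus_gt0; apply: contra_neq => ->; rewrite mulr0.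
Unshelve. all: by end_near. Qed.

(** The value is phi(N) exp (alpha LogB k M) (exp (alpha u) - 1). Replace the last factor by its
    ratio to exp u - 1 = p / M, which tends to alpha; the remaining powers combine through phi(N)
    N^alpha = [mesh N] N. *)
Lemma cvg_pair_value k : cvgC (fun N => pair_value N k k (M N) (n N))
  (alpha%:C * expC (alpha%:C * LogB k x) * (y / x)).
Proof.
have u1 : \forall N \near \oo, expC (u N) != 1.
  near=> N.
  have M0 : M N != 0.
    by rewrite -modulus_gt0; have /andP[//] : 0 < modulus (M N) <= N%:R by near: N; exact: near_ball cM.
  have n0 : n N != 0.
    by rewrite -modulus_gt0; have /andP[//] : 0 < modulus (n N) <= N%:R by near: N; exact: near_ball cn.
  have p0 : p N != 0 by near: N; exact: near_p.
  rewrite expCB !LogK//; apply: contra_neq p0 => h.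
  by have := congr1 (fun z => z * M N) h; rewrite divfK// mul1r /n -[RHS]addr0 => /addrI.
have hQ := cvg_expC_ratio alpha01 cu u1.
have hE : cvgC (fun N => expC (alpha%:C * LogB k ((N%:R^-1)%:C * M N))) (expC (alpha%:C * LogB k x)).
  apply: cvgC_expC; apply: cvgCM; first exact: cvgC_cst.
  by apply: cvgCD; [exact: cvgC_Log|exact: cvgC_cst].
have := cvgCM (cvgCM hQ hE) (cvgCM cp (cvgCV x0 cM)); apply: cvgC_eq; near=> N.
have N0 : (0 < N)%N by near: N; exact: nearN.
have N0' : 0 < N%:R :> R by rewrite ltr0n.
have M0 : M N != 0.
  by rewrite -modulus_gt0; have /andP[//] : 0 < modulus (M N) <= N%:R by near: N; exact: near_ball cM.
have n0 : n N != 0.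
  by rewrite -modulus_gt0; have /andP[//] : 0 < modulus (n N) <= N%:R by near: N; exact: near_ball cn.
have p0 : p N != 0 by near: N; exact: near_p.
have Eu : expC (u N) - 1 = p N / M N by rewrite expCB !LogK// /n mulrDl divff// addrAC subrr add0r.
rewrite Eu /pair_value.
have -> : LogB k (n N) = u N + LogB k (M N) by rewrite /LogB /u addrA subrK.
rewrite [alpha%:C * (u N + _)]mulrDr expCD.
have -> : LogB k (M N) = (ln N%:R)%:C + LogB k ((N%:R^-1)%:C * M N).
  by rewrite /LogB (Log_scale N0 M0) addrA.
rewrite [alpha%:C * (_%:C + _)]mulrDr [expC (_ + _)]expCD -[alpha%:C * _%:C]rmorphM/=.
have -> : expC (alpha * ln N%:R)%:C = (N%:R `^ alpha)%:C.
  rewrite /expC/= cos0 sin0 /powR gt_eqF//.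
  by apply/eqP; rewrite eq_complex/=; apply/andP; split; apply/eqP; ring.
have hr : (phi N)%:C * (N%:R `^ alpha)%:C = (mesh N)%:C * N%:R%:C.
  by rewrite -!rmorphM/= mesh_natE.
have Nc : (N%:R : R)%:C != 0 by rewrite (inj_eq (@complexI R)) gt_eqF.
rewrite rmorphV/= ?unitfE ?gt_eqF//.
move: hr Nc; set P := (phi N)%:C; set Q := (N%:R `^ alpha)%:C; set NN := (N%:R)%:C => hr Nc.
transitivity (P * Q * ((expC (alpha%:C * u N) - 1) * expC (alpha%:C * LogB k (NN^-1 * M N)))); last by ring.
rewrite hr; field.
by rewrite p0 M0 pnatr_eq0 -lt0n N0.
Unshelve. all: by end_near. Qed.

Let near_Im k l : complex.Im (LogB k (M N)) - complex.Im (LogB l (n N)) @[N --> \oo] -->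
  2 * pi * (k%:R - l%:R).
Proof.
have [_ h] := cu.
have -> : 2 * pi * (k%:R - l%:R) = - 0 + 2 * pi * (k%:R - l%:R) :> R by ring.
have : - complex.Im (u N) + 2 * pi * (k%:R - l%:R) @[N --> \oo] --> - 0 + 2 * pi * (k%:R - l%:R : R).
  by apply: cvgD; [exact: cvgN|exact: cvg_cst].
apply: cvg_trans; apply: near_eq_cvg; apply: nearW => N.
by rewrite !Im_LogB /u raddfB/= /Log/=; ring.
Qed.

Let near_Im_norm k l :
  `|complex.Im (LogB k (M N)) - complex.Im (LogB l (n N))| @[N --> \oo] -->
  `|2 * pi * (k%:R - l%:R)|.
Proof. by apply: cvg_norm; exact: near_Im. Qed.

Lemma cvg_pair_term k : pair_term N k k (M N) (n N) @[N --> \oo] -->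
  f (plane_of (alpha%:C * expC (alpha%:C * LogB k x) * (y / x))).
Proof.
have := cvg_plane_of cf (cvg_pair_value k); apply: cvg_trans; apply: near_eq_cvg; near=> N.
rewrite /pair_term ifT//; apply/and4P; split.
- have p0 : p N != 0 by near: N; exact: near_p.
  by apply: contra_neq p0; rewrite /n -[RHS]addr0 => /addrI.
- by near: N; exact: near_ball cM.
- by near: N; exact: near_ball cn.
- near: N; have h := @near_Im_norm k k; rewrite subrr mulr0 normr0 in h.
  by apply: (cvgr_lt _ h); rewrite mulr_gt0// pi_gt0.
Unshelve. all: by end_near. Qed.

(** With v the difference of the logarithms, Im v tends to 2 pi (l - k), so |v| > pi eventually. By
    [expC_small] with eta = pi, an admissible pair has |exp (alpha v) - 1| >= delta, and its value
    is at least phi(N) N^alpha c delta, beyond the support of f. *)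
Lemma cvg_pair_term_off k l : k != l -> pair_term N k l (M N) (n N) @[N --> \oo] --> (0 : R).
Proof.
move=> kl; have pi0 := pi_gt0 R; have /andP[al0 al1] := alpha01.
have [delta d0 hd] := expC_small alpha01 pi0.
have hIm := @near_Im_norm k l.
have kl1 : 1 <= `|k%:R - l%:R| :> R.
  rewrite -[k%:R]/(k%:Z%:~R) -[l%:R]/(l%:Z%:~R) -intrB -intr_norm -[1]/(1%:~R) ler_int.
  by rewrite -gtz0_ge1 normr_gt0 subr_eq0.
have /andP[x1 _] := x01; have hM := cvgC_modulus cM.
(* As |M N| / N tends to |x|, eventually |M N|^alpha >= c N^alpha. *)
pose c := (modulus x / 2) `^ alpha; have c0 : 0 < c by rewrite powR_gt0// divr_gt0.
have /cvgryPgt/(_ (C / (c * delta))) hphi := phi_pow_oo.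
apply: (@cvg_trans _ (0 @[N --> \oo])); last exact: cvg_cst.
apply: near_eq_cvg; near=> N; rewrite /pair_term; case: ifP => // /and4P[_ /andP[M0 _] /andP[n0 _] him].
apply/eqP; apply: contraT; rewrite eq_sym => /fC.
rewrite modulus_gt0 in M0; rewrite modulus_gt0 in n0.
rewrite /pair_value modulusZ gtr0_norm//.
pose v := LogB l (n N) - LogB k (M N).
have -> : expC (alpha%:C * LogB l (n N)) - expC (alpha%:C * LogB k (M N)) =
    expC (alpha%:C * LogB k (M N)) * (expC (alpha%:C * v) - 1).
  by rewrite mulrBr mulr1 -expCD -mulrDr /v [LogB k _ + _]addrC subrK.
rewrite modulusM modulus_expC_LogB// => hC.
have N0 : (0 < N)%N by near: N; exact: nearN.
have N0' : 0 < N%:R :> R by rewrite ltr0n.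
have hMN : N%:R `^ alpha * c <= modulus (M N) `^ alpha.
  have h1 : modulus x / 2 < modulus ((N%:R^-1)%:C * M N).
    by near: N; apply: (cvgr_gt _ hM); rewrite ltr_pdivrMr// mulr_natr mulr2n ltrDl.
  rewrite modulusZ gtr0_norm ?invr_gt0// ltr_pdivlMl// in h1.
  rewrite -powRM ?divr_ge0 ?modulus_ge0 ?ler0n//.
  rewrite ge0_ler_powR ?(ltW al0) ?nnegrE ?modulus_ge0 ?mulr_ge0 ?divr_ge0 ?modulus_ge0 ?ler0n//.
  exact: ltW.
have hp : C / (c * delta) < phi N * N%:R `^ alpha by near: N; exact: hphi.
have small : modulus (expC (alpha%:C * v) - 1) < delta.
  rewrite ltNge; apply/negP => dle.
  have : phi N * (N%:R `^ alpha * c * delta) <= C.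
    rewrite (le_trans _ hC)// ler_pM2l// ler_pM// ?(ltW d0)// mulr_ge0 ?powR_ge0 ?(ltW c0)//.
  rewrite ltr_pdivrMr ?mulr_gt0// in hp.
  by move: hp; rewrite !mulrA => hp /(lt_le_trans hp); rewrite ltxx.
have := hd v; rewrite raddfB/= distrC => /(_ him small).
rewrite ltNge => /negP; case; rewrite (le_trans _ (Im_le_modulus v))// raddfB/= distrC.
apply: ltW; near: N; apply: (cvgr_gt _ hIm).
rewrite normrM gtr0_norm ?mulr_gt0//; nra.
Unshelve. all: by end_near. Qed.

End PairTerm.

(** * Sums over Z^2 as integrals of functions constant on squares *)

Section Cells.
Context {R : realType}.
Local Open Scope ereal_scope.
Notation mu := (@lebesgue_measure R).
Notation T := (measurableTypeR R).
Implicit Types (e : R) (G : int * int -> \bar R).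

Definition cell_index e (x : plane R) : int * int :=
  (Num.floor (x.1 / e)%R, Num.floor (x.2 / e)%R).

Definition cell e (q : int * int) : set (plane R) :=
  [set` `[(e * q.1%:~R)%R, (e * (q.1 + 1)%:~R)%R[] `*`
  [set` `[(e * q.2%:~R)%R, (e * (q.2 + 1)%:~R)%R[].

Lemma cellP e q x : (0 < e)%R -> cell e q x <-> cell_index e x = q.
Proof.
move=> e0.
have P (t : R) (i : int) : (t \in `[(e * i%:~R)%R, (e * (i + 1)%:~R)%R[) <-> (Num.floor (t / e)%R = i).
  rewrite in_itv/= mulrC -ler_pdivlMr// [(e * _)%R]mulrC -ltr_pdivrMr//.
  split=> [/floor_def//|<-]; rewrite floor_le_tmp/=; exact: floorD1_gt.
rewrite /cell /cell_index/=; split => [[/P -> /P ->]|<-]; first by case: q.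
by split; apply/P.
Qed.

Lemma measurable_cell e q : measurable (cell e q).
Proof. exact: measurableX. Qed.

Lemma Leb_cell e q : (0 < e)%R -> Leb R (cell e q) = (e ^+ 2)%:E.
Proof.
move=> e0; rewrite /cell Leb_setX//.
have P (i : int) : mu [set` `[(e * i%:~R)%R, (e * (i + 1)%:~R)%R[] = e%:E.
  rewrite lebesgue_measure_itv/= lte_fin ltr_pM2l// ltr_int ltrDl ltr01 -EFinB.
  by congr EFin; rewrite intrD/=; ring.
by rewrite !P -EFinM expr2.
Qed.

Lemma measurable_cell_fun e G : (0 < e)%R ->
  measurable_fun setT (fun x : plane R => G (cell_index e x)).
Proof.
move=> e0 _ B mB; rewrite setTI.
rewrite [X in measurable X](_ : _ = \bigcup_(q in [set q | B (G q)]) cell e q).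
  rewrite bigcup_mkcond; apply: countable_bigcupT_measurable.
    exact: countableP.
  by move=> q; case: ifP => _; [exact: measurable_cell|exact: measurable0].
apply/seteqP; split=> [x /= Bx|x [q /= Bq] /(cellP _ _ e0)]; last by rewrite /= => ->.
by exists (cell_index e x) => //; apply/cellP.
Qed.

Lemma integral_cell e G : (0 < e)%R -> (forall q, 0 <= G q) ->
  \int[Leb R]_x G (cell_index e x) = \esum_(q in setT) ((e ^+ 2)%:E * G q).
Proof.
move=> e0 G0.
(* The squares are enumerated by the codes of their indices; a number coding no pair gets the empty
   set. *)
pose F (n : nat) : set (plane R) := if @pickle_inv (int * int)%type n is Some q then cell e q else set0.
have mF n : measurable (F n) by rewrite /F; case: pickle_inv => // q; exact: measurable_cell.
have UF : \bigcup_n F n = setT.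
  rewrite -subTset => x _; exists (pickle (cell_index e x)); first exact: I.
  by rewrite /F pickleK_inv; apply/cellP.
have tF : trivIset setT F.
  apply/trivIsetP => i j _ _ ij; apply/seteqP; split => // x [].
  rewrite /F; have := @pickle_invK (int * int)%type i; have := @pickle_invK (int * int)%type j.
  case: pickle_inv => // q1 /= h1; case: pickle_inv => // q2 /= h2.
  move=> /(cellP _ _ e0) E2 /(cellP _ _ e0) E1.
  by move: ij; rewrite -h1 -h2 -E1 -E2 eqxx.
pose a (n : nat) : \bar R :=
  if @pickle_inv (int * int)%type n is Some q then (e ^+ 2)%:E * G q else 0.
have a0 n : 0 <= a n.
  by rewrite /a; case: pickle_inv => // q; rewrite mule_ge0// lee_fin sqr_ge0.
rewrite -[in LHS]UF ge0_integral_bigcup//; last first.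
  by rewrite UF; exact: measurable_cell_fun.
transitivity (\sum_(n <oo) a n).
  apply: eq_eseriesr => n _; rewrite /F /a; case: pickle_inv => [q|]; last by rewrite integral_set0.
  rewrite (eq_integral (cst (G q))); last by move=> x /[1!inE] /(cellP _ _ e0) ->.
  by rewrite integral_cst; [rewrite Leb_cell// muleC|exact: measurable_cell].
rewrite nneseries_esumT//.
transitivity (\esum_(n in [set pickle q | q in [set: int * int]]) a n).
  rewrite [RHS]esum_mkcond; apply: eq_esum => n _; case: ifPn => // nP.
  rewrite /a; have := @pickle_invK (int * int)%type n; case: pickle_inv => // q /= h.
  by case/negP: nP; rewrite inE; exists q.
rewrite esum_image; last by move=> q1 q2 _ _; exact: (pcan_inj pickleK).
by apply: eq_esum => q _; rewrite /a pickleK_inv.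
Qed.

(** A sum over Z^2 is an integral over cells of side 1, so this is linearity of the integral. *)
Lemma esumZ_int (c : R) G : (0 <= c)%R -> (forall q, 0 <= G q) ->
  \esum_(q in setT) (c%:E * G q) = c%:E * \esum_(q in setT) G q.
Proof.
move=> c0 G0.
have H (K : int * int -> \bar R) : (forall q, 0 <= K q) ->
  \esum_(q in setT) K q = \int[Leb R]_x K (cell_index 1%R x).
  move=> K0; rewrite integral_cell//; apply: eq_esum => q _.
  by rewrite expr1n mul1e.
rewrite !H//; last by move=> q; rewrite mule_ge0.
by rewrite ge0_integralZl//; exact: measurable_cell_fun.
Qed.

Lemma cell_index_approx e (t : R) : (0 < e)%R ->
  (`|e * (Num.floor (t / e))%:~R - t| <= e)%R.
Proof.
move=> e0; have h1 := floor_le_tmp (t / e); have h2 := floorD1_gt (t / e).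
rewrite ler_pdivlMr// in h1; rewrite ltr_pdivrMr// intrD/= in h2.
by rewrite ler_norml; apply/andP; split; lra.
Qed.

(** On D, Phi is the limit of its samples at the lower left corners of the squares of side 1 / (n +
    1), which are measurable. The corners may lie outside D, so continuity at points of D is asked
    along all sequences. *)
Lemma measurable_seq_continuous (D : set (plane R)) (Phi : plane R -> \bar R) :
  measurable D ->
  (forall x (s t : nat -> R), D x -> s @ \oo --> (x.1 : R) -> t @ \oo --> (x.2 : R) ->
     Phi (s n, t n) @[n --> \oo] --> Phi x) ->
  measurable_fun D Phi.
Proof.
move=> mD H.
pose e (n : nat) : R := (n.+1%:R^-1)%R.
have e0 n : (0 < e n)%R by rewrite invr_gt0.
pose st n (x : R) : R := (e n * (Num.floor (x / e n))%:~R)%R.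
have cst (x : R) : st n x @[n --> \oo] --> x.
  apply/subr_cvg0/norm_cvg0P.
  apply: (@squeeze_cvgr _ _ _ _ (fun=> 0%R) e); [|exact: cvg_cst|exact: cvg_harmonic].
  by apply: nearW => n; rewrite normr_ge0/=; exact: cell_index_approx.
pose G n (q : int * int) := Phi (e n * q.1%:~R, e n * q.2%:~R)%R.
apply: (@emeasurable_fun_cvg _ _ _ _ (fun n x => G n (cell_index (e n) x))).
  by move=> n; apply: measurable_funTS; exact: measurable_cell_fun.
by move=> x Dx; exact: (H x (st^~ x.1) (st^~ x.2) Dx (cst _) (cst _)).
Qed.

Lemma continuous_measurable_plane (f : R * R -> R) : continuous f ->
  measurable_fun [set: plane R] (f : plane R -> R).
Proof.
move=> cf; apply/measurable_EFinP; apply: measurable_seq_continuous => // x s t _ sx tx.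
apply/cvg_EFin; first exact: nearW.
have h : (s n, t n) @[n --> \oo] --> ((x.1, x.2) : R * R).
  exact: (@cvg_pair _ _ _ _ (nbhs (x.1 : R)) (nbhs (x.2 : R)) _ _ _ _ _ sx tx).
by have := cvg_comp _ f h (cf _); rewrite -surjective_pairing.
Qed.

End Cells.

(** * Lattice coordinates and covolume *)

Section Lattice.
Context {R : realType}.
Variables (w1 w2 : R[i]).

Definition det2 : R := complex.Re w1 * complex.Im w2 - complex.Im w1 * complex.Re w2.

(** A zero determinant makes Im w2, - Im w1 and Re w2, - Re w1 coefficients of two real relations;
    they vanish, so w1 = w2 = 0, which is absurd. *)
Lemma det2_neq0 : real_independent w1 w2 -> det2 != 0.
Proof.
rewrite /det2 => hw; apply/eqP => d0.
move: hw d0; case: w1 => a b; case: w2 => c d /= hw d0.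
have [d1 b1] : d = 0 /\ - b = 0.
  by apply: hw; apply/eqP; rewrite eq_complex/=; apply/andP; split; apply/eqP; [rewrite -[RHS]d0|]; ring.
have [c1 a1] : c = 0 /\ - a = 0.
  by apply: hw; apply/eqP; rewrite eq_complex/=; apply/andP; split; apply/eqP; [|rewrite -[RHS]oppr0 -[in RHS]d0]; ring.
have /eqP : (1 : R) = 0; last by rewrite oner_eq0.
have [//] : (1 : R) = 0 /\ (0 : R) = 0.
apply: hw; apply/eqP; rewrite eq_complex/=.
move/eqP: a1; move/eqP: b1; rewrite !oppr_eq0 => /eqP -> /eqP ->; rewrite c1 d1.
by apply/andP; split; apply/eqP; ring.
Qed.

Definition lincomb (x : plane R) : R[i] := x.1%:C * w1 + x.2%:C * w2.

Definition lat (q : int * int) : R[i] := q.1%:~R%:C * w1 + q.2%:~R%:C * w2.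

Lemma plane_comb x : plane_of (lincomb x) =
  (x.1 * complex.Re w1 + x.2 * complex.Re w2, x.1 * complex.Im w1 + x.2 * complex.Im w2).
Proof.
rewrite /lincomb /plane_of; case: w1 => a b; case: w2 => c d /=.
by congr (_, _); ring.
Qed.

Lemma intrC (k : int) : (k%:~R : R[i]) = (k%:~R : R)%:C.
Proof. by rewrite rmorph_int. Qed.

Lemma latticeE : lattice w1 w2 = range lat.
Proof.
apply/seteqP; split=> [p [k [l ->]]|_ [[k l] _ <-]].
  by exists (k, l) => //; rewrite /lat/= !intrC.
by exists k, l; rewrite /lat/= !intrC.
Qed.

Hypothesis hw : real_independent w1 w2.

Lemma lat_inj : injective lat.
Proof.
move=> [k l] [k' l'] /eqP; rewrite -subr_eq0 /lat/= => /eqP h.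
have [/eqP + /eqP] : (k - k')%:~R = 0 :> R /\ (l - l')%:~R = 0 :> R.
  by apply: hw; rewrite !intrB !rmorphB/= -h; ring.
by rewrite !intr_eq0 !subr_eq0 => /eqP -> /eqP ->.
Qed.

Lemma lat0 q : (lat q == 0) = (q == 0).
Proof.
have -> : 0 = lat 0 by rewrite /lat/= !mul0r addr0.
by rewrite (inj_eq lat_inj).
Qed.

(** Cramer's rule. The bound makes the lattice discrete: a disc contains finitely many of its
    points. *)
Lemma comb_bound : exists2 c : R, 0 < c & forall x : plane R,
  `|x.1| <= c * modulus (lincomb x) /\ `|x.2| <= c * modulus (lincomb x).
Proof.
have D0 := det2_neq0 hw.
pose S := `|complex.Re w1| + `|complex.Im w1| + `|complex.Re w2| + `|complex.Im w2|.
have S0 : 0 <= S by rewrite !addr_ge0.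
exists ((S + 1) / `|det2|); first by rewrite divr_gt0 ?normr_gt0// ltr_wpDl.
move=> x; have hr := Re_le_modulus (lincomb x); have hi := Im_le_modulus (lincomb x).
have E : plane_of (lincomb x) = (complex.Re (lincomb x), complex.Im (lincomb x)) by [].
rewrite plane_comb in E; case: E => E1 E2.
have m0 := modulus_ge0 (lincomb x).
have k1 : x.1 * det2 = complex.Re (lincomb x) * complex.Im w2 - complex.Im (lincomb x) * complex.Re w2.
  by rewrite -E1 -E2 /det2; ring.
have k2 : x.2 * det2 = complex.Im (lincomb x) * complex.Re w1 - complex.Re (lincomb x) * complex.Im w1.
  by rewrite -E1 -E2 /det2; ring.
have B (s t p q : R) : `|s| <= modulus (lincomb x) -> `|t| <= modulus (lincomb x) ->
    `|p| + `|q| <= S + 1 -> `|s * p - t * q| <= (S + 1) * modulus (lincomb x).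
  move=> hs ht hpq; rewrite (le_trans (ler_normB _ _))// !normrM.
  apply: (@le_trans _ _ (modulus (lincomb x) * `|p| + modulus (lincomb x) * `|q|)).
    by apply: lerD; rewrite ler_wpM2r.
  by rewrite -mulrDr mulrC ler_wpM2r.
have D0' : 0 < `|det2| by rewrite normr_gt0.
by split; rewrite mulrAC ler_pdivlMr// -normrM ?k1 ?k2; apply: B => //; rewrite /S;
  have := normr_ge0 (complex.Re w1); have := normr_ge0 (complex.Im w1);
  have := normr_ge0 (complex.Re w2); have := normr_ge0 (complex.Im w2); lra.
Qed.

Lemma lat_comb q : lat q = lincomb (q.1%:~R, q.2%:~R).
Proof. by []. Qed.

Lemma integral_comb (g : plane R -> \bar R) :
  measurable_fun setT g -> (forall x, 0 <= g x)%E ->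
  (\int[Leb R]_x g x = `|det2|%:E * \int[Leb R]_x g (plane_of (lincomb x)))%E.
Proof.
move=> mg g0; rewrite (ge0_integral_linear (det2_neq0 hw) mg g0); congr (_ * _)%E.
by apply: eq_integral => x _; rewrite plane_comb.
Qed.

Lemma measurable_comb : measurable_fun setT (fun x : plane R => plane_of (lincomb x)).
Proof.
under eq_fun do rewrite plane_comb.
by apply: measurable_fun_pair; apply: measurable_funD; apply: measurable_funM.
Qed.

(** The parallelogram is the preimage of the unit square under the inverse map given by Cramer's
    rule, whence its measurability; its area is the Jacobian. *)
Lemma covolE : covol w1 w2 = `|det2|.
Proof.
have D0 := det2_neq0 hw.
pose Q : set (plane R) := `[0, 1[%classic `*` `[0, 1[%classic.
have mQ : measurable Q by exact: measurableX.
pose inv (z : plane R) : plane R :=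
  ((z.1 * complex.Im w2 - z.2 * complex.Re w2) / det2,
   (z.2 * complex.Re w1 - z.1 * complex.Im w1) / det2).
have combK x : inv (plane_of (lincomb x)) = x.
  by rewrite plane_comb /inv/=; case: x => s t/=; congr (_, _); move: D0; rewrite /det2 => D0; field.
have invK z : plane_of (lincomb (inv z)) = z.
  by rewrite plane_comb /inv/=; case: z => s t/=; congr (_, _); move: D0; rewrite /det2 => D0; field.
have PE : parallelogram w1 w2 = inv @^-1` Q.
  apply/seteqP; split => [z [s [t [hs ht ->]]]|z].
    change (Q (inv (plane_of (lincomb (s, t))))).
    by rewrite combK; split; rewrite /= in_itv.
  rewrite /preimage /Q/= !in_itv/= => -[h1 h2].
  by exists (inv z).1, (inv z).2; split => //; rewrite -[in LHS](invK z).
have minv : measurable_fun setT inv.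
  by apply: measurable_fun_pair; apply: measurable_funM => //; apply: measurable_funB; apply: measurable_funM.
have mP : measurable (parallelogram w1 w2).
  by rewrite PE -[X in measurable X]setTI; exact: minv.
rewrite /covol; suff -> : Leb R (parallelogram w1 w2) = `|det2|%:E by [].
have := @integral_comb (fun z => (\1_(parallelogram w1 w2) z)%:E).
rewrite integral_indic// setIT => ->//; last first.
  exact/measurable_EFinP/measurable_indic.
under eq_integral => x _.
  have -> : \1_(parallelogram w1 w2) (plane_of (lincomb x)) = \1_Q x :> R.
    rewrite !indicE PE; congr (_%:R); congr nat_of_bool.
    by apply/idP/idP; rewrite !inE /preimage /mkset combK.
  over.
rewrite integral_indic// setIT /Q Leb_setX// lebesgue_measure_itv/= lte_fin ltr01.
by rewrite -EFinB subr0 -EFinM !mulr1.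
Qed.

End Lattice.

(** * The pair correlation as a measure and its integrals *)

Section FiniteDirac.
Context {R : realType}.
Local Open Scope ereal_scope.

(** Identifies a bare set function with a genuine measure, so that integration theory applies to it.
    An empty index set is apart because enumerating A takes one of its elements as default. *)
Lemma finite_dirac_measure (I : choiceType) (A : set I) (pt : I -> plane R) (c : R) :
  finite_set A -> (0 <= c)%R ->
  exists2 nu : {measure set (plane R) -> \bar R},
    (fun B => c%:E * \esum_(q in A) \d_(pt q) B) = nu :> (set (plane R) -> \bar R) &
    forall g : plane R -> \bar R, measurable_fun setT g -> (forall x, 0 <= g x) ->
      \int[nu]_x g x = c%:E * \esum_(q in A) g (pt q).
Proof.
move=> fA c0; pose s := finmap.enum_fset (fset_set A).
have [->|/set0P[q0 _]] := eqVneq A set0.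
  exists mzero; first by apply/funext => B; rewrite esum_set0 mule0.
  by move=> g _ _; rewrite integral_measure_zero esum_set0 mule0.
pose m_ (i : nat) : {measure set (plane R) -> \bar R} := \d_(pt (nth q0 s i)).
pose cn : {nonneg R} := NngNum c0.
have sumE (h : I -> \bar R) : (forall q, 0 <= h q) ->
  \esum_(q in A) h q = \sum_(i < size s) h (nth q0 s i).
  by move=> h0; rewrite esum_fset// fsbig_finite//= (big_nth q0) big_mkord.
exists (mscale cn (msum m_ (size s))).
  by apply/funext => B; rewrite /mscale/= sumE.
move=> g mg g0; rewrite ge0_integral_mscale// ge0_integral_measure_sum//=; congr (_ * _).
rewrite sumE//; apply: eq_bigr => i _.
by rewrite integral_dirac// diracT mul1e.
Qed.

End FiniteDirac.

Section PairMeasure.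
Context {R : realType}.
Local Open Scope ereal_scope.
Variables (alpha : R) (z0 w1 w2 : R[i]) (phi psi : nat -> R) (b : nat) (f : R * R -> R).
Hypothesis hw : real_independent w1 w2.
Hypothesis f0 : forall x, (0 <= f x)%R.
Hypothesis mf : measurable_fun [set: plane R] (f : plane R -> R).
Hypothesis psi0 : forall N, (0 < psi N)%R.

(** The sheets of r and s, the lattice coordinates of m - z0, and those of p = n - m. *)
Let idx := ('I_b * 'I_b * ((int * int) * (int * int)))%type.
Let gp (q : int * int) : R[i] := (z0 + lat w1 w2 q)%R.

Let cond N (j : idx) := pair_cond N j.1.1 j.1.2 (gp j.2.1) (gp j.2.1 + lat w1 w2 j.2.2)%R.

Let emb (j : idx) : R[i] * R[i] * R[i] * R[i] :=
  let m := gp j.2.1 in let n := (m + lat w1 w2 j.2.2)%R in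
  (m, n, LogB j.1.1 m, LogB j.1.2 n).

Let lat_add q q' : (lat w1 w2 q + lat w1 w2 q')%R = lat w1 w2 (q.1 + q'.1, q.2 + q'.2)%R.
Proof. by rewrite /lat/= !intrD !rmorphD/=; ring. Qed.

Let emb_inj : injective emb.
Proof.
move=> [[k l] [q q']] [[k' l'] [t t']]; rewrite /emb/= => -[] /addrI /(lat_inj hw) <-.
move=> /addrI /(lat_inj hw) <- _ h1 _ h2.
have pi0 := pi_gt0 R.
have E (i j : 'I_b) (a : R) : (a + 2 * pi * i%:R = a + 2 * pi * j%:R)%R -> i = j.
  move=> /addrI /(mulfI _) h; apply/val_inj/eqP; rewrite -(eqr_nat R); apply/eqP; apply: h.
  by rewrite mulf_neq0// gt_eqF.
by rewrite (E _ _ _ h1) (E _ _ _ h2).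
Qed.

Let embE N : pair_index (grid z0 w1 w2) b N = emb @` [set j | cond N j].
Proof.
apply/seteqP; split.
  move=> [[[m n] r] s] [[Lm Ln] nm [hm hn] [lm ln] [him hr hs]].
  move: Lm => [_ [k1 [l1 ->]] mE]; move: Ln => [_ [k2 [l2 ->]] nE].
  have m0 : m != 0%R by case/andP: hm => + _; rewrite modulus_gt0.
  have n0 : n != 0%R by case/andP: hn => + _; rewrite modulus_gt0.
  have [k rk] : exists k : 'I_b, r = LogB k m by apply/logs_strip.
  have [l sl] : exists l : 'I_b, s = LogB l n by apply/logs_strip.
  have mE' : m = gp (k1, l1) by rewrite -mE /gp /lat/= -!intrC.
  have nE' : n = (gp (k1, l1) + lat w1 w2 (k2 - k1, l2 - l1)%R)%R.
    by rewrite -nE /gp /lat/= -!intrC !intrB; ring.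
  exists (k, l, ((k1, l1), (k2 - k1, l2 - l1)%R)).
    rewrite /= /cond/= -nE' -mE'; apply/and4P; split => //; first exact/eqP.
    by rewrite -rk -sl.
  by rewrite /emb/= -nE' -mE' -rk -sl.
move=> _ [[[k l] [q q']] + <-]; rewrite /= /cond/= => /and4P[nm hm hn him].
set m := gp q in nm hm hn him *; set n := (m + _)%R in nm hm hn him *.
have m0 : m != 0%R by case/andP: hm => + _; rewrite modulus_gt0.
have n0 : n != 0%R by case/andP: hn => + _; rewrite modulus_gt0.
have [lm hr] : logs m (LogB k m) /\ (0 <= complex.Im (LogB k m) < 2 * pi * b%:R)%R.
  by apply/logs_strip => //; exists k.
have [ln hs] : logs n (LogB l n) /\ (0 <= complex.Im (LogB l n) < 2 * pi * b%:R)%R.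
  by apply/logs_strip => //; exists l.
split => //; first split.
- by exists (lat w1 w2 q) => //; rewrite latticeE; exists q.
- by rewrite /n /m /gp -addrA lat_add; eexists; last by []; rewrite latticeE; eexists.
- exact/eqP.
Qed.

Lemma finite_int_box (B : nat) :
  finite_set [set q : int * int | (`|q.1| <= B%:Z)%R /\ (`|q.2| <= B%:Z)%R].
Proof.
have fB : finite_set [set i : int | (`|i| <= B%:Z)%R].
  apply: (@sub_finite_set _ _ ((fun n : nat => n%:Z - B%:Z)%R @` `I_(B + B).+1)).
    by move=> i /= hi; exists (absz (i + B%:Z)%R); rewrite /=; lia.
  exact: finite_image.
by apply: sub_finite_set (finite_setX fB fB) => -[i j].
Qed.

Lemma finite_lat_ball (A : R) : finite_set [set q | (modulus (lat w1 w2 q) <= A)%R].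
Proof.
have [c c0 hc] := comb_bound hw.
apply: sub_finite_set (finite_int_box (Num.bound (c * A))) => q /= hq.
have B (i : int) : (`|i%:~R : R| <= c * modulus (lat w1 w2 q))%R -> (`|i| <= (Num.bound (c * A))%:Z)%R.
  move=> h; rewrite -(ler_int R) intr_norm (le_trans h)//.
  rewrite (@le_trans _ _ (c * A)%R)//; first by rewrite ler_pM2l.
  rewrite -[leRHS]/((Num.bound (c * A))%:R)%R ltW// archi_boundP//.
  by rewrite mulr_ge0 ?(ltW c0)// (le_trans (modulus_ge0 _) hq).
by have [h1 h2] := hc (q.1%:~R, q.2%:~R)%R; split; apply: B.
Qed.

Let fin_cond N : finite_set [set j | cond N j].
Proof.
have fq := finite_lat_ball (N%:R + modulus z0).
have fq' := finite_lat_ball (N%:R + N%:R).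
have fI : finite_set [set: 'I_b * 'I_b] by exact: finite_finset.
apply: sub_finite_set (finite_setX fI (finite_setX fq fq')) => -[kl [q q']] /=.
rewrite /cond/= => /and4P[_ /andP[_ hm] /andP[_ hn] _]; split => //=; split.
  have -> : lat w1 w2 q = (gp q - z0)%R by rewrite /gp addrAC subrr add0r.
  by rewrite (le_trans (modulusD _ _))// modulusN lerD2r.
have -> : lat w1 w2 q' = ((gp q + lat w1 w2 q') - gp q)%R by rewrite addrAC subrr add0r.
by rewrite (le_trans (modulusD _ _))// modulusN lerD.
Qed.

Lemma pair_measure_measure N :
  exists2 nu : {measure set (plane R) -> \bar R},
    pair_measure alpha (grid z0 w1 w2) phi psi b N = nu :> (set (plane R) -> \bar R) &
    forall g : plane R -> \bar R, measurable_fun setT g -> (forall x, 0 <= g x) ->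
      \int[nu]_x g x = ((b%:R * psi N)^-1)%:E *
        \esum_(q in pair_index (grid z0 w1 w2) b N) g (pair_point alpha (phi N) q).
Proof.
apply: finite_dirac_measure; first by rewrite embE; exact: finite_image.
by rewrite invr_ge0 mulr_ge0// ltW.
Qed.

(** The conditions on m, n, r, s pass from the index set into [pair_term], which is 0 when they
    fail, so both sums run over all of Z^2. *)
Lemma integral_pair_measure N :
  \int[pair_measure alpha (grid z0 w1 w2) phi psi b N]_x (f x)%:E =
  ((b%:R * psi N)^-1)%:E * \sum_(kl : 'I_b * 'I_b) \esum_(q in setT) \esum_(q' in setT)
     (pair_term alpha phi f N kl.1 kl.2 (gp q) (gp q + lat w1 w2 q'))%:E.
Proof.
have [nu -> ->//] := pair_measure_measure N; last exact/measurable_EFinP.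
congr (_ * _); rewrite embE esum_image; last by move=> j j' _ _; exact: emb_inj.
rewrite esum_mkcond.
pose t (kl : 'I_b * 'I_b) (qq : (int * int) * (int * int)) : \bar R :=
  (pair_term alpha phi f N kl.1 kl.2 (gp qq.1) (gp qq.1 + lat w1 w2 qq.2))%:E.
transitivity (\esum_(kl in [set: 'I_b * 'I_b]) \esum_(qq in setT) t kl qq).
  rewrite esum_esum; last by move=> *; rewrite lee_fin pair_term_ge0.
  rewrite (_ : setT `*`` _ = setT); last by apply/seteqP; split.
  apply: eq_esum => -[kl qq] _; rewrite /t /pair_term /=.
  have -> : ((kl, qq) \in [set j | cond N j]) = cond N (kl, qq).
    by apply/idP/idP; rewrite inE.
  by rewrite /cond/=; case: ifP.
rewrite esum_fset//=; last by move=> *; apply: esum_ge0 => *; rewrite lee_fin pair_term_ge0.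
apply/esym; rewrite bigfs ?index_enum_uniq//; last by move=> i _; rewrite mem_index_enum.
rewrite (_ : [set` _] = setT); last by apply/seteqP.
apply/esym; apply: eq_fsbigr => kl _; rewrite [RHS]esum_esum; last by move=> *; rewrite lee_fin pair_term_ge0.
by rewrite (_ : setT `*`` _ = setT)//; apply/seteqP; split.
Qed.

End PairMeasure.

(** * Limits of the inner and outer sums *)

Section GridLimit.
Context {R : realType}.
Local Open Scope ereal_scope.
Variables (alpha : R) (z0 w1 w2 : R[i]) (phi : nat -> R) (f : R * R -> R) (C Fmax : R).
Hypothesis alpha01 : (0 < alpha < 1)%R.
Hypothesis hw : real_independent w1 w2.
Hypothesis phi0 : forall N, (0 < phi N)%R.
Hypothesis phioo : phi N @[N --> \oo] --> +oo%R.
Hypothesis f0 : forall x, (0 <= f x)%R.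
Hypothesis fM : forall x, (f x <= Fmax)%R.
Hypothesis cf : continuous f.
Hypothesis fC : forall z, (f (plane_of z) != 0 -> modulus z <= C)%R.

Local Notation lat := (lat w1 w2).
Local Notation comb := (lincomb w1 w2).
Local Notation mesh := (mesh alpha phi).
Local Notation pair_term := (pair_term alpha phi f).

Definition gridpt (q : int * int) : R[i] := (z0 + lat q)%R.

Definition inner_sum (N k l : nat) (m : R[i]) : \bar R :=
  (mesh N ^+ 2)%:E * \esum_(q in setT) (pair_term N k l m (m + lat q))%:E.

Definition box (X : R) : set (plane R) :=
  [set` `[(- X)%R, X]%R] `*` [set` `[(- X)%R, X]%R].

Lemma boxP X (x : plane R) : box X x <-> (`|x.1| <= X /\ `|x.2| <= X)%R.
Proof. by rewrite /box/= !in_itv/= -!ler_norml. Qed.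

Lemma measurable_box X : measurable (box X).
Proof. exact: measurableX. Qed.

Lemma Leb_box X : Leb R (box X) < +oo.
Proof. by rewrite Leb_setX// lebesgue_measure_itv/=; case: ifP => _; rewrite -?EFinB -?EFinM ?mule0 ltry. Qed.

Lemma box_indic_integrable (B X : R) : (0 <= B)%R ->
  (Leb R).-integrable setT (fun x => (B * \1_(box X) x)%:E).
Proof.
move=> B0; apply/integrableP; split.
  by apply/measurable_EFinP; apply: measurable_funM => //; exact: (measurable_indic (measurable_box X)).
under eq_integral do rewrite gee0_abs ?lee_fin ?mulr_ge0//.
under eq_integral do rewrite EFinM.
rewrite ge0_integralZl//; last first.
  by apply/measurable_EFinP; exact: (measurable_indic (measurable_box X)).
rewrite integral_indic//; last exact: measurable_box.
by rewrite setIT lte_mul_pinfty// ?lee_fin// Leb_box.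
Qed.

Let Fmax0 : (0 <= Fmax)%R.
Proof. exact: le_trans (f0 (0, 0)%R) (fM _). Qed.

Lemma inner_sumE N k l m : (0 < N)%N -> inner_sum N k l m =
  \int[Leb R]_y (pair_term N k l m (m + lat (cell_index (mesh N) y)))%:E.
Proof.
move=> N0; rewrite /inner_sum -esumZ_int ?sqr_ge0//; last by move=> q; rewrite lee_fin pair_term_ge0.
rewrite (@integral_cell _ _ (fun q => (pair_term N k l m (m + lat q))%:E))//.
  exact: mesh_gt0.
by move=> q; rewrite lee_fin pair_term_ge0.
Qed.

(** The dominating function of the inner Riemann sum: by [pair_term_support], the index of a
    contributing cell has coordinates at most c D / [mesh N]. *)
Lemma inner_box : exists2 X, (0 < X)%R & forall N k l m y, (0 < N)%N ->
  (pair_term N k l m (m + lat (cell_index (mesh N) y)) <= Fmax * \1_(box X) y)%R.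
Proof.
have [D D0 hD] := pair_term_support alpha01 phi0 fC.
have [c c0 hc] := comb_bound hw.
exists (2 * (c * D))%R; first by rewrite !mulr_gt0.
move=> N k l m y N0; set q := cell_index _ _; have r0 := mesh_gt0 alpha phi0 N0.
have [->|h] := eqVneq (pair_term N k l m (m + lat q)%R) 0%R; first by rewrite mulr_ge0.
have := hD _ _ _ _ _ N0 h; rewrite addrAC subrr add0r => hl.
have q0 : q != 0%R.
  apply: contra_neq h => ->; rewrite /pair_term /pair_cond.
  have -> : lat (0 : int * int)%R = 0%R by apply/eqP; rewrite (lat0 hw).
  by rewrite addr0 eqxx.
have [h1 h2] := hc (q.1%:~R, q.2%:~R)%R; rewrite -lat_comb /= in h1 h2.
have B (i : int) : (`|i%:~R : R| <= c * modulus (lat q) -> mesh N * `|i%:~R| <= c * D)%R.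
  move=> hi; apply: (@le_trans _ _ (c * (mesh N * modulus (lat q)))%R).
    by rewrite mulrCA ler_pM2l.
  by rewrite ler_pM2l.
have {}h1 := B _ h1; have {}h2 := B _ h2.
have I1 (i : int) : i != 0%R -> (1 <= `|i%:~R : R|)%R.
  by move=> i0; rewrite -intr_norm -[1%R]/(1%:~R)%R ler_int -gtz0_ge1 normr_gt0.
(* A nonzero integer vector has a coordinate of absolute value at least 1. The side of a
   contributing cell is thus at most c D too, and y stays within 2 c D even for a coarse mesh. *)
have rD : (mesh N <= c * D)%R.
  have : (q.1 != 0%R) || (q.2 != 0%R).
    rewrite -negb_and; apply: contra q0 => /andP[/eqP e1 /eqP e2].
    by rewrite [q]surjective_pairing e1 e2.
  by move=> /orP[/I1|/I1] hi; [apply: le_trans h1|apply: le_trans h2]; rewrite ler_peMr// ltW.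
have Y (t : R) : (mesh N * `|(Num.floor (t / mesh N))%:~R| <= c * D -> `|t| <= 2 * (c * D))%R.
  move=> ht; have := cell_index_approx t r0; rewrite distrC => ha.
  rewrite -(subrK (mesh N * (Num.floor (t / mesh N))%:~R) t)%R (le_trans (ler_normD _ _))//.
  by rewrite normrM (gtr0_norm r0); lra.
have yb : box (2 * (c * D))%R y by apply/boxP; split; apply: Y.
rewrite indicE mem_set// mulr1 /pair_term; case: ifP => _; [exact: fM|exact: Fmax0].
Qed.

Lemma inner_sum_bound : exists2 B, (0 <= B)%R & forall N k l m, (0 < N)%N ->
  inner_sum N k l m <= B%:E /\ ((N%:R < modulus m)%R -> inner_sum N k l m = 0).
Proof.
have [X X0 hX] := inner_box.
have fin : Leb R (box X) \is a fin_num by rewrite ge0_fin_numE// Leb_box.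
exists (Fmax * fine (Leb R (box X)))%R; first by rewrite mulr_ge0// fine_ge0.
move=> N k l m N0; split.
  rewrite inner_sumE// EFinM fineK//.
  apply: (@le_trans _ _ (\int[Leb R]_y (Fmax%:E * (\1_(box X) y)%:E))).
    apply: ge0_le_integral => //.
    - by move=> y _; rewrite lee_fin pair_term_ge0.
    - exact: (measurable_cell_fun (fun q => (pair_term N k l m (m + lat q))%:E) (mesh_gt0 alpha phi0 N0)).
    - by apply: emeasurable_funM => //; apply/measurable_EFinP; exact: (measurable_indic (measurable_box X)).
    - by move=> y _; rewrite -EFinM lee_fin hX.
  rewrite ge0_integralZl//; last first.
    by apply/measurable_EFinP; exact: (measurable_indic (measurable_box X)).
  by rewrite integral_indic ?setIT//; exact: measurable_box.
move=> Nm; rewrite /inner_sum esum1 ?mule0// => q _.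
by rewrite /pair_term /pair_cond [(modulus m <= _)%R]leNgt Nm !andbF.
Qed.

Lemma inner_sum_ge0 N k l m : 0 <= inner_sum N k l m.
Proof.
rewrite mule_ge0 ?lee_fin ?sqr_ge0//; apply: esum_ge0 => q _.
by rewrite lee_fin pair_term_ge0.
Qed.

Lemma modulus_plane_of (x : plane R) :
  modulus (complex_of x) = Num.sqrt (x.1 ^+ 2 + x.2 ^+ 2)%R.
Proof. exact: modulus_def. Qed.

Lemma measurable_modulus : measurable_fun setT (fun x : plane R => modulus (complex_of x)).
Proof.
under eq_fun do rewrite modulus_plane_of.
apply: (measurableT_comp (f := @Num.sqrt R)).
  by apply: continuous_measurable_fun; exact: sqrt_continuous.
by apply: measurable_funD; apply: measurable_funX.
Qed.

Definition off_axis_circle : set (plane R) :=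
  [set x | x.2 != 0%R /\ modulus (complex_of x) != 1%R].

Lemma measurable_off_axis : measurable [set x : plane R | x.2 != 0%R].
Proof.
rewrite [X in measurable X](_ : _ = setT `*` ~` [set 0%R]).
  by apply: measurableX => //; exact: measurableC.
by apply/seteqP; split => x /=; [move/eqP|case=> _ /eqP].
Qed.

Lemma measurable_circle (r : R) : measurable [set x : plane R | modulus (complex_of x) = r].
Proof.
rewrite [X in measurable X](_ : _ = setT `&` (fun x : plane R => modulus (complex_of x)) @^-1` [set r]).
  by apply: measurable_modulus => //; exact: measurable_set1.
by rewrite setTI.
Qed.

Lemma measurable_off_axis_circle : measurable off_axis_circle.
Proof.
rewrite [X in measurable X](_ : _ = [set x | x.2 != 0%R] `&` ~` [set x : plane R | modulus (complex_of x) = 1%R]).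
  by apply: measurableI; [exact: measurable_off_axis|apply: measurableC; exact: measurable_circle].
by apply/seteqP; split => x /= [] h1 /eqP.
Qed.

Lemma modulus_exp_polar (x : plane R) : modulus (complex_of (exp_polar x)) = expR x.1.
Proof.
rewrite modulus_plane_of /exp_polar/= !exprMn -mulrDr cos2Dsin2 mulr1.
by rewrite sqrtr_sqr ger0_norm// expR_ge0.
Qed.

(** In log-polar coordinates the circle is the line u = 0. *)
Lemma Leb_circle : Leb R [set x | modulus (complex_of x) = 1%R] = 0.
Proof.
have mc := measurable_circle 1.
have -> : Leb R [set x | modulus (complex_of x) = 1%R] =
    \int[Leb R]_x (\1_[set x | modulus (complex_of x) = 1%R] x)%:E.
  by rewrite integral_indic// setIT.
rewrite ge0_integral_log_polar//; last exact/measurable_EFinP/measurable_indic.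
set h := fun u : R => _; rewrite -[LHS]/(\int[lebesgue_measure]_u h u).
rewrite -[RHS](@integral_set1 R h 0%R) [RHS]integral_mkcond.
apply: eq_integral => u _; rewrite patchE; case: ifPn => // u0.
apply: integral0_eq => s _; rewrite indicE memNset ?mul0e//= modulus_exp_polar -expR0.
by move=> /expR_inj uE; move/negP: u0; apply; rewrite inE; exact: uE.
Qed.

Lemma Leb_off_axis_circle : Leb R (~` off_axis_circle) = 0.
Proof.
rewrite [X in Leb R X](_ : _ = [set x | x.2 = 0%R] `|` [set x | modulus (complex_of x) = 1%R]).
  rewrite null_set_setU//; last exact: Leb_circle.
  - rewrite (_ : [set x | x.2 = 0%R] = setT `*` [set 0%R]); last by apply/seteqP; split => x //= [].
    exact: measurableX.
  - exact: measurable_circle.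
  - rewrite (_ : [set x | x.2 = 0%R] = setT `*` [set 0%R]); last by apply/seteqP; split => x //= [].
    by rewrite Leb_setX// lebesgue_measure_set1 mule0.
apply/seteqP; split => x; rewrite /off_axis_circle/=.
  move=> h; apply: contrapT => /not_orP[/eqP h1 /eqP h2]; exact: h.
by move=> [->|->]; rewrite eqxx => -[].
Qed.

Lemma measurable_good : measurable (off_axis_circle : set (plane R)) ->
  measurable [set x : plane R | complex.Im (comb x) != 0%R /\ modulus (comb x) != 1%R].
Proof.
move=> m; rewrite [X in measurable X](_ : _ = setT `&` (fun x => plane_of (comb x)) @^-1` off_axis_circle).
  exact: measurable_comb.
rewrite setTI; apply/seteqP; split => x; rewrite /preimage /off_axis_circle/=.
  by rewrite /complex_of /plane_of/=; case: (comb x).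
by rewrite /complex_of /plane_of/=; case: (comb x).
Qed.

(* The points where the summand converges: off the branch cut of the logarithm and
   off the circle where the truncation |m| <= N jumps. *)
Definition good : set (plane R) :=
  [set x | complex.Im (comb x) != 0%R /\ modulus (comb x) != 1%R].

Definition grid_seq (x : plane R) (N : nat) : R[i] := gridpt (cell_index (N%:R^-1)%R x).

(** The floors approximate the coordinates of x within 1 / N, and z0 / N tends to 0. *)
Lemma cvg_grid_seq x : cvgC (fun N => ((N%:R^-1)%:C * grid_seq x N)%R) (comb x).
Proof.
have inv0 : ((N%:R : R)^-1)%R @[N --> \oo] --> (0 : R)%R.
  apply/gtr0_cvgV0; last exact: cvgr_idn.
  by near=> N; rewrite ltr0n; near: N; exact: nbhs_infty_gt.
have c1 (t : R) : (N%:R^-1 * (Num.floor (t / N%:R^-1))%:~R)%R @[N --> \oo] --> t.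
  apply/subr_cvg0/norm_cvg0P.
  apply: (@squeeze_cvgr _ _ _ _ (fun=> 0%R) (fun N => N%:R^-1)%R) => //; last exact: cvg_cst.
  near=> N; rewrite normr_ge0/= cell_index_approx// invr_gt0 ltr0n.
  by near: N; exact: nbhs_infty_gt.
have := cvgCD (cvgCM (cvgC_real inv0) (cvgC_cst z0))
  (cvgCD (cvgCM (cvgC_real (c1 x.1)) (cvgC_cst w1)) (cvgCM (cvgC_real (c1 x.2)) (cvgC_cst w2))).
rewrite mul0r add0r; apply: cvgC_eq; apply: nearW => N.
rewrite /grid_seq /gridpt /lat /cell_index/= !rmorphM/=; ring.
Unshelve. all: by end_near. Qed.

(** Dominated convergence over cells of side 1 / N. The bound on the inner sum is uniform in m, and
    the truncation |m| <= N confines the cells to a fixed box. *)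
Lemma outer_limit (k l : nat) (Finf : plane R -> \bar R) :
  (forall x, good x -> (modulus (comb x) < 1)%R ->
     inner_sum N k l (grid_seq x N) @[N --> \oo] --> Finf x) ->
  (forall x, good x -> (1 < modulus (comb x))%R -> Finf x = 0) ->
  measurable good -> Leb R (~` good) = 0 ->
  (((N%:R^-1) ^+ 2)%:E * \esum_(q in setT) inner_sum N k l (gridpt q)) @[N --> \oo] -->
    \int[Leb R]_(x in good) Finf x /\
  \int[Leb R]_(x in good) Finf x < +oo.
Proof.
move=> Hin Hout mgood ngood.
have [B B0 hB] := inner_sum_bound; have [c c0 hc] := comb_bound hw.
(* For |m| <= N the lattice part has modulus at most N + |z0|, so its coordinates over N are at most
   c (1 + |z0|); the last 1 is the side of a cell. *)
pose X := (c * (1 + modulus z0) + 1)%R.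
pose f_ (n : nat) (x : plane R) := inner_sum n.+1 k l (grid_seq x n.+1).
have e0 n : (0 < n.+1%:R^-1 :> R)%R by rewrite invr_gt0.
have mf_ n : measurable_fun setT (f_ n).
  exact: (measurable_cell_fun (fun q => inner_sum n.+1 k l (gridpt q)) (e0 n)).
have f_0 n x : 0 <= f_ n x by exact: inner_sum_ge0.
have f_f x : good x -> f_ n x @[n --> \oo] --> Finf x.
  move=> gx; have [lt1|gt1|E] := ltgtP (modulus (comb x)) 1%R; last first.
  - by case: gx => _; rewrite E eqxx.
  - rewrite Hout//; have h := cvgC_modulus (cvg_grid_seq x).
    rewrite /f_ (cvg_shiftS (fun N => inner_sum N k l (grid_seq x N))).
    apply: (@cvg_trans _ (0 @[n --> \oo])); last exact: cvg_cst.
    have nr : \forall N \near \oo, 0 = inner_sum N k l (grid_seq x N).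
      near=> N.
      have N0 : (0 < N)%N by near: N; exact: nbhs_infty_gt.
      have N0' : (0 < N%:R :> R)%R by rewrite ltr0n.
      have h1 : (1 < modulus ((N%:R^-1)%:C * grid_seq x N))%R by near: N; exact: (cvgr_gt _ h).
      have [_ ->//] := hB N k l (grid_seq x N) N0.
      by move: h1; rewrite modulusZ gtr0_norm ?invr_gt0// ltr_pdivlMl// mulr1.
    exact: near_eq_cvg nr.
  - by rewrite (cvg_shiftS (fun N => inner_sum N k l (grid_seq x N))); exact: Hin.
have absfg n x : good x -> `|f_ n x| <= (B * \1_(box X) x)%:E.
  move=> _; rewrite gee0_abs//; have [h1 h2] := hB n.+1 k l (grid_seq x n.+1) isT.
  have [xb|xb] := pselect (box X x); first by rewrite indicE mem_set// mulr1.
  rewrite /f_ h2 ?lee_fin ?mulr_ge0//; rewrite ltNge; apply/negP => hle; apply: xb; apply/boxP.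
  set q := cell_index (n.+1%:R^-1)%R x.
  have hl : (modulus (lat q) <= n.+1%:R + modulus z0)%R.
    have -> : lat q = (gridpt q - z0)%R by rewrite /gridpt addrAC subrr add0r.
    by rewrite (le_trans (modulusD _ _))// modulusN lerD2r.
  have n1 : (1 <= n.+1%:R :> R)%R by rewrite ler1n.
  have Y (t : R) : (`|(Num.floor (t / n.+1%:R^-1))%:~R : R| <= c * modulus (lat q) -> `|t| <= X)%R.
    move=> ht; have := cell_index_approx t (e0 n); rewrite distrC => ha.
    rewrite -(subrK (n.+1%:R^-1 * (Num.floor (t / n.+1%:R^-1))%:~R) t)%R (le_trans (ler_normD _ _))//.
    rewrite normrM (gtr0_norm (e0 n)) /X addrC lerD//.
      rewrite mulrC ler_pdivrMr ?ltr0n// (le_trans ht)// -mulrA ler_pM2l//.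
      by rewrite (le_trans hl)// mulrDl mul1r lerD2l ler_peMr// modulus_ge0.
    by rewrite (le_trans ha)// invf_le1// ltr0n.
  by have [g1 g2] := hc (q.1%:~R, q.2%:~R)%R; split; apply: Y.
have ig : (Leb R).-integrable good (fun x => (B * \1_(box X) x)%:E).
  by apply: integrableS (box_indic_integrable X B0).
have mfg n : measurable_fun good (f_ n) by exact: measurable_funTS.
split.
  rewrite -(cvg_shiftS (fun N => ((N%:R^-1) ^+ 2)%:E * \esum_(q in setT) inner_sum N k l (gridpt q))).
  have E n : ((n.+1%:R^-1) ^+ 2)%:E * (\esum_(q in setT) inner_sum n.+1 k l (gridpt q)) =
      \int[Leb R]_(x in good) f_ n x.
    rewrite -esumZ_int ?sqr_ge0//; last by move=> q; exact: inner_sum_ge0.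
    rewrite -(@integral_cell _ _ (fun q => inner_sum n.+1 k l (gridpt q)) (e0 n)); last first.
      by move=> q; exact: inner_sum_ge0.
    transitivity (\int[Leb R]_(x in setT `\` ~` good) f_ n x); last by rewrite setTD setCK.
    exact: (@ge0_negligible_integral _ _ _ (Leb R) setT (~` good) (f_ n) (measurableC mgood) measurableT (mf_ n) (fun x _ => f_0 n x) ngood).
  under eq_fun do rewrite E.
  by apply: (@dominated_cvg _ _ _ (Leb R) good mgood f_ Finf (fun x => (B * \1_(box X) x)%:E)).
have := @lebesgue_integral_dominated_convergence.dominated_integrable _ _ _ (Leb R) good mgood
  f_ Finf (fun x => (B * \1_(box X) x)%:E) mfg f_f.
by move=> /(_ ig absfg) /(integrable_lty mgood).
Unshelve. all: by end_near. Qed.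

(** The limit of [pair_term] when m / N tends to z and [mesh N] p tends to y. *)
Definition lim_term (k l : nat) (z y : R[i]) : R :=
  if k == l then f (plane_of (alpha%:C * expC (alpha%:C * LogB k z) * (y / z))%R) else 0%R.

Lemma lim_term_ge0 k l z y : (0 <= lim_term k l z y)%R.
Proof. by rewrite /lim_term; case: ifP. Qed.

Lemma cvg_inner_term k l x (p : nat -> R[i]) y : good x -> (modulus (comb x) < 1)%R ->
  cvgC (fun N => ((mesh N)%:C * p N)%R) y -> y != 0%R ->
  (pair_term N k l (grid_seq x N) (grid_seq x N + p N)%R) @[N --> \oo] -->
  lim_term k l (comb x) y.
Proof.
move=> [Imx _] x1 cp y0.
have x01 : (0 < modulus (comb x) < 1)%R.
  by rewrite x1 andbT modulus_gt0; apply: contra_neq Imx => ->.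
rewrite /lim_term; case: eqVneq => [->|kl].
  exact: (cvg_pair_term alpha01 phi0 phioo cf (cvg_grid_seq x) cp x01 Imx y0).
apply: (cvg_pair_term_off alpha01 phi0 fC phioo (cvg_grid_seq x) cp x01 Imx kl).
Qed.

(** The cells of side [mesh N] shrink, so [mesh N] p converges to the point of the integration
    variable. That limit must be nonzero for the summand to converge, hence the removal of one null
    point. *)
Lemma inner_limit_0 k l x : good x -> (modulus (comb x) < 1)%R ->
  mesh N @[N --> \oo] --> (0 : R)%R ->
  inner_sum N k l (grid_seq x N) @[N --> \oo] -->
  \int[Leb R]_(y in [set y | comb y != 0%R]) (lim_term k l (comb x) (comb y))%:E.
Proof.
move=> gx x1 mesh0; set D := [set y | _].
have DE : D = ~` ([set 0%R] `*` [set 0%R]).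
  apply/seteqP; split => -[s t]; rewrite /D/=.
    by move=> + [s0 t0]; rewrite s0 t0 /comb/= !mul0r addr0 eqxx.
  by move=> st; apply/eqP => /(hw)[s0 t0]; apply: st.
have mD : measurable D by rewrite DE; apply: measurableC; exact: measurableX.
have nD : Leb R (~` D) = 0.
  by rewrite DE setCK Leb_setX// lebesgue_measure_set1 mule0.
have [X X0 hX] := inner_box.
rewrite -(cvg_shiftS (fun N => inner_sum N k l (grid_seq x N))).
pose f_ (n : nat) (y : plane R) : \bar R := (pair_term n.+1 k l (grid_seq x n.+1)
  (grid_seq x n.+1 + lat (cell_index (mesh n.+1) y))%R)%:E.
have mf_ n : measurable_fun setT (f_ n).
  exact: (measurable_cell_fun (fun q => (pair_term n.+1 k l (grid_seq x n.+1)
    (grid_seq x n.+1 + lat q)%R)%:E) (mesh_gt0 alpha phi0 (ltn0Sn n))).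
have f_0 n y : 0 <= f_ n y by rewrite lee_fin pair_term_ge0.
have E n : inner_sum n.+1 k l (grid_seq x n.+1) = \int[Leb R]_(y in D) f_ n y.
  rewrite inner_sumE//.
  transitivity (\int[Leb R]_(y in setT `\` ~` D) f_ n y); last by rewrite setTD setCK.
  exact: (@ge0_negligible_integral _ _ _ (Leb R) setT (~` D) (f_ n) (measurableC mD) measurableT (mf_ n) (fun x _ => f_0 n x) nD).
rewrite [X in X @ _ --> _](_ : _ = fun n => \int[Leb R]_(y in D) f_ n y); last first.
  by apply/funext => n; exact: E.
apply: (@dominated_cvg _ _ _ (Leb R) D mD f_ _ (fun y => (Fmax * \1_(box X) y)%:E)) => //.
- by move=> n; exact: measurable_funTS.
- move=> y Dy; rewrite /f_.
  rewrite (cvg_shiftS (fun N => (pair_term N k l (grid_seq x N)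
    (grid_seq x N + lat (cell_index (mesh N) y))%R)%:E)).
  apply/cvg_EFin; first exact: nearW.
  apply: (cvg_inner_term (p := fun N => lat (cell_index (mesh N) y))) => //.
  have c1 (t : R) : (mesh N * (Num.floor (t / mesh N))%:~R)%R @[N --> \oo] --> t.
    apply/subr_cvg0/norm_cvg0P.
    apply: (@squeeze_cvgr _ _ _ _ (fun=> 0%R) mesh) => //; last exact: cvg_cst.
    near=> N; rewrite normr_ge0/= cell_index_approx// mesh_gt0//.
    by near: N; exact: nbhs_infty_gt.
  have := cvgCD (cvgCM (cvgC_real (c1 y.1)) (cvgC_cst w1)) (cvgCM (cvgC_real (c1 y.2)) (cvgC_cst w2)).
  by apply: cvgC_eq; apply: nearW => N; rewrite /lat /cell_index/= !rmorphM/=; ring.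
- by apply: integrableS (box_indic_integrable X Fmax0).
- by move=> n y _; rewrite gee0_abs// lee_fin hX.
Unshelve. all: by end_near. Qed.

Lemma lat_neq0_lb : exists2 c, (0 < c)%R & forall q, q != 0%R -> (c <= modulus (lat q))%R.
Proof.
have [c c0 hc] := comb_bound hw; exists (c^-1)%R; first by rewrite invr_gt0.
move=> q q0; have [h1 h2] := hc (q.1%:~R, q.2%:~R)%R; rewrite -lat_comb /= in h1 h2.
have I1 (i : int) : i != 0%R -> (1 <= `|i%:~R : R|)%R.
  by move=> i0; rewrite -intr_norm -[1%R]/(1%:~R)%R ler_int -gtz0_ge1 normr_gt0.
have : (q.1 != 0%R) || (q.2 != 0%R).
  rewrite -negb_and; apply: contra q0 => /andP[/eqP e1 /eqP e2].
  by rewrite [q]surjective_pairing e1 e2.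
by move=> /orP[/I1|/I1] hi; rewrite -[leLHS]mulr1 ler_pdivrMl//; [apply: le_trans h1|apply: le_trans h2].
Qed.

Let pair_term_lat0 N k l m : pair_term N k l m (m + lat (0 : int * int)%R)%R = 0%R.
Proof.
have -> : lat (0 : int * int)%R = 0%R by apply/eqP; rewrite (lat0 hw).
by rewrite /pair_term /pair_cond addr0 eqxx.
Qed.

(** Once [mesh N] exceeds D over the length of the shortest lattice vectors, no nonzero p
    contributes and the sum is exactly 0, for all m at once. *)
Lemma inner_limit_oo : mesh N @[N --> \oo] --> +oo%R ->
  \forall N \near \oo, forall k l m, inner_sum N k l m = 0.
Proof.
move=> meshoo; have [D D0 hD] := pair_term_support alpha01 phi0 fC.
have [c c0 hc] := lat_neq0_lb.
have /cvgryPgt/(_ (D / c)%R) hm := meshoo; near=> N => k l m.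
have N0 : (0 < N)%N by near: N; exact: nbhs_infty_gt.
have hN : (D / c < mesh N)%R by near: N; exact: hm.
rewrite /inner_sum esum1 ?mule0// => q _; congr EFin.
have [->|q0] := eqVneq q 0%R; first exact: pair_term_lat0.
apply/eqP; apply: contraT => /(hD _ _ _ _ _ N0); rewrite addrAC subrr add0r => hl.
move: hN; rewrite ltr_pdivrMr// => hN.
have := lt_le_trans hN (le_trans _ hl); rewrite ltxx; apply.
by rewrite ler_pM2l ?mesh_gt0// hc.
Unshelve. all: by end_near. Qed.

(** Stated for every sufficiently large finite S, so that S can later be enlarged to hold also the
    lattice points that [rho] requires. *)
Lemma inner_limit_pos (lam : R) : (0 < lam)%R -> mesh N @[N --> \oo] --> lam ->
  exists A : R, forall S : set (int * int), finite_set S -> (forall q, S q -> q != 0%R) ->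
  (forall q, q != 0%R -> (modulus (lat q) <= A)%R -> S q) ->
  forall k l x, good x -> (modulus (comb x) < 1)%R ->
  inner_sum N k l (grid_seq x N) @[N --> \oo] -->
  (lam ^+ 2)%:E * \sum_(q <- finmap.enum_fset (fset_set S)) (lim_term k l (comb x) (lam%:C * lat q)%R)%:E.
Proof.
move=> lam0 meshl; have [D D0 hD] := pair_term_support alpha01 phi0 fC.
(* Eventually [mesh N] > lam / 2, so a nonzero term has |p| <= 2 D / lam. *)
exists (2 * D / lam)%R => S fS S0 SA k l x gx x1.
have E : \forall N \near \oo, (mesh N ^+ 2 * \sum_(q <- finmap.enum_fset (fset_set S))
    pair_term N k l (grid_seq x N) (grid_seq x N + lat q))%:E = inner_sum N k l (grid_seq x N).
  near=> N; have N0 : (0 < N)%N by near: N; exact: nbhs_infty_gt.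
  have hl : (lam / 2 < mesh N)%R.
    by near: N; apply: (cvgr_gt _ meshl); rewrite ltr_pdivrMr// mulr_natr mulr2n ltrDl.
  rewrite EFinM -sumEFin /inner_sum; congr (_ * _); rewrite -fsbig_finite// -esum_fset//; last first.
    by move=> q _; rewrite lee_fin pair_term_ge0.
  rewrite esum_mkcond; apply: eq_esum => q _; case: ifPn => // qS; congr EFin; apply/esym/eqP.
  have [->|q0] := eqVneq q 0%R; first exact/eqP/pair_term_lat0.
  apply: contraT => /(hD _ _ _ _ _ N0); rewrite addrAC subrr add0r => hl'.
  case/negP: qS; rewrite inE; apply: SA => //; rewrite ler_pdivlMr//.
  by have := modulus_ge0 (lat q); nra.
apply: (cvg_trans (near_eq_cvg E)).
rewrite sumEFin -EFinM; apply/cvg_EFin; first exact: nearW.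
apply: cvgM; first by rewrite expr2; under eq_fun do rewrite expr2; exact: cvgM.
have : {in (finmap.enum_fset (fset_set S)), forall q, q != 0%R}.
  by move=> q qS; apply: S0; move: qS; rewrite in_fset_set// inE.
elim: (finmap.enum_fset (fset_set S)) => [_|q s IH hs].
  by under eq_fun do rewrite big_nil; rewrite big_nil; exact: cvg_cst.
under eq_fun do rewrite big_cons; rewrite big_cons; apply: cvgD; last first.
  by apply: IH => r rs; apply: hs; rewrite inE rs orbT.
apply: (cvg_inner_term (p := fun=> lat q)) => //.
  exact: cvgCM (cvgC_real meshl) (cvgC_cst _).
rewrite mulf_neq0//; first by rewrite eq_complex/= gt_eqF.
by rewrite (lat0 hw) hs// inE eqxx.
Unshelve. all: by end_near. Qed.

Lemma Leb_good : Leb R (~` good) = 0.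
Proof.
have mg := measurable_good measurable_off_axis_circle.
have E : Leb R (~` off_axis_circle) = `|det2 w1 w2|%:E * Leb R (~` good).
  have mo := measurableC measurable_off_axis_circle.
  have -> : Leb R (~` off_axis_circle) = \int[Leb R]_x (\1_(~` off_axis_circle) x)%:E.
    by rewrite integral_indic// setIT.
  rewrite (integral_comb hw)//; last exact/measurable_EFinP/measurable_indic.
  congr (_ * _).
  rewrite -[X in _ = Leb R X]setIT -integral_indic//; last exact: measurableC.
  apply: eq_integral => x _; congr EFin; rewrite !indicE; congr (nat_of_bool _)%:R.
  rewrite !in_setC; congr (~~ _); apply/idP/idP; rewrite !inE /good /off_axis_circle/=.
    by rewrite /complex_of /plane_of/=; case: (comb x).
  by rewrite /complex_of /plane_of/=; case: (comb x).
move: E; rewrite Leb_off_axis_circle => /esym/eqP; rewrite mule_eq0 eqe normr_eq0.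
by rewrite (negbTE (det2_neq0 hw))/= => /eqP.
Qed.

End GridLimit.

(** * Translates and periods on the line *)

Section IntervalIntegral.
Context {R : realType}.
Local Open Scope ereal_scope.
Notation mu := (@lebesgue_measure R).
Variable h : R -> \bar R.
Hypothesis mh : measurable_fun setT h.
Hypothesis h0 : forall x, 0 <= h x.

Lemma integral_shift (a b d : R) :
  \int[mu]_(s in `[a, b[) h (s + d)%R = \int[mu]_(s in `[(a + d)%R, (b + d)%R[) h s.
Proof.
rewrite [LHS]integral_mkcond [RHS]integral_mkcond.
rewrite [RHS](@ge0_integral_affine _ 1%R d)//.
- rewrite normr1 mul1e; apply: eq_integral => s _; rewrite mul1r !patchE.
  have -> : (s + d \in `[(a + d)%R, (b + d)%R[%classic)%R = (s \in `[a, b[%classic)%R.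
    by apply/idP/idP; rewrite !inE/= !in_itv/= lerD2r ltrD2r.
  by [].
- exact: measurable_patch.
- by apply: erestrict_ge0 => x _; exact: h0.
Qed.

Lemma integral_adjacent (a b c : R) : (a <= b)%R -> (b <= c)%R ->
  \int[mu]_(s in `[a, b[) h s + \int[mu]_(s in `[b, c[) h s = \int[mu]_(s in `[a, c[) h s.
Proof.
move=> ab bc; rewrite -ge0_integral_setU//.
- by rewrite -itv_bndbnd_setU// bnd_simp.
- exact: measurable_funTS.
- apply/disj_setPLR => x/=; rewrite !in_itv/= => /andP[_ xb]; apply/negP.
  by rewrite negb_and -ltNge xb.
Qed.

Lemma integral_steps (T : R) n : (0 <= T)%R ->
  \sum_(k < n) \int[mu]_(s in `[0%R, T[) h (s + T * k%:R)%R = \int[mu]_(s in `[0%R, (T * n%:R)%R[) h s.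
Proof.
move=> T0; elim: n => [|n IH].
  by rewrite big_ord0 mulr0 set_itvco0 integral_set0.
rewrite big_ord_recr/= IH integral_shift add0r integral_adjacent//.
- by have -> : (T + T * n%:R = T * n.+1%:R)%R by rewrite -natr1 mulrDr mulr1 addrC.
- by rewrite mulr_ge0.
- by rewrite lerDr.
Qed.

End IntervalIntegral.

Section PeriodicIntegral.
Context {R : realType}.
Local Open Scope ereal_scope.
Notation mu := (@lebesgue_measure R).
Variables (h : R -> \bar R) (T : R).
Hypothesis mh : measurable_fun setT h.
Hypothesis h0 : forall x, 0 <= h x.
Hypothesis T0 : (0 < T)%R.
Hypothesis hT : forall x (m : int), h (x + T * m%:~R)%R = h x.

Let m_aff (c d : R) : measurable_fun setT (fun s => h (c * s + d)%R).
Proof.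
apply: measurableT_comp => //.
by apply: measurable_funD => //; exact: mulrl_measurable.
Qed.

(** Reduce the shift to d' in [0, T] and move the part of [d', T + d'[ beyond T back by one
    period. *)
Lemma periodic_integral_shift (d : R) :
  \int[mu]_(s in `[0%R, T[) h (s + d)%R = \int[mu]_(s in `[0%R, T[) h s.
Proof.
pose m := Num.floor (d / T); pose d' := (d - T * m%:~R)%R.
have d0 : (0 <= d')%R by rewrite subr_ge0 mulrC -ler_pdivlMr// floor_le_tmp.
have dT : (d' <= T)%R.
  rewrite ltW// ltrBlDl -{2}[T]mulr1 -mulrDr mulrC -ltr_pdivrMr//.
  by rewrite -[1%R]/(1%:~R)%R -intrD floorD1_gt.
have -> : \int[mu]_(s in `[0%R, T[) h (s + d)%R = \int[mu]_(s in `[0%R, T[) h (s + d')%R.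
  apply: eq_integral => s _; have -> : (s + d = s + d' + T * m%:~R)%R by rewrite /d'; ring.
  by rewrite hT.
rewrite integral_shift// add0r -(@integral_adjacent _ h mh h0 d' T)//; last by rewrite lerDl.
have -> : \int[mu]_(s in `[T, (T + d')%R[) h s = \int[mu]_(s in `[0%R, d'[) h s.
  have E := integral_shift mh h0 0%R d' T; rewrite add0r (addrC d') in E.
  by rewrite -E; apply: eq_integral => s _; have := hT s 1; rewrite mulr1.
by rewrite addeC integral_adjacent.
Qed.

(* As s runs through the b sheets, d - c s winds n = c b times around the period. *)
Lemma periodic_integral_wind (b n : nat) (c d : R) : (0 < c)%R -> (c * b%:R = n%:R)%R ->
  \sum_(k < b) \int[mu]_(s in `[0%R, T[) h (d - c * (s + T * k%:R))%R =
  b%:R%:E * \int[mu]_(s in `[0%R, T[) h s.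
Proof.
move=> c0 cb.
have mH : measurable_fun setT (fun s => h (d - c * s)%R).
  by under eq_fun do rewrite addrC -mulNr; exact: m_aff.
rewrite (@integral_steps _ (fun s => h (d - c * s)%R))//; last exact: ltW.
set A := LHS.
(* The factor c is the Jacobian of s -> d - c s, which maps [0, T b[ onto ]d - T n, d], that is, n
   periods. *)
suff E : c%:E * A = n%:R%:E * \int[mu]_(s in `[0%R, T[) h s.
  rewrite -[A]mul1e -(@mulVf _ c) ?gt_eqF// EFinM -muleA E muleA -EFinM; congr (_%:E * _).
  by rewrite -cb mulrA mulVf ?mul1r// gt_eqF.
transitivity (\int[mu]_(s in `](d - T * n%:R)%R, d]) h s).
  rewrite [RHS]integral_mkcond [RHS](@ge0_integral_affine _ (- c)%R d)//.
  - rewrite normrN gtr0_norm// /A [X in _ * X = _]integral_mkcond; congr (_ * _).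
    apply: eq_integral => s _; rewrite !patchE.
    have -> : (- c * s + d \in `](d - T * n%:R)%R, d]%classic)%R = (s \in `[0%R, (T * b%:R)%R[%classic)%R.
      apply/idP/idP; rewrite !inE/= !in_itv/= -cb mulrCA mulNr [(- _ + d)%R]addrC ltrD2l lerBlDr lerDl.
        by rewrite ltrN2 ltr_pM2l// pmulr_rge0// andbC.
      by rewrite ltrN2 ltr_pM2l// pmulr_rge0// andbC.
    by rewrite mulNr addrC.
  - by rewrite oppr_eq0 gt_eqF.
  - exact: measurable_patch.
  - by apply: erestrict_ge0 => x _; exact: h0.
rewrite integral_itv_obnd_cbnd; last exact: measurable_funTS.
rewrite -integral_itv_bndo_bndc; last exact: measurable_funTS.
have -> : `[(d - T * n%:R)%R, d[%classic = `[(0 + (d - T * n%:R))%R, (T * n%:R + (d - T * n%:R))%R[%classic.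
  by rewrite add0r [(T * n%:R + _)%R]addrC subrK.
have mS : measurable_fun setT (fun s : R => h (s + (d - T * n%:R))%R).
  by under eq_fun do rewrite -[X in h (X + _)%R]mul1r; exact: m_aff.
rewrite -integral_shift// -(@integral_steps _ (fun s : R => h (s + (d - T * n%:R))%R))//; last exact: ltW.
under eq_bigr => k _ do under eq_integral do rewrite -addrA.
under eq_bigr => k _ do rewrite periodic_integral_shift.
by rewrite sumr_const card_ord mule_natl.
Qed.

End PeriodicIntegral.

(** * Integrals over the disc through a branch of the logarithm *)

Section BranchPolar.
Context {R : realType}.
Local Open Scope ereal_scope.
Notation mu := (@lebesgue_measure R).

Lemma plane_ofK : cancel (@plane_of R) (@complex_of R).
Proof. by case. Qed.

Lemma complex_of_exp_polar (u s : R) : complex_of (exp_polar (u, s)) = expC (u +i* s).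
Proof. by rewrite /complex_of /exp_polar/= /expC/= /GRing.mul/= !mul0r subr0 addr0. Qed.

Lemma measurable_LogB k :
  measurable_fun [set x : plane R | x.2 != 0%R] (fun x => plane_of (LogB k (complex_of x))).
Proof.
have cL (x : plane R) (s t : nat -> R) : x.2 != 0%R -> s n @[n --> \oo] --> x.1 -> t n @[n --> \oo] --> x.2 ->
    cvgC (fun n => LogB k (complex_of (s n, t n))) (LogB k (complex_of x)).
  by move=> x0 cs ct; apply: cvgCD; [apply: cvgC_Log|exact: cvgC_cst].
pose D : set (plane R) := [set x | x.2 != 0%R].
have mD : measurable D by exact: measurable_off_axis.
have mRe : measurable_fun D (fun x => complex.Re (LogB k (complex_of x)) : R).
  apply/measurable_EFinP; apply: measurable_seq_continuous => // x s t Dx cs ct.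
  by apply/cvg_EFin; [exact: nearW|case: (cL x s t Dx cs ct)].
have mIm : measurable_fun D (fun x => complex.Im (LogB k (complex_of x)) : R).
  apply/measurable_EFinP; apply: measurable_seq_continuous => // x s t Dx cs ct.
  by apply/cvg_EFin; [exact: nearW|case: (cL x s t Dx cs ct)].
move/(measurable_restrictT _ mD) in mRe; move/(measurable_restrictT _ mD) in mIm.
have mP := measurable_funTS (measurable_fun_pair mRe mIm).
apply: (eq_measurable_fun _ _ (mP D)) => x xD; rewrite /plane_of !patchE.
by rewrite xD.
Qed.

(** For c = 1 this is the length of ]0, 1[ under the substitution y = exp u; a dilation gives the
    rest. *)
Lemma integral_expR_lt0 (c : R) : (0 < c)%R ->
  \int[mu]_(u in `]-oo, 0%R[) (expR (c * u))%:E = (c^-1)%:E.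
Proof.
move=> c0.
have mI : measurable_fun setT ((fun=> 1 : \bar R) \_ (`]-oo, 1%R[ : set R)) by exact: measurable_patch.
have mE : measurable_fun setT ((fun v : R => (expR v)%:E) \_ (`]-oo, 0%R[ : set R)).
  by apply: measurable_patch => //; apply/measurable_EFinP; exact: measurable_expR.
have I0 x : 0 <= ((fun=> 1 : \bar R) \_ (`]-oo, 1%R[ : set R)) x by apply: erestrict_ge0.
have E := ge0_integral_expR mI I0; rewrite -integral_mkcondr in E.
have EI : `]0%R, +oo[%classic `&` `]-oo, 1%R[%classic = `]0%R, 1%R[%classic :> set R.
  by apply/seteqP; split => x/=; rewrite !in_itv/= andbT; [move=> [-> ->]|move=> /andP[-> ->]].
rewrite EI integral_cst// mul1e in E.
have E1 : mu `]0%R, 1%R[ = 1 by rewrite lebesgue_measure_itv/= lte_fin ltr01 oppr0 adde0.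
have {}E := etrans (esym E1) E.
have E2 : \int[mu]_(u in `]-oo, 0%R[) (expR u)%:E = 1.
  rewrite E [LHS]integral_mkcond; apply: eq_integral => v _; rewrite !patchE.
  have -> : (expR v \in `]-oo, 1%R[%classic) = (v \in `]-oo, 0%R[%classic).
    by apply/idP/idP; rewrite !inE/= !in_itv/= -expR0 ltr_expR.
  by case: ifP; rewrite ?mul1e ?mul0e.
move: E2; rewrite [X in X = _]integral_mkcond (@ge0_integral_affine _ c 0%R)//; first last.
- by apply: erestrict_ge0 => v _; rewrite lee_fin expR_ge0.
- by rewrite gt_eqF.
rewrite gtr0_norm// => E2; rewrite [LHS]integral_mkcond.
rewrite -[RHS]mule1 -[in RHS]E2 muleA -EFinM mulVf ?gt_eqF// mul1e.
apply: eq_integral => v _; rewrite !patchE addr0.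
have -> : (c * v \in `]-oo, 0%R[%classic)%R = (v \in `]-oo, 0%R[%classic).
  by apply/idP/idP; rewrite !inE/= !in_itv/= pmulr_rlt0.
by [].
Qed.

Variables (w1 w2 : R[i]).
Hypothesis hw : real_independent w1 w2.
Local Notation comb := (lincomb w1 w2).

Definition inside : set (plane R) := [set x | complex.Im (comb x) != 0%R /\ (modulus (comb x) < 1)%R].

Let D : set (plane R) := [set x | x.2 != 0%R /\ (modulus (complex_of x) < 1)%R].

Let mD : measurable D.
Proof.
rewrite [X in measurable X](_ : _ = [set x | x.2 != 0%R] `&`
   (setT `&` (fun x : plane R => modulus (complex_of x)) @^-1` `]-oo, 1%R[)).
  apply: measurableI; first exact: measurable_off_axis.
  by apply: measurable_modulus => //; exact: measurable_itv.
by rewrite setTI; apply/seteqP; split => x /=; rewrite in_itv.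
Qed.

Let D_inside x : D (plane_of (comb x)) <-> inside x.
Proof. by rewrite /D /inside/= plane_ofK. Qed.

Lemma measurable_inside : measurable inside.
Proof.
rewrite [X in measurable X](_ : _ = setT `&` (fun x => plane_of (comb x)) @^-1` D).
  exact: measurable_comb.
by rewrite setTI; apply/seteqP; split => x; move/D_inside.
Qed.

Lemma measurable_branch k (K : plane R -> \bar R) : measurable_fun setT K ->
  measurable_fun inside (fun x => K (plane_of (LogB k (comb x)))).
Proof.
move=> mK; apply: (measurableT_comp mK).
rewrite (_ : (fun x => _) = (fun x => plane_of (LogB k (complex_of x))) \o (fun x => plane_of (comb x))); last first.
  by apply/funext => x /=; rewrite plane_ofK.
apply: (measurable_comp (F := [set x : plane R | x.2 != 0%R])).
- exact: measurable_off_axis.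
- by move=> _ [x [Ix _] <-].
- exact: measurable_LogB.
- by apply: measurable_funTS; exact: measurable_comb.
Qed.

(** The determinant passes from lattice coordinates to z, and log-polar coordinates of z are those
    of its logarithm up to the sheet: |z| < 1 means u < 0, and the angle is s + 2 pi k. *)
Lemma ge0_integral_branch k (K : plane R -> \bar R) :
  measurable_fun setT K -> (forall x, 0 <= K x) ->
  `|det2 w1 w2|%:E * \int[Leb R]_(x in inside) K (plane_of (LogB k (comb x))) =
  \int[mu]_(u in `]-oo, 0%R[) \int[mu]_(s in `[0%R, (2 * pi)%R[)
    (K (u, s + 2 * pi * k%:R)%R * (expR (2 * u))%:E).
Proof.
move=> mK K0.
pose g := (fun x => K (plane_of (LogB k (complex_of x)))) \_ D.
have g0 x : 0 <= g x by apply: erestrict_ge0.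
have mg : measurable_fun setT g.
  apply/(measurable_restrictT _ mD); apply: (measurableT_comp mK).
  by apply: (measurable_funS _ _ (measurable_LogB k)); [exact: measurable_off_axis|move=> x []].
transitivity (\int[Leb R]_x g x).
  rewrite (integral_comb hw)//; congr (_ * _); rewrite [LHS]integral_mkcond.
  apply: eq_integral => x _; rewrite /g !patchE plane_ofK.
  by have -> : (plane_of (comb x) \in D) = (x \in inside) by apply/idP/idP; rewrite !inE => /D_inside.
rewrite ge0_integral_log_polar// [RHS]integral_mkcond; apply: eq_integral => u _; rewrite patchE.
case: ifPn => u0; last first.
  apply: integral0_eq => s _; rewrite /g patchE memNset ?mul0e// /D/= complex_of_exp_polar modulus_expC/=.
  move=> [_]; rewrite -expR0 ltr_expR => u1; move/negP: u0; apply.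
  by rewrite inE/= in_itv.
have {}u0 : (u < 0)%R by move: u0; rewrite inE/= in_itv.
(* These two angles give the points of the real axis, excluded from [D]. *)
have muN : mu [set 0%R; pi] = 0.
  by apply: countable_lebesgue_measure0; apply: finite_set_countable; exact: finite_set2.
have mN : measurable ([set 0%R; pi] : set R) by apply: measurableU; exact: measurable_set1.
have mu_ : measurable_fun setT (fun s : R => (u, s) : plane R).
  exact: measurable_fun_pair.
rewrite (@ge0_negligible_integral _ _ _ mu _ [set 0%R; pi])//; first last.
- by move=> s _; rewrite mule_ge0// lee_fin expR_ge0.
- apply: measurable_funTS; apply: emeasurable_funM => //.
  by apply: (measurableT_comp mg); exact: (measurableT_comp measurable_exp_polar).
rewrite [RHS](@ge0_negligible_integral _ _ _ mu _ [set 0%R; pi])//; first last.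
- by move=> s _; rewrite mule_ge0// lee_fin expR_ge0.
- apply: measurable_funTS; apply: emeasurable_funM => //.
  apply: (measurableT_comp mK); apply: measurable_fun_pair => //.
  exact: measurable_funD.
apply: eq_integral => s; rewrite inE/= in_itv/= => -[/andP[s0 s2] /not_orP[/eqP sn0 /eqP snp]].
congr (_ * _); rewrite /g patchE mem_set.
  by rewrite complex_of_exp_polar /LogB Log_polar ?s0//= /plane_of/= addr0.
split.
  rewrite /= mulf_neq0//; first by rewrite gt_eqF ?expR_gt0.
  have sgt : (0 < s)%R by rewrite lt_neqAle eq_sym sn0.
  have [sp|sp|sE] := ltgtP s pi.
  - by rewrite gt_eqF// sin_gt0_pi// sgt.
  - rewrite -(subrK pi s) sinDpi oppr_eq0 gt_eqF// sin_gt0_pi// subr_gt0 sp/=.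
    by move: s2; lra.
  - by rewrite sE eqxx in snp.
by rewrite complex_of_exp_polar modulus_expC/= -expR0 ltr_expR.
Qed.

End BranchPolar.

Lemma muleKe (R : realType) (c : R) (x y : \bar R) : c != 0 ->
  (c%:E * x = y -> x = c^-1%:E * y)%E.
Proof. by move=> c0 <-; rewrite muleA -EFinM mulVf// mul1e. Qed.

Lemma complex_ofK (R : realType) : cancel (@complex_of R) (@plane_of R).
Proof. by case. Qed.

(** The substitution t = v - B u, which maps u < 0 onto t > v. *)
Lemma ge0_integral_radial (R : realType) (J : R -> \bar R) (v B c : R) :
  measurable_fun setT J -> (forall t, 0 <= J t)%E -> 0 < B -> 0 <= c ->
  (\int[lebesgue_measure]_(u in `]-oo, 0%R[) (c%:E * ((expR (2 * u))%:E * J (v - B * u)%R)) =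
   (c / B)%:E * \int[lebesgue_measure]_(t in `[v, +oo[) ((expR (2 * (v - t) / B))%:E * J t))%E.
Proof.
move=> mJ J0 B0 c0.
pose H (t : R) : \bar R := ((expR (2 * (v - t) / B))%:E * J t)%E.
have mH : measurable_fun setT H.
  apply: emeasurable_funM => //; apply/measurable_EFinP.
  apply: (measurableT_comp (@measurable_expR R)); apply: measurable_funM => //.
  by apply: measurable_funM => //; exact: measurable_funB.
have H0 t : (0 <= H t)%E by rewrite mule_ge0// lee_fin expR_ge0.
pose G (u : R) : \bar R := H (v - B * u).
have mG : measurable_fun setT G.
  by apply: (measurableT_comp mH); apply: measurable_funB => //; exact: measurable_funM.
have G0 u : (0 <= G u)%E by exact: H0.
have GE u : ((expR (2 * u))%:E * J (v - B * u)%R)%E = G u.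
  by rewrite /G /H; congr ((expR _)%:E * _)%E; field; rewrite gt_eqF.
under eq_integral do rewrite GE.
rewrite ge0_integralZl//; last by apply: measurable_funTS; exact: mG.
rewrite -[X in (_ = _ * X)%E]/(\int[lebesgue_measure]_(t in `[v, +oo[) H t)%E.
rewrite -integral_itv_obnd_cbnd; last exact: measurable_funTS.
rewrite [X in (_ = _ * X)%E]integral_mkcond (@ge0_integral_affine _ (- B) v)//; first last.
- by apply: erestrict_ge0 => t _; exact: H0.
- exact: measurable_patch.
- by rewrite oppr_eq0 gt_eqF.
rewrite normrN gtr0_norm// muleA -EFinM divfK ?gt_eqF//; congr (_ * _)%E.
rewrite [LHS]integral_mkcond; apply: eq_integral => u _; rewrite !patchE.
have -> : (- B * u + v \in `]v, +oo[%classic) = (u \in `]-oo, 0%R[%classic).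
  by apply/idP/idP; rewrite !inE/= !in_itv/= andbT ltrDr mulNr oppr_gt0 pmulr_rlt0.
by rewrite mulNr addrC.
Qed.

(** * The limit density, term by term *)

Section DensityTerms.
Context {R : realType}.
Local Open Scope ereal_scope.
Notation mu := (@lebesgue_measure R).
Variables (alpha : R) (w1 w2 : R[i]).
Hypothesis alpha01 : (0 < alpha < 1)%R.
Hypothesis hw : real_independent w1 w2.
Local Notation lat := (lat w1 w2).
Local Notation comb := (lincomb w1 w2).
Local Notation inside := (inside w1 w2).

Let al0 : (0 < alpha)%R. Proof. by case/andP: alpha01. Qed.
Let al1 : (0 < 1 - alpha)%R. Proof. by case/andP: alpha01 => _; rewrite subr_gt0. Qed.

Lemma covol_gt0 : (0 < covol w1 w2)%R.
Proof. by rewrite covolE// normr_gt0 det2_neq0. Qed.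

(** The contribution of one lattice vector p to [rho], cut off at the radius |alpha lam p|. *)
Definition rho_term (lam : R) (p : R[i]) (x : plane R) : R :=
  if (alpha * lam * modulus p <= modulus (complex_of x))%R then
    (alpha `^ (2 / (1 - alpha)) / ((1 - alpha) * covol w1 w2)
     * (modulus (complex_of x) / lam) `^ (- ((4 - 2 * alpha) / (1 - alpha)))
     * modulus p `^ (2 / (1 - alpha)))%R
  else 0%R.

Lemma rho_term_ge0 lam p x : (0 <= rho_term lam p x)%R.
Proof.
rewrite /rho_term; case: ifP => // _; rewrite !mulr_ge0 ?powR_ge0// invr_ge0 ltW//.
by rewrite mulr_gt0// covol_gt0.
Qed.

Lemma measurable_rho_term lam p : measurable_fun setT (rho_term lam p).
Proof.
apply: measurable_fun_ifT => //.
  by apply: measurable_fun_ler => //; exact: measurable_modulus.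
apply: measurable_funM => //; apply: measurable_funM => //.
apply: (measurableT_comp (measurable_powR _)).
by apply: measurable_funM => //; exact: measurable_modulus.
Qed.

(** Vectors of S beyond the cutoff contribute 0, and p = 0, absent from S, has weight 0 since its
    exponent is nonzero. At x = 0 every term vanishes, in agreement with the value prescribed
    there. *)
Lemma rho_sum (lam : R) (S : set (int * int)) x : (0 < lam)%R -> finite_set S ->
  (forall q, S q -> q != 0%R) ->
  (forall q, q != 0%R -> (modulus (lat q) <= modulus (complex_of x) / (alpha * lam))%R -> S q) ->
  rho alpha w1 w2 lam%:E x = (\sum_(q <- finmap.enum_fset (fset_set S)) rho_term lam (lat q) x)%R.
Proof.
move=> l0 fS S0 hS; rewrite /rho gt_eqF//; set t := modulus _.
have all0 : (0 < alpha * lam)%R by rewrite mulr_gt0.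
have [t0|t0] := eqVneq t 0%R.
  rewrite big_seq big1// => q; rewrite in_fset_set// inE => /S0 q0.
  rewrite /rho_term -/t t0 leNgt mulr_gt0//= modulus_gt0.
  by rewrite (lat0 hw).
set e := (2 / (1 - alpha))%R; set c1 := (alpha `^ e / _)%R; set c2 := (_ `^ (- _))%R.
pose B := [set q | (modulus (lat q) <= t / (alpha * lam))%R].
have -> : [set p | lattice w1 w2 p /\ (modulus p <= t / (alpha * lam))%R] = lat @` B.
  rewrite latticeE; apply/seteqP; split => [p [[q _ <-] h]|p [q h <-]]; first by exists q.
  by split => //; exists q.
rewrite fsbig_image; last by move=> q q' _ _; exact: lat_inj.
have fB : finite_set B by exact: finite_lat_ball.
rewrite -fsbig_finite//.
have rE q : rho_term lam (lat q) x = (if (modulus (lat q) <= t / (alpha * lam)) then c1 * c2 * modulus (lat q) `^ e else 0)%R.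
  by rewrite /rho_term -/t -/c1 -/c2 -/e ler_pdivlMr// mulrC.
have e0 : e != 0%R by rewrite gt_eqF// divr_gt0.
have z q : q = 0%R -> (modulus (lat q) `^ e = 0)%R.
  move=> ->; have -> : lat (0 : int * int)%R = 0%R by apply/eqP; rewrite (lat0 hw).
  by rewrite modulus0 powR0.
rewrite -(@fsbig_widen _ _ _ _ (B `&` S) B); last 2 first.
- by move=> q [].
- move=> q [Bq nBS]; apply: z; apply/eqP; apply: contraT => q0; exfalso; apply: nBS.
  by split => //; exact: hS.
rewrite -(@fsbig_widen _ _ _ _ (B `&` S) S); last 2 first.
- by move=> q [].
- by move=> q [Sq nBS] /=; rewrite rE; case: ifPn => // h; exfalso; apply: nBS.
have fBS : finite_set (B `&` S) by apply: sub_finite_set fS => q [].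
rewrite !fsbig_finite// mulr_sumr; apply: eq_big_seq => q; rewrite in_fset_set// inE => -[Bq _].
by rewrite rE Bq.
Qed.

(** For finite positive lam, [rho] is the limit of sums over lattice discs of radius n, eventually
    constant at each x. *)
Lemma measurable_rho (lam : \bar R) : 0 <= lam -> measurable_fun setT (rho alpha w1 w2 lam).
Proof.
case: lam => [lam| |] lam0; rewrite ?lee_fin in lam0; last 2 first.
- exact: measurable_cst.
- exact: measurable_cst.
have [->|ln0] := eqVneq lam 0%R; first by rewrite /rho eqxx; exact: measurable_cst.
have l0 : (0 < lam)%R by rewrite lt_neqAle eq_sym ln0.
pose S (n : nat) := [set q | q != 0%R /\ (modulus (lat q) <= n%:R)%R].
have fS n : finite_set (S n) by apply: sub_finite_set (finite_lat_ball hw n%:R) => q [].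
apply: (@measurable_fun_cvg _ _ _ _ (fun n x => \sum_(q <- finmap.enum_fset (fset_set (S n))) rho_term lam (lat q) x)%R).
  by move=> n; apply: measurable_sum => q; exact: measurable_rho_term.
move=> x _; apply: (@cvg_trans _ (rho alpha w1 w2 lam%:E x @[n --> \oo])); last exact: cvg_cst.
apply: near_eq_cvg; near=> n; apply: rho_sum => //.
  by move=> q [].
move=> q q0 h; split => //; apply: (le_trans h).
near: n; exact: nbhs_infty_ger.
Unshelve. all: by end_near. Qed.

Lemma rho_ge0 (lam : \bar R) x : (0 <= rho alpha w1 w2 lam x)%R.
Proof.
have c0 := covol_gt0; rewrite /rho; case: lam => // l; case: ifP => _.
  rewrite divr_ge0 ?pi_ge0// ltW// !mulr_gt0// ?exprn_gt0//.
  by have := al1; lra.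
case: ifP => // _; apply: mulr_ge0; last by apply: fsumr_ge0 => *; exact: powR_ge0.
by rewrite mulr_ge0 ?powR_ge0// divr_ge0 ?powR_ge0// ltW// mulr_gt0.
Qed.

Variable f : R * R -> R.
Hypothesis f0 : forall x, (0 <= f x)%R.
Hypothesis cf : continuous f.
Local Notation lim_term := (lim_term alpha f).

Let mf : measurable_fun [set: plane R] (f : plane R -> R).
Proof. exact: continuous_measurable_plane. Qed.

(** The factor 1 / z is exp (- LogB k z), so the limit depends on z only through its logarithm. *)
Lemma lim_termE k z y : z != 0%R ->
  lim_term k k z y = f (plane_of (alpha%:C * y * expC ((alpha - 1)%:C * LogB k z))%R).
Proof.
move=> z0; rewrite /lim_term eqxx; congr (f (plane_of _)).
by rewrite rmorphB/= mulrBl mul1r expCB (expC_LogB k z0); ring.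
Qed.

Let inside_neq0 x : inside x -> comb x != 0%R.
Proof. by move=> [+ _]; apply: contra_neq => ->. Qed.

Lemma measurable_lim_term k y : measurable_fun inside (fun x => (lim_term k k (comb x) y)%:E).
Proof.
pose K (x : plane R) : \bar R := (f (plane_of (alpha%:C * y * expC ((alpha - 1)%:C * complex_of x))%R))%:E.
have mK : measurable_fun setT K.
  apply: measurable_seq_continuous => // x s t _ cs ct; apply/cvg_EFin; first exact: nearW.
  apply: cvg_plane_of => //; apply: cvgCM; first exact: cvgC_cst.
  by apply: cvgC_expC; apply: cvgCM; [exact: cvgC_cst|split].
apply: (eq_measurable_fun (fun x => K (plane_of (LogB k (comb x))))); last exact: measurable_branch.
move=> x; rewrite inE => /inside_neq0 x0.
by rewrite /K plane_ofK lim_termE.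
Qed.

(** Multiplication by B = alpha exp ((alpha - 1) LogB k z) scales area by |B|^2 = alpha^2 |z|^(2
    alpha - 2), and lattice coordinates contribute the covolume. *)
Lemma lim_term_area k z : z != 0%R ->
  \int[Leb R]_(y in [set y | comb y != 0%R]) (lim_term k k z (comb y))%:E =
  (covol w1 w2 * alpha ^+ 2)^-1%:E * \int[Leb R]_x (f x)%:E *
  (expR ((2 - 2 * alpha) * complex.Re (LogB k z)))%:E.
Proof.
move=> z0; set B := (alpha%:C * expC ((alpha - 1)%:C * LogB k z))%R.
have B0 : B != 0%R by rewrite mulf_neq0 ?expC_neq0// eq_complex/= gt_eqF.
have Bsq : (complex.Re B ^+ 2 + complex.Im B ^+ 2 = alpha ^+ 2 * expR ((2 * alpha - 2) * complex.Re (LogB k z)))%R.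
  rewrite -modulus_sqr /B modulusZ modulus_expC gtr0_norm// exprMn -expRM_natl.
  by congr (_ * expR _)%R; rewrite /=; ring.
have hB : real_independent (B * w1)%R (B * w2)%R.
  move=> x y; rewrite !(mulrCA _ B) -mulrDr => /eqP; rewrite mulf_eq0 (negbTE B0)/= => /eqP.
  exact: hw.
have dB : (det2 (B * w1) (B * w2) = (complex.Re B ^+ 2 + complex.Im B ^+ 2) * det2 w1 w2)%R.
  by rewrite /det2; case: (B) (w1) (w2) => [b1 b2] [x1 x2] [y1 y2] /=; ring.
have -> : \int[Leb R]_(y in [set y | comb y != 0%R]) (lim_term k k z (comb y))%:E =
    \int[Leb R]_y (f (plane_of (lincomb (B * w1) (B * w2) y)%R))%:E.
  set D := [set y | _].
  have DE : D = ~` ([set 0%R] `*` [set 0%R]).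
    apply/seteqP; split => -[s t]; rewrite /D/=.
      by move=> + [s0 t0]; rewrite s0 t0 /comb/= !mul0r addr0 eqxx.
    by move=> st; apply/eqP => /(hw)[s0 t0]; apply: st.
  have mD : measurable D by rewrite DE; apply: measurableC; exact: measurableX.
  have nD : Leb R (~` D) = 0.
    by rewrite DE setCK Leb_setX// lebesgue_measure_set1 mule0.
  have mF : measurable_fun setT (fun y => (f (plane_of (lincomb (B * w1) (B * w2) y)%R))%:E).
    by apply/measurable_EFinP; apply: (measurableT_comp mf); exact: measurable_comb.
  rewrite (@ge0_negligible_integral _ _ _ (Leb R) setT (~` D))//; last 2 first.
  - exact: measurableC.
  - by move=> y _; rewrite lee_fin.
  rewrite setTD setCK; apply: eq_integral => y _; rewrite lim_termE//; congr (f (plane_of _))%:E.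
  by rewrite /B /lincomb; ring.
rewrite [\int[Leb R]_x (f x)%:E](integral_comb hB); last 2 first.
- exact/measurable_EFinP.
- by move=> x; rewrite lee_fin.
have n0 : (0 <= alpha ^+ 2 * expR ((2 * alpha - 2) * complex.Re (LogB k z)))%R.
  by rewrite mulr_ge0 ?sqr_ge0 ?expR_ge0.
rewrite dB Bsq normrM (ger0_norm n0) -(covolE hw).
rewrite muleA -EFinM muleC muleA -EFinM.
set X := \int[_]_y _; rewrite -[LHS]mul1e; congr (_%:E * _).
have e0 : (expR ((2 - 2 * alpha) * complex.Re (LogB k z)) * expR ((2 * alpha - 2) * complex.Re (LogB k z)) = 1)%R.
  by rewrite -expRD -expR0; congr expR; ring.
have := covol_gt0; have := al0; move: e0; move: (expR _) (expR _) (covol _ _) => e1 e2 c e12 a0 c0.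
by rewrite -e12; field; rewrite !gt_eqF.
Qed.

(** The integral of |z|^(2 - 2 alpha) over the unit disc is 2 pi / (4 - 2 alpha), divided by the
    covolume in lattice coordinates. *)
Lemma integral_modulus_power k :
  \int[Leb R]_(x in inside) (expR ((2 - 2 * alpha) * complex.Re (LogB k (comb x))))%:E =
  (pi / ((2 - alpha) * covol w1 w2))%:E.
Proof.
have := al0; have := al1 => a1 a0.
have c0 := covol_gt0.
pose K (x : plane R) : \bar R := (expR ((2 - 2 * alpha) * x.1))%:E.
have mK : measurable_fun setT K.
  apply/measurable_EFinP; apply: (measurableT_comp (@measurable_expR R)).
  exact: measurable_funM.
have K0 x : 0 <= K x by rewrite lee_fin expR_ge0.
have m2pi : mu `[0%R, (2 * pi)%R[ = (2 * pi)%:E.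
  by rewrite lebesgue_measure_itv/= lte_fin mulr_gt0 ?pi_gt0// oppr0 adde0.
have := ge0_integral_branch hw k mK K0.
rewrite -covolE// => E.
have {}E : (covol w1 w2)%:E * \int[Leb R]_(x in inside) (expR ((2 - 2 * alpha) * complex.Re (LogB k (comb x))))%:E = (pi / (2 - alpha))%:E.
  rewrite E.
  transitivity (\int[mu]_(u in `]-oo, 0%R[) ((2 * pi)%:E * (expR ((4 - 2 * alpha) * u))%:E)).
    apply: eq_integral => u _; rewrite /K/=.
    under eq_integral do rewrite -EFinM -expRD.
    rewrite integral_cst//= [X in _ * X](_ : _ = (2 * pi)%:E) -?EFinM; last exact: m2pi.
    by rewrite mulrC; congr (_ * expR _)%:E; ring.
  rewrite ge0_integralZl//; last 2 first.
  - apply/measurable_EFinP; apply: measurable_funTS; apply: (measurableT_comp (@measurable_expR R)).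
    exact: measurable_funM.
  - by rewrite lee_fin mulr_ge0// pi_ge0.
  rewrite integral_expR_lt0; last by lra.
  rewrite -EFinM; congr EFin; field; apply/andP; split; apply/eqP; lra.
rewrite (muleKe _ E) ?gt_eqF// -EFinM; congr EFin.
by field; rewrite gt_eqF//=; apply/eqP; lra.
Qed.

Lemma exp_polar_period (t s : R) (m : int) :
  exp_polar (t, s + 2 * pi * m%:~R)%R = exp_polar (t, s) :> plane R.
Proof.
rewrite /exp_polar/=; congr (_ * _, _ * _)%R.
  by apply: periodic_intr; exact: cosD2pi.
by apply: periodic_intr; exact: sinD2pi.
Qed.

Variables (a b : nat).
Hypothesis hb : (0 < b)%N.
Hypothesis halpha : alpha = (a%:R / b%:R)%R.

Let b0 : (b%:R : R) != 0%R. Proof. by rewrite pnatr_eq0 -lt0n. Qed.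

Let winding : ((1 - alpha) * b%:R = (b - a)%:R)%R.
Proof.
have ab : (a <= b)%N.
  have : (alpha < 1)%R by case/andP: alpha01.
  by rewrite halpha ltr_pdivrMr ?ltr0n// mul1r ltr_nat => /ltnW.
by rewrite natrB// mulrBl mul1r halpha divfK.
Qed.

(** Both sides are multiples of [X], the integral over t >= v of the angular integral J(t) with
    weight W(t): [E1] treats the left side, [E2] the sum over the sheets. *)
Lemma rho_term_integral (lam : R) (p : R[i]) : (0 < lam)%R -> p != 0%R ->
  \int[Leb R]_x ((f x)%:E * (rho_term lam p x)%:E) =
  (b%:R^-1 * lam ^+ 2)%:E *
    \sum_(k < b) \int[Leb R]_(x in inside) (lim_term k k (comb x) (lam%:C * p)%R)%:E.
Proof.
move=> l0 p0; set B := (1 - alpha)%R.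
have m0 : (0 < modulus p)%R by rewrite modulus_gt0.
pose c := (alpha%:C * (lam%:C * p))%R.
have c_neq0 : c != 0%R by rewrite !mulf_neq0// eq_complex/= gt_eqF.
have mc : modulus c = (alpha * lam * modulus p)%R.
  by rewrite /c !modulusZ !gtr0_norm// mulrA.
(* v + i th is a logarithm of alpha lam p, and [lim_term] is f at the exponential of v + i th - (1 -
   alpha) LogB k z. *)
pose v := ln (modulus c); pose th := arg c.
have ev : expR v = (alpha * lam * modulus p)%R by rewrite /v lnK ?mc// posrE !mulr_gt0.
have cE : c = expC (v +i* th)%R by rewrite -[LHS](LogK c_neq0).
pose J (t : R) : \bar R := \int[mu]_(s in `[0%R, (2 * pi)%R[) (f (exp_polar (t, s)))%:E.
have mfp : measurable_fun setT (fun x : plane R => (f (exp_polar x))%:E).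
  by apply/measurable_EFinP; apply: (measurableT_comp mf); exact: measurable_exp_polar.
have mJ : measurable_fun setT J.
  apply: (@measurable_integral_strip _ (fun x => (f (exp_polar x))%:E)) => // x.
  by rewrite lee_fin.
have J0 t : 0 <= J t by apply: integral_ge0 => s _; rewrite lee_fin.
(* The Jacobian exp (2 u) of log-polar coordinates, at u = (v - t) / B. *)
pose W t := expR (2 * (v - t) / B).
have mWJ : measurable_fun setT (fun t => (W t)%:E * J t).
  apply: emeasurable_funM => //; apply/measurable_EFinP.
  apply: (measurableT_comp (@measurable_expR R)); apply: measurable_funM => //.
  by apply: measurable_funM => //; exact: measurable_funB.
have WJ0 t : 0 <= (W t)%:E * J t by rewrite mule_ge0// lee_fin expR_ge0.
pose X := \int[mu]_(t in `[v, +oo[) ((W t)%:E * J t).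
have c0 := covol_gt0.
have mfs (t : R) : measurable_fun setT (fun s : R => (f (exp_polar (t, s)))%:E).
  by apply: (measurableT_comp mfp); exact: measurable_fun_pair.
have E1 : \int[Leb R]_x ((f x)%:E * (rho_term lam p x)%:E) = (lam ^+ 2 / covol w1 w2 / B)%:E * X.
  rewrite ge0_integral_log_polar; last 2 first.
  - by apply: emeasurable_funM; apply/measurable_EFinP => //; exact: measurable_rho_term.
  - by move=> x; rewrite mule_ge0// lee_fin ?rho_term_ge0.
  rewrite -ge0_integralZl//; last 2 first.
  - exact: measurable_funTS.
  - by rewrite lee_fin !divr_ge0 ?sqr_ge0// ltW.
  rewrite [RHS]integral_mkcond; apply: eq_integral => t _; rewrite patchE.
  pose ct := (if (v <= t) then lam ^+ 2 / covol w1 w2 / B * W t else 0)%R.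
  transitivity (\int[mu]_(s in `[0%R, (2 * pi)%R[) (ct%:E * (f (exp_polar (t, s)))%:E)).
    apply: eq_integral => s _; rewrite -!EFinM; congr EFin.
    rewrite -mulrA mulrC; congr (_ * _)%R; rewrite /rho_term modulus_exp_polar/= -ev ler_expR /ct.
    case: ifP => _; last by rewrite mul0r.
    have pE (x y : R) : (0 < x)%R -> (x `^ y = expR (y * ln x))%R by move=> x0; rewrite /powR gt_eqF.
    have vE : v = (ln alpha + ln lam + ln (modulus p))%R.
      by rewrite /v mc !lnM ?posrE ?mulr_gt0.
    rewrite !pE ?divr_gt0 ?expR_gt0// ln_div ?posrE ?expR_gt0// expRK /W vE -/B.
    have -> : (lam ^+ 2 = expR (2 * ln lam))%R by rewrite mulrC expRM_natr lnK.
    have B0 : B != 0%R by rewrite gt_eqF.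
    set e1 := expR _; set e2 := expR _; set e3 := expR _; set e4 := expR _; set e5 := expR _; set e6 := expR _.
    have -> : (e5 / covol w1 w2 / B * e6 = (B * covol w1 w2)^-1 * (e5 * e6))%R.
      by field; rewrite B0 gt_eqF.
    have -> : (e1 / (B * covol w1 w2) * e2 * e3 * e4 = (B * covol w1 w2)^-1 * (e1 * e2 * e3 * e4))%R by ring.
    congr (_ * _)%R; rewrite /e1 /e2 /e3 /e4 /e5 /e6 -!expRD; congr expR.
    by rewrite /B in B0 *; field.
  have ct0 : (0 <= ct)%R.
    by rewrite /ct; case: ifP => // _; rewrite mulr_ge0 ?expR_ge0// !divr_ge0 ?sqr_ge0// ltW.
  rewrite ge0_integralZl//; last 2 first.
  - by apply: measurable_funTS; exact: (mfs t).
  - by move=> s _; rewrite lee_fin.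
  rewrite -/(J t) /ct.
  have -> : (t \in `[v, +oo[%classic) = (v <= t)%R by apply/idP/idP; rewrite inE/= in_itv/= andbT.
  by case: ifP; rewrite ?mul0e// EFinM muleA.
have E2 : (covol w1 w2)%:E * (\sum_(k < b) \int[Leb R]_(x in inside) (lim_term k k (comb x) (lam%:C * p)%R)%:E)
    = (b%:R / B)%:E * X.
  rewrite ge0_sume_distrr; last by move=> k _; apply: integral_ge0 => x _; rewrite lee_fin lim_term_ge0.
  pose K (x : plane R) : \bar R := (f (exp_polar (v - B * x.1, th - B * x.2)%R))%:E.
  have mK : measurable_fun setT K.
    apply: (measurableT_comp mfp); apply: measurable_fun_pair.
      by apply: measurable_funB => //; exact: measurable_funM.
    by apply: measurable_funB => //; exact: measurable_funM.
  have K0 x : 0 <= K x by rewrite lee_fin.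
  pose G (k : 'I_b) (u : R) := \int[mu]_(s in `[0%R, (2 * pi)%R[)
    (K (u, s + 2 * pi * k%:R)%R * (expR (2 * u))%:E).
  have mG k : measurable_fun setT (G k).
    apply: (@measurable_integral_strip _ (fun x => K (x.1, x.2 + 2 * pi * k%:R)%R * (expR (2 * x.1))%:E)) => //.
    - apply: emeasurable_funM.
        apply: (measurableT_comp mK); apply: measurable_fun_pair => //.
        exact: measurable_funD.
      apply/measurable_EFinP; apply: (measurableT_comp (@measurable_expR R)).
      exact: measurable_funM.
    - by move=> x; rewrite mule_ge0// lee_fin expR_ge0.
  have G0 k u : 0 <= G k u by apply: integral_ge0 => s _; rewrite mule_ge0// lee_fin expR_ge0.
  transitivity (\sum_(k < b) \int[mu]_(u in `]-oo, 0%R[) G k u).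
    apply: eq_bigr => k _; rewrite (covolE hw) /G -(ge0_integral_branch hw k mK K0); congr (_ * _).
    apply: eq_integral => x; rewrite inE => /inside_neq0 x0; rewrite lim_termE// -/c cE -expCD /K.
    congr (f _)%:E; rewrite -[RHS]complex_ofK; congr plane_of; rewrite complex_of_exp_polar.
    by congr expC; rewrite /plane_of/= /B; apply/eqP; rewrite eq_complex/=; apply/andP; split; apply/eqP; ring.
  rewrite -ge0_integral_sum//; last by move=> k; apply: measurable_funTS; exact: mG.
  transitivity (\int[mu]_(u in `]-oo, 0%R[) (b%:R%:E * ((expR (2 * u))%:E * J (v - B * u)%R))).
    apply: eq_integral => u _.
    transitivity (\sum_(k < b) ((expR (2 * u))%:E *
        \int[mu]_(s in `[0%R, (2 * pi)%R[) (f (exp_polar (v - B * u, th - B * (s + 2 * pi * k%:R))%R))%:E)).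
      apply: eq_bigr => k _; rewrite /G -ge0_integralZl//.
      - by apply: eq_integral => s _; rewrite muleC.
      - apply: measurable_funTS; apply: (measurableT_comp (mfs (v - B * u)%R)).
        by apply: measurable_funB => //; apply: measurable_funM => //; exact: measurable_funD.
      - by move=> s _; rewrite lee_fin.
    rewrite -ge0_sume_distrr; last by move=> k _; apply: integral_ge0 => s _; rewrite lee_fin.
    rewrite (@periodic_integral_wind _ (fun s => (f (exp_polar (v - B * u, s)%R))%:E) _ _ _ _ _ _ (b - a)%N)//.
    - by rewrite muleCA.
    - by move=> s; rewrite lee_fin.
    - by rewrite mulr_gt0// pi_gt0.
    - by move=> s m; rewrite exp_polar_period.
  exact: (@ge0_integral_radial R J v B b%:R mJ J0 al1 (ler0n R b)).
rewrite E1 (muleKe _ E2) ?gt_eqF// !muleA -!EFinM; congr (_%:E * _).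
by field; rewrite b0 !gt_eqF.
Qed.

End DensityTerms.

(** * Convergence for nonnegative test functions *)

Section NonnegLimit.
Context {R : realType}.
Local Open Scope ereal_scope.
Variables (a b : nat) (alpha : R) (z0 w1 w2 : R[i]) (phi psi : nat -> R)
  (f : R * R -> R) (C Fmax : R).
Hypothesis hb : (0 < b)%N.
Hypothesis halpha : alpha = (a%:R / b%:R)%R.
Hypothesis alpha01 : (0 < alpha < 1)%R.
Hypothesis hw : real_independent w1 w2.
Hypothesis phi0 : forall N, (0 < phi N)%R.
Hypothesis psi0 : forall N, (0 < psi N)%R.
Hypothesis phioo : phi N @[N --> \oo] --> +oo%R.
Hypothesis hpsi : forall N, (0 < N)%N -> psi N = ((N%:R `^ (2 - alpha) / phi N) ^+ 2)%R.
Hypothesis f0 : forall x, (0 <= f x)%R.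
Hypothesis fM : forall x, (f x <= Fmax)%R.
Hypothesis cf : continuous f.
Hypothesis fC : forall z, (f (plane_of z) != 0 -> modulus z <= C)%R.

Local Notation Mu N := (pair_measure alpha (grid z0 w1 w2) phi psi b N).
Local Notation lat := (lat w1 w2).
Local Notation comb := (lincomb w1 w2).
Local Notation good := (good w1 w2).
Local Notation inside := (inside w1 w2).
Local Notation mesh := (mesh alpha phi).
Local Notation inner_sum := (inner_sum alpha w1 w2 phi f).
Local Notation grid_seq := (grid_seq z0 w1 w2).
Local Notation gridpt := (gridpt z0 w1 w2).
Local Notation lim_term := (lim_term alpha f).

Let mf : measurable_fun [set: plane R] (f : plane R -> R).
Proof. exact: continuous_measurable_plane. Qed.

Let b0 : (b%:R : R) != 0%R. Proof. by rewrite pnatr_eq0 -lt0n. Qed.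

Lemma pair_integralE N : (0 < N)%N -> \int[Mu N]_x (f x)%:E =
  (b%:R^-1)%:E * \sum_(kl : 'I_b * 'I_b)
    (((N%:R^-1) ^+ 2)%:E * \esum_(q in setT) inner_sum N kl.1 kl.2 (gridpt q)).
Proof.
move=> N0; rewrite integral_pair_measure//.
have N0' : (0 < N%:R :> R)%R by rewrite ltr0n.
have -> : ((b%:R * psi N)^-1 = b%:R^-1 * ((N%:R^-1) ^+ 2 * mesh N ^+ 2))%R.
  rewrite invfM; congr (_ * _)%R; rewrite hpsi// /mesh.
  have -> : (N%:R `^ (2 - alpha) = N%:R * N%:R `^ (1 - alpha) :> R)%R.
    rewrite -[X in (X * _)%R](@powRr1 R N%:R)// -powRD; last by rewrite (gt_eqF N0') implybT.
    by congr (_ `^ _)%R; lra.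
  have P0 : (0 < N%:R `^ (1 - alpha) :> R)%R by rewrite powR_gt0.
  by field; rewrite !gt_eqF.
rewrite EFinM -muleA; congr (_ * _); rewrite ge0_sume_distrr; last first.
  by move=> kl _; apply: esum_ge0 => q _; apply: esum_ge0 => q' _; rewrite lee_fin pair_term_ge0.
apply: eq_bigr => kl _; rewrite EFinM -muleA; congr (_ * _).
rewrite -esumZ_int ?sqr_ge0// => q.
by apply: esum_ge0 => q' _; rewrite lee_fin pair_term_ge0.
Qed.

(** A finite sum over pairs of sheets of the limits of [outer_limit], of which only the diagonal
    survives. *)
Lemma pair_integral_limit (F : nat -> plane R -> \bar R) :
  (forall k l x, good x -> (modulus (comb x) < 1)%R ->
    inner_sum N k l (grid_seq x N) @[N --> \oo] --> (if k == l then F k x else 0)) ->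
  \int[Mu N]_x (f x)%:E @[N --> \oo] -->
    (b%:R^-1)%:E * \sum_(k < b) \int[Leb R]_(x in inside) F k x /\
  (b%:R^-1)%:E * (\sum_(k < b) \int[Leb R]_(x in inside) F k x) < +oo.
Proof.
move=> hF.
have mg : measurable good := measurable_good _ _ measurable_off_axis_circle.
pose Finf k l x := if (modulus (comb x) < 1)%R && (k == l) then F k x else 0.
have L k l : (((N%:R^-1) ^+ 2)%:E * \esum_(q in setT) inner_sum N k l (gridpt q)) @[N --> \oo] -->
    \int[Leb R]_(x in good) Finf k l x /\ \int[Leb R]_(x in good) Finf k l x < +oo.
  apply: (outer_limit alpha01 hw phi0 f0 fM fC) => //; last exact: Leb_good.
  - by move=> x gx x1; rewrite /Finf x1; exact: hF.
  - by move=> x gx x1; rewrite /Finf ltNge ltW.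
have E k l : \int[Leb R]_(x in good) Finf k l x =
    if k == l then \int[Leb R]_(x in inside) F k x else 0.
  case: ifPn => kl; last by apply: integral0_eq => x _; rewrite /Finf (negbTE kl) andbF.
  rewrite [LHS]integral_mkcond [RHS]integral_mkcond; apply: eq_integral => x _.
  rewrite !patchE /Finf kl andbT.
  have -> : (x \in inside) = (x \in good) && (modulus (comb x) < 1)%R.
    apply/idP/andP; rewrite !inE; first by move=> [h1 h2]; split => //; split => //; rewrite lt_eqF.
    by move=> [[h1 _] h2].
  by case: (x \in good); case: (modulus (comb x) < 1)%R.
have sumE : \sum_(kl : 'I_b * 'I_b) \int[Leb R]_(x in good) Finf kl.1 kl.2 x =
    \sum_(k < b) \int[Leb R]_(x in inside) F k x.
  rewrite -(pair_bigA _ (fun k l : 'I_b => \int[Leb R]_(x in good) Finf k l x)).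
  apply: eq_bigr => k _; rewrite (bigD1 k)//= E eqxx big1 ?adde0// => l.
  by rewrite -val_eqE eq_sym E => /negbTE ->.
split.
  rewrite -sumE; apply: (@cvg_trans _ ((b%:R^-1)%:E * \sum_(kl : 'I_b * 'I_b)
    (((N%:R^-1) ^+ 2)%:E * \esum_(q in setT) inner_sum N kl.1 kl.2 (gridpt q)) @[N --> \oo])).
    apply: near_eq_cvg; near=> N; apply/esym; apply: pair_integralE.
    by near: N; exact: nbhs_infty_gt.
  apply: cvgeZl => //; apply: cvg_nnesum => kl _; last by case: (L kl.1 kl.2).
  apply: nearW => N; rewrite mule_ge0 ?lee_fin ?sqr_ge0//; apply: esum_ge0 => q _.
  exact: inner_sum_ge0.
apply: lte_mul_pinfty => //.
apply: lte_sum_pinfty => k _; have := (L k k).2; by rewrite E eqxx.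
Unshelve. all: by end_near. Qed.

Let sum_cst (X : \bar R) : (b%:R^-1)%:E * (\sum_(k < b) X) = X.
Proof.
have -> : \sum_(k < b) X = b%:R%:E * X by rewrite sumr_const card_ord mule_natl.
by rewrite muleA -EFinM mulVf// mul1e.
Qed.

Let inside_neq0 x : inside x -> comb x != 0%R.
Proof. by move=> [+ _]; apply: contra_neq => ->. Qed.

Let fin0 : 0 <= \int[Leb R]_x (f x)%:E.
Proof. by apply: integral_ge0 => x _; rewrite lee_fin. Qed.

(** The limit is the product of the constants of [lim_term_area] and [integral_modulus_power]; it is
    the same on each sheet, so averaging over the b sheets leaves it unchanged. *)
Lemma pair_integral_cvg_0 : mesh N @[N --> \oo] --> (0 : R)%R ->
  \int[Mu N]_x (f x)%:E @[N --> \oo] -->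
    \int[Leb R]_x ((f x)%:E * (rho alpha w1 w2 0%:E x)%:E) /\
  \int[Leb R]_x ((f x)%:E * (rho alpha w1 w2 0%:E x)%:E) < +oo.
Proof.
have /andP[al0 al1] := alpha01; have c0 := covol_gt0 hw; move=> hm.
pose F k x := \int[Leb R]_(y in [set y | comb y != 0%R]) (lim_term k k (comb x) (comb y))%:E.
have H (k l : nat) x : good x -> (modulus (comb x) < 1)%R ->
    inner_sum N k l (grid_seq x N) @[N --> \oo] --> (if k == l then F k x else 0).
  move=> gx x1; have := inner_limit_0 z0 alpha01 hw phi0 phioo f0 fM cf fC (k := k) (l := l) gx x1 hm.
  case: eqVneq => [<-//|kl]; rewrite integral0_eq// => y _.
  by rewrite /lim_term (negbTE kl).
set A := (covol w1 w2 * alpha ^+ 2)^-1%:E * \int[Leb R]_x (f x)%:E.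
have A0 : 0 <= A by rewrite mule_ge0// lee_fin invr_ge0 mulr_ge0 ?sqr_ge0// ltW.
have FE k : \int[Leb R]_(x in inside) F k x = A * (pi / ((2 - alpha) * covol w1 w2))%:E.
  rewrite -(integral_modulus_power alpha01 hw k).
  rewrite -ge0_integralZl//; first last.
  - pose K (x : plane R) : \bar R := (expR ((2 - 2 * alpha) * x.1))%:E.
    have mK : measurable_fun setT K.
      by apply/measurable_EFinP; apply: (measurableT_comp (@measurable_expR R)); exact: measurable_funM.
    by apply: (eq_measurable_fun (fun x => K (plane_of (LogB k (comb x))))); last exact: measurable_branch.
  - exact: measurable_inside.
  by apply: eq_integral => x; rewrite inE => /inside_neq0 x0; rewrite /F lim_term_area.
have := pair_integral_limit H.
rewrite (eq_bigr (fun=> A * (pi / ((2 - alpha) * covol w1 w2))%:E)); last by move=> k _; exact: FE.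
rewrite sum_cst.
suff -> : \int[Leb R]_x ((f x)%:E * (rho alpha w1 w2 0%:E x)%:E) =
  A * (pi / ((2 - alpha) * covol w1 w2))%:E by [].
rewrite /rho eqxx ge0_integralZr//; last 3 first.
- exact/measurable_EFinP.
- by move=> x _; rewrite lee_fin.
- have := rho_ge0 alpha01 hw 0%:E (0, 0)%R; rewrite /rho eqxx => h; by rewrite lee_fin.
rewrite muleC /A muleAC -EFinM; congr (_%:E * _).
by field; rewrite !gt_eqF//= subr_gt0; lra.
Qed.

Lemma pair_integral_cvg_pos (lam : R) : (0 < lam)%R -> mesh N @[N --> \oo] --> lam ->
  \int[Mu N]_x (f x)%:E @[N --> \oo] -->
    \int[Leb R]_x ((f x)%:E * (rho alpha w1 w2 lam%:E x)%:E) /\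
  \int[Leb R]_x ((f x)%:E * (rho alpha w1 w2 lam%:E x)%:E) < +oo.
Proof.
move=> l0 hm; have /andP[al0 al1] := alpha01.
have [A hA] := inner_limit_pos z0 alpha01 hw phi0 phioo f0 cf fC l0 hm.
(* The radius A serves the inner sums; C / (alpha lam) makes S contain every nonzero p counted by
   [rho] at a point of the support of f. *)
pose S := [set q | q != 0%R /\ (modulus (lat q) <= Num.max A (C / (alpha * lam)))%R].
have fS : finite_set S by apply: sub_finite_set (finite_lat_ball hw _) => q [_]; exact.
have S0 q : S q -> q != 0%R by case.
have SA q : q != 0%R -> (modulus (lat q) <= A)%R -> S q.
  by move=> q0 h; split => //; rewrite le_max h.
pose t (q : int * int) k x := (lim_term k k (comb x) (lam%:C * lat q)%R)%:E.
pose F k x := (lam ^+ 2)%:E * \sum_(q <- finmap.enum_fset (fset_set S)) t q k x.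
have H (k l : nat) x : good x -> (modulus (comb x) < 1)%R ->
    inner_sum N k l (grid_seq x N) @[N --> \oo] --> (if k == l then F k x else 0).
  move=> gx x1; have := hA S fS S0 SA k l x gx x1.
  case: eqVneq => [<-//|kl]; rewrite big1 ?mule0// => q _.
  by rewrite /lim_term (negbTE kl).
have t0 q k x : 0 <= t q k x by rewrite lee_fin lim_term_ge0.
have mt q k : measurable_fun inside (t q k) by exact: measurable_lim_term.
have mI := measurable_inside w1 w2.
have l2 : 0 <= (lam ^+ 2)%:E by rewrite lee_fin sqr_ge0.
have FE k : \int[Leb R]_(x in inside) F k x =
    \sum_(q <- finmap.enum_fset (fset_set S)) ((lam ^+ 2)%:E * \int[Leb R]_(x in inside) t q k x).
  rewrite /F ge0_integralZl//; last 2 first.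
  - by apply: emeasurable_sum => q; exact: mt.
  - by move=> x _; apply: sume_ge0 => q _; exact: t0.
  rewrite ge0_integral_sum//.
  by rewrite ge0_sume_distrr// => q _; apply: integral_ge0.
have := pair_integral_limit H.
suff -> : \int[Leb R]_x ((f x)%:E * (rho alpha w1 w2 lam%:E x)%:E) =
  (b%:R^-1)%:E * (\sum_(k < b) \int[Leb R]_(x in inside) F k x) by [].
under [in RHS]eq_bigr do rewrite FE.
rewrite exchange_big/= ge0_sume_distrr; last first.
  by move=> q _; apply: sume_ge0 => k _; rewrite mule_ge0//; apply: integral_ge0.
transitivity (\int[Leb R]_x \sum_(q <- finmap.enum_fset (fset_set S)) ((f x)%:E * (rho_term alpha w1 w2 lam (lat q) x)%:E)).
  apply: eq_integral => x _; rewrite -ge0_sume_distrr; last first.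
    by move=> q _; rewrite lee_fin rho_term_ge0.
  have [fx0|fx0] := eqVneq (f x) 0%R; first by rewrite fx0 !mul0e.
  rewrite sumEFin; congr (_ * _%:E); apply: rho_sum => // q q0 h; split => //.
  rewrite le_max; apply/orP; right; apply: (le_trans h).
  rewrite ler_pM2r ?invr_gt0 ?mulr_gt0//; apply: fC.
  by rewrite complex_ofK.
rewrite ge0_integral_sum//; last 2 first.
- by move=> q; apply: emeasurable_funM; apply/measurable_EFinP => //; exact: measurable_rho_term.
- by move=> q x _; rewrite mule_ge0 ?lee_fin// rho_term_ge0.
apply: eq_big_seq => q; rewrite in_fset_set// inE => -[q0 _].
rewrite (rho_term_integral alpha01 hw f0 cf hb halpha)//; last by rewrite (lat0 hw).
rewrite -ge0_sume_distrr; last by move=> k _; apply: integral_ge0.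
by rewrite muleA -EFinM.
Qed.

Lemma pair_integral_cvg (lam : \bar R) : 0 <= lam ->
  (mesh N)%:E @[N --> \oo] --> lam ->
  \int[Mu N]_x (f x)%:E @[N --> \oo] -->
    \int[Leb R]_x ((f x)%:E * (rho alpha w1 w2 lam x)%:E) /\
  \int[Leb R]_x ((f x)%:E * (rho alpha w1 w2 lam x)%:E) < +oo.
Proof.
have /andP[al0 al1] := alpha01; have c0 := covol_gt0 hw.
case: lam => [lam| |] //.
- rewrite lee_fin le_eqVlt => /orP[/eqP <-|l0] /fine_cvgP[_ hm].
    exact: pair_integral_cvg_0 hm.
  exact: pair_integral_cvg_pos hm.
- move=> _ /cvgeryP hm.
  have H (k l : nat) x : good x -> (modulus (comb x) < 1)%R ->
      inner_sum N k l (grid_seq x N) @[N --> \oo] --> (if k == l then 0 else 0 : \bar R).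
    move=> _ _; rewrite if_same.
    apply: (@cvg_trans _ ((0 : \bar R) @[N --> \oo])); last exact: cvg_cst.
    apply: near_eq_cvg; have := inner_limit_oo alpha01 hw phi0 fC hm.
    by apply: filterS => N ->.
  have := pair_integral_limit (F := fun _ _ => 0) H.
  have -> : \int[Leb R]_x ((f x)%:E * (rho alpha w1 w2 +oo x)%:E) = 0.
    by apply: integral0_eq => x _; rewrite /rho mule0.
  have -> : \sum_(k < b) \int[Leb R]_(x in inside) (0 : \bar R) = 0.
    by rewrite big1// => k _; apply: integral0_eq.
  by rewrite mule0.
Qed.

End NonnegLimit.

(** * Test functions of arbitrary sign *)

Lemma compact_support_bounds (R : realType) (f : R * R -> R) : continuous f ->
  compact (closure [set x | f x != 0]) ->
  exists C Fmax : R, (forall z, f (plane_of z) != 0 -> modulus z <= C) /\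
    (forall x, `|f x| <= Fmax).
Proof.
move=> cf kf; have [M [_ hM]] := compact_bounded kf.
have [M' [_ hM']] := compact_bounded (continuous_compact (continuous_subspaceT cf) kf).
(* The norm of R * R is the maximum of the coordinates, whence the factor 2; M and M' are bounds
   only from strictly above, whence the 1; the 0 covers the points where f vanishes. *)
exists (2 * (M + 1)), (Num.max 0 (M' + 1)); split.
  move=> z fz; have M1 : M < M + 1 by rewrite ltrDl.
  have := hM (M + 1) M1 (plane_of z) (@subset_closure _ [set x | f x != 0] (plane_of z) fz).
  rewrite /= prod_normE ge_max => /andP[h1 h2].
  apply: (le_trans (modulus_le z)); rewrite mulr_natl mulr2n; exact: lerD.
move=> x; have [->|fx] := eqVneq (f x) 0; first by rewrite normr0 le_max lexx.
rewrite le_max; apply/orP; right; apply: (hM' (M' + 1)) => /=; first by rewrite ltrDl.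
by exists x => //; exact: subset_closure.
Qed.

Theorem theorem2p2 (R : realType) (a b : nat) (alpha : R)
    (z0 w1 w2 : R[i]) (phi psi : nat -> R) (lam : \bar R)
    (ha : (0 < a)%N) (hb : (0 < b)%N) (hab : coprime a b)
    (halpha : alpha = a%:R / b%:R) (halpha01 : 0 < alpha < 1)
    (hw : real_independent w1 w2)
    (hphi0 : forall N, 0 < phi N) (hpsi0 : forall N, 0 < psi N)
    (hlam : (0 <= lam)%E)
    (hphi : phi N @[N --> \oo] --> +oo)
    (hphilam : (phi N / N%:R `^ (1 - alpha))%:E @[N --> \oo] --> lam)
    (hpsi : forall N, (0 < N)%N ->
      psi N = (N%:R `^ (2 - alpha) / phi N) ^+ 2) :
  vague_cvg (pair_measure alpha (grid z0 w1 w2) phi psi b)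
            (with_density (rho alpha w1 w2 lam) (Leb R)).
Proof.
move=> f cf kf; have [C [Fmax [fC fM]]] := compact_support_bounds cf kf.
(* A nonnegative g below |f| inherits the bounds C and Fmax of f; this is applied to f^+ and f^-. *)
have part (g : R * R -> R) : continuous g -> (forall x, 0 <= g x <= `|f x|) ->
    (\int[pair_measure alpha (grid z0 w1 w2) phi psi b N]_x (g x)%:E)%E @[N --> \oo] -->
      (\int[Leb R]_x ((g x)%:E * (rho alpha w1 w2 lam x)%:E))%E /\
    (\int[Leb R]_x ((g x)%:E * (rho alpha w1 w2 lam x)%:E) < +oo)%E.
  move=> cg gf; apply: (pair_integral_cvg z0 hb halpha halpha01 hw hphi0 hpsi0 hphi hpsi
    (C := C) (Fmax := Fmax)) => //.
  - by move=> x; case/andP: (gf x).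
  - by move=> x; case/andP: (gf x) => _ /le_trans; apply.
  - move=> z gz; apply: fC; apply: contra_neq gz => fz.
    by apply/eqP; rewrite eq_le; case/andP: (gf (plane_of z)) => -> +; rewrite fz normr0 => ->.
have cpos : continuous (f^\+)%R.
  by apply: max_fun_continuous => //; exact: cst_continuous.
have cneg : continuous (f^\-)%R.
  by apply: max_fun_continuous; [move=> x; apply: cvgN; exact: cf|exact: cst_continuous].
have bpos x : 0 <= (f^\+ x)%R <= `|f x|.
  by rewrite funrpos_ge0 ge_max ler_norm normr_ge0.
have bneg x : 0 <= (f^\- x)%R <= `|f x|.
  by rewrite funrneg_ge0 ge_max -normrN ler_norm normr_ge0.
have [pos_cvg pos_fin] := part _ cpos bpos; have [neg_cvg neg_fin] := part _ cneg bneg.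
have muE N : (\int[pair_measure alpha (grid z0 w1 w2) phi psi b N]_x (f x)%:E =
    \int[pair_measure alpha (grid z0 w1 w2) phi psi b N]_x (f^\+ x)%R%:E -
    \int[pair_measure alpha (grid z0 w1 w2) phi psi b N]_x (f^\- x)%R%:E)%E.
  have [nu -> _] := pair_measure_measure alpha z0 phi b hw hpsi0 N.
  by rewrite integralE -[(fun x => (f x)%:E)]/(EFin \o f) funerpos funerneg.
have mr := measurable_rho halpha01 hw hlam.
pose nu := density_pack (Leb R) mr (rho_ge0 halpha01 hw lam).
have nuE : (\int[with_density (rho alpha w1 w2 lam) (Leb R)]_x (f x)%:E =
    \int[Leb R]_x ((f^\+ x)%R%:E * (rho alpha w1 w2 lam x)%:E) -
    \int[Leb R]_x ((f^\- x)%R%:E * (rho alpha w1 w2 lam x)%:E))%E.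
  rewrite -[with_density _ _]/(nu : set (plane R) -> \bar R).
  rewrite integralE -[(fun x => (f x)%:E)]/(EFin \o f) funerpos funerneg.
  congr (_ - _)%E; apply: (ge0_integral_density mr (rho_ge0 halpha01 hw lam)) => //.
  - by apply/measurable_EFinP; exact: (continuous_measurable_plane cpos).
  - by move=> x; rewrite /= lee_fin funrpos_ge0.
  - by apply/measurable_EFinP; exact: (continuous_measurable_plane cneg).
  - by move=> x; rewrite /= lee_fin funrneg_ge0.
under eq_fun do rewrite muE.
(* The limit of the negative part is finite, so the difference of the limits is defined. *)
rewrite nuE; apply: cvgeB => //; apply: fin_num_adde_defl.
rewrite fin_numN ge0_fin_numE//; apply: integral_ge0 => x _.
by rewrite mule_ge0 ?lee_fin ?rho_ge0// funrneg_ge0.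
Qed.
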